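(* Let $(M,g)$ be a $d$-dimensional Lipschitz Riemannian (LR) manifold with volume measure $\mathfrak v$ and heat kernel $\mathsf p$. Suppose that $\mathcal k\colon M\to\mathbb R$ is a Borel function that can be decomposed as $\mathcal k=\mathcal k_1+\mathcal k_2$ into the sum of two Borel functions $\mathcal k_1,\mathcal k_2\colon M\to\mathbb R$ such that (a) $\mathcal k_2\in L^\infty(M,\mathfrak v)$, and (b) there exist $p\in[1,\infty)$ if $d=1$, or $p\in(d/2,\infty)$ if $d\ge2$, and a heat kernel control pair $(\Xi,\Sigma)$ such that $\mathcal k_1\in L^p(M,\Xi\,\mathfrak v)$. Then for every $s\in(0,1]$ and every $x\in M$, $$\int_M\mathsf p(s,x,\cdot)\,|\mathcal k|\,d\mathfrak v\le C^{1/p}\,\Sigma^{1/p}(s)\,\|\mathcal k_1\|_{L^p(M,\Xi\,\mathfrak v)}+\|\mathcal k_2\|_{L^\infty(M)},$$ where $C>0$ is a constant with $\sup_{y\in M}\mathsf p(t,x,y)\le C\,\Sigma(t)\,\Xi(x)$ for every $x\in M$, $t\in(0,1]$. In particular, for every choice of $(\Xi,\Sigma)$ and $p$ as in (b) and every $\mathcal k\in L^p(M,\Xi\,\mathfrak v)+L^\infty(M,\mathfrak v)$, we have $\mathcal k\,\mathfrak v\in\mathscr K(M)$.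
   Context: LR manifolds. A $d$-dimensional Lipschitz manifold, $d\in\mathbb N$, is a second countable Hausdorff space $M$ with an atlas $(U_\alpha,\Phi_\alpha)_{\alpha\in A}$: the $U_\alpha$ are an open cover, each $\Phi_\alpha$ is a homeomorphism of $U_\alpha$ onto an open subset of $\mathbb R^d$ or of $\mathbb R^{d-1}\times[0,\infty)$, and all transition maps $\Phi_{\alpha'}\circ\Phi_\alpha^{-1}$ (defined on $\Phi_\alpha(U_\alpha\cap U_{\alpha'})$) are locally Lipschitz. $M$ is always connected and paracompact and the atlas locally finite with countable sub-atlas; a boundary is allowed and completeness is not assumed. A Riemannian metric $g=(g_\alpha)_{\alpha\in A}$ is a family of scalar products $g_\alpha$ on $\mathbb R^d$ with Borel coefficients depending on the point of $\Phi_\alpha(U_\alpha)$, compatible in the sense that $(\Phi_{\alpha'}\circ\Phi_\alpha^{-1})_*g_\alpha=g_{\alpha'}$ holds $\mathcal L^d$-a.e. on $\Phi_{\alpha'}(U_\alpha\cap U_{\alpha'})$. It is always assumed locally Lipschitz: for every $\alpha$ there is $c_\alpha\ge1$ with $c_\alpha^{-1}\|\omega\|_{\rm E}\le\|\omega\|_{g_\alpha}\le c_\alpha\|\omega\|_{\rm E}$ for all smooth $1$-forms $\omega$ compactly supported in $U_\alpha$ (with $\|\cdot\|_{\rm E},\|\cdot\|_{g_\alpha}$ the $L^2$-norms of $1$-forms on $\Phi_\alpha(U_\alpha)$ for the Euclidean metric, resp. $g_\alpha$); accordingly for every $\alpha$ there is $\lambda_\alpha\ge1$ with $\lambda_\alpha^{-1}|\xi|^2\le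 g_\alpha(\xi,\xi)\le\lambda_\alpha|\xi|^2$ for all $\xi\in\mathbb R^d$, $\mathcal L^d$-a.e. on $\Phi_\alpha(U_\alpha)$. Such a pair $(M,g)$ is an LR manifold. Volume and heat kernel. The volume measure $\mathfrak v$ is given by $\int f\,d\mathfrak v=\int_{\Phi_\alpha(U_\alpha)}f\circ\Phi_\alpha^{-1}\sqrt{\det g_\alpha}\,d\mathcal L^d$ for bounded Borel $f\ge0$ supported in $U_\alpha$. For (weakly) differentiable $f$, $|df|^2\circ\Phi_\alpha^{-1}=g_\alpha^*(d(f\circ\Phi_\alpha^{-1}),d(f\circ\Phi_\alpha^{-1}))$ a.e., $g_\alpha^*$ the co-metric. $W^{1,2}(M)$ is the space of $f\in L^2(M,\mathfrak v)$ with chartwise weak differentials (locally $L^2$) and $|df|\in L^2(M,\mathfrak v)$. $\mathcal E(f)=\frac12\int_M|df|^2\,d\mathfrak v$ with domain $W^{1,2}(M)$ is a strongly local, regular Dirichlet form on $L^2(M,\mathfrak v)$; its nonpositive self-adjoint generator is denoted $\Delta/2$, and $\mathsf P_t=e^{t\Delta/2}$ is the heat flow. The heat kernel $\mathsf p\colon(0,\infty)\times M^2\to(0,\infty)$ is the jointly locally Hölder continuous integral kernel of $(\mathsf P_t)$ with respect to $\mathfrak v$. Kato class. $\mathscr K(M)$ consists of all signed Borel measures $\kappa$ on $M$ which do not charge $\mathcal E$-polar sets and satisfy $\lim_{t\to0}\sup_{x\in M}\int_0^t\int_M\mathsf p(s,x,\cdot)\,d|\kappa|\,ds=0$. (For a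 Borel function $\mathcal k$, $|\mathcal k\,\mathfrak v|=|\mathcal k|\,\mathfrak v$, and the measure is not required to be finite.) Heat kernel control pair for $(M,g)$: an ordered pair $(\Xi,\Sigma)$ such that (i) $\Xi\colon M\to(0,\infty)$ is continuous and bounded away from zero; (ii) $\Sigma\colon(0,1]\to(0,\infty)$ is Borel measurable; (iii) there is $C>0$ with $\sup_{y\in M}\mathsf p(t,x,y)\le C\,\Sigma(t)\,\Xi(x)$ for every $x\in M$ and $t\in(0,1]$; (iv) for every $p\in[1,\infty)$ if $d=1$, and every $p\in(d/2,\infty)$ if $d\ge2$, there is $C>0$ with $\int_0^1\Sigma^{1/p}(t)\,e^{-Ct}\,dt<\infty$. *)

(* Defs.v *)
From HB Require Import structures.
From mathcomp Require Import all_boot all_order all_algebra.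
From mathcomp Require Import all_classical all_reals all_analysis.
From mathcomp Require Import measurable_realfun lra.
Set Implicit Arguments. Unset Strict Implicit. Unset Printing Implicit Defensive.
Import Order.TTheory GRing.Theory Num.Theory.
Import numFieldNormedType.Exports.
Local Open Scope classical_set_scope.
Local Open Scope ring_scope.
Notation borel T := (g_sigma_algebraType (@open T)).

Lemma open_borel (T : ptopologicalType) (A : set T) :
  open A -> measurable (A : set (borel T)).
Proof. by move=> oA; exact: sub_sigma_algebra. Qed.

Lemma rV_rat_ball (R : realType) n (O : set 'rV[R]_n) x : open O -> O x ->
  exists q : 'rV[rat]_n * nat,
    let b := [set y : 'rV[R]_n | forall i, `|y 0 i - ratr (q.1 0 i)| < q.2.+1%:R^-1] in
    b x /\ b `<=` O.
Proof.
move=> oO Ox; have /nbhs_ballP[e /= e0 eO] : nbhs x O by exact: open_nbhs_nbhs.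
have [k ke] : exists k : nat, k.+1%:R^-1 < e / 2.
  have e20 : 0 < (e / 2)^-1 by rewrite invr_gt0 divr_gt0.
  exists (Num.trunc (e / 2)^-1).
  by rewrite invf_plt ?posrE ?divr_gt0// truncnS_gt.
have kpos : 0 < k.+1%:R^-1 :> R by rewrite invr_gt0.
have qE i : exists q : rat, `|x 0 i - ratr q| < k.+1%:R^-1.
  have : x 0 i - k.+1%:R^-1 < x 0 i + k.+1%:R^-1.
    by rewrite ltrD2l gtrN.
  move=> /rat_in_itvoo[q]; rewrite in_itv/= => /andP[q1 q2].
  by exists q; rewrite ltr_norml; apply/andP; split; move: q1 q2; move: (k.+1%:R^-1) => r *; lra.
have [q qP] := choice qE.
exists (\row_i q i, k) => /=; split=> [i|y yq]; first by rewrite mxE.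
apply: eO; split => // i j; rewrite [i]ord1 -ball_normE /=.
have := yq j; have := qP j; rewrite /= mxE => h1 h2.
rewrite (le_lt_trans (ler_distD (ratr (q j)) _ _))//.
rewrite (distrC (ratr _)).
by move: ke h1 h2; move: (k.+1%:R^-1) => r *; lra.
Qed.


Lemma measurable_borel_coord (R : realType) n (i : 'I_n) :
  measurable_fun setT (fun z : borel 'rV[R]_n => (z : 'rV[R]_n) 0 i : R).
Proof.
apply: (measurability _ (RGenOpens.measurableE R)) => _ [_ [a [b ->]] <-].
rewrite setTI; apply: open_borel; apply: open_comp; last exact: interval_open.
by move=> z _; exact: coord_continuous.
Qed.

Lemma measurable_fun_rV d (T : measurableType d) (R : realType) n
    (f : T -> borel 'rV[R]_n) :
  (forall i, measurable_fun setT (fun x => (f x : 'rV[R]_n) 0 i : R)) ->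
  measurable_fun setT f.
Proof.
move=> mf; apply: (@measurability _ _ _ (borel 'rV[R]_n) _ _ (@open 'rV[R]_n)) => // _ [V oV <-].
rewrite setTI.
pose b (q : 'rV[rat]_n * nat) :=
  [set y : 'rV[R]_n | forall i, `|y 0 i - ratr (q.1 0 i)| < q.2.+1%:R^-1].
pose F k := if unpickle k is Some q then
  if `[< b q `<=` V >] then f @^-1` b q else set0 else set0.
have -> : f @^-1` V = \bigcup_k F k.
  apply/seteqP; split => [x /= Vx|x [k _]]; last first.
    rewrite /F; case: unpickle => //= q; case: asboolP => // bO fx.
    exact: bO.
  have [q /= [bq bO]] := rV_rat_ball oV Vx.
  by exists (pickle q) => //; rewrite /F pickleK asboolT.
apply: bigcupT_measurable => k; rewrite /F; case: unpickle => //= q.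
case: asboolP => // _.
have -> : f @^-1` b q = \bigcap_(i in [set: 'I_n])
    ((fun x => `|(f x : 'rV[R]_n) 0 i - ratr (q.1 0 i)|) @^-1`
      `]-oo, q.2.+1%:R^-1[%classic).
  apply/seteqP; split => [x bx i _|x bx i] /=; last by have := bx i I; rewrite /= in_itv.
  by rewrite in_itv /=; exact: bx.
apply: fin_bigcap_measurable => // i _.
rewrite -[X in measurable X]setTI.
have : measurable_fun setT (fun x => `|(f x : 'rV[R]_n) 0 i - ratr (q.1 0 i)|).
  by apply: measurableT_comp => //; exact: measurable_funB.
by apply.
Qed.

Definition rV_cons (R : realType) n (z : R * borel 'rV[R]_n) : borel 'rV[R]_n.+1 :=
  row_mx (z.1%:M : 'rV[R]_1) (z.2 : 'rV[R]_n).

Definition rV_uncons (R : realType) n (z : borel 'rV[R]_n.+1) :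
    R * borel 'rV[R]_n :=
  ((z : 'rV[R]_n.+1) 0 0, rsubmx (z : 'rV[R]_(1 + n))).

Lemma rV_consK (R : realType) n : cancel (@rV_cons R n) (@rV_uncons R n).
Proof.
move=> [x y]; congr pair; last by rewrite row_mxKr.
transitivity (row_mx (x%:M : 'rV[R]_1) (y : 'rV[R]_n) 0 (lshift n 0)).
  by congr (row_mx _ _ _ _); exact/val_inj.
by rewrite row_mxEl mxE.
Qed.

Lemma measurable_rV_cons (R : realType) n : measurable_fun setT (@rV_cons R n).
Proof.
apply: measurable_fun_rV => i; rewrite /rV_cons.
case: (splitP (i : 'I_(1 + n))) => [j ij|j ij].
  have -> : i = lshift n j by exact/val_inj.
  have -> : (fun x : R * borel 'rV[R]_n =>
    (row_mx (x.1%:M : 'rV_1) (x.2 : 'rV[R]_n)) 0 (lshift n j)) = fst.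
    by apply/funext => x; rewrite row_mxEl mxE ord1.
  exact: measurable_fst.
have -> : i = rshift 1 j by exact/val_inj.
have -> : (fun x : R * borel 'rV[R]_n =>
  (row_mx (x.1%:M : 'rV_1) (x.2 : 'rV[R]_n)) 0 (rshift 1 j)) =
    (fun y : borel 'rV[R]_n => (y : 'rV[R]_n) 0 j) \o snd.
  by apply/funext => x; rewrite row_mxEr.
by apply: (measurableT_comp (measurable_borel_coord j)); exact: measurable_snd.
Qed.

Lemma measurable_rV_uncons (R : realType) n : measurable_fun setT (@rV_uncons R n).
Proof.
apply/measurable_fun_pairP; split; first exact: measurable_borel_coord.
apply: measurable_fun_rV => i /=.
under eq_fun do rewrite /= mxE.
exact: measurable_borel_coord.
Qed.

Definition rV_prod_measure (R : realType) n
    (m : {sigma_finite_measure set (borel 'rV[R]_n) -> \bar R}) :=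
  pushforward (@lebesgue_measure R \x m)%E (@rV_cons R n).

Section rV_prod_measure.
Context (R : realType) n
  (m : {sigma_finite_measure set (borel 'rV[R]_n) -> \bar R}).

HB.instance Definition _ := Measure.copy (rV_prod_measure m)
  (measure_function_pushforward__canonical__measure_function_Measure
    (@lebesgue_measure R \x m)%E (@measurable_rV_cons R n)).

Let rV_prod_measure_sigma_finite : sigma_finite setT (rV_prod_measure m).
Proof.
have [F FT mF] : sigma_finite setT (@lebesgue_measure R \x m)%E.
  have /sigma_finiteP[F [FT ndF mF]] := sigma_finiteT (@lebesgue_measure R).
  have /sigma_finiteP[G [GT ndG mG]] := sigma_finiteT m.
  exists (fun k => F k `*` G k) => [|k].
    apply/seteqP; split => // -[x y] _.
    have [i _ Fx] : (\bigcup_k F k) x by rewrite -FT.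
    have [j _ Gy] : (\bigcup_k G k) y by rewrite -GT.
    exists (maxn i j) => //; split => /=.
    - by move: x Fx; exact/subsetPset/ndF/leq_maxl.
    - by move: y Gy; exact/subsetPset/ndG/leq_maxr.
  have [? ?] := mF k; have [? ?] := mG k; split; first exact: measurableX.
  by rewrite product_measure1E// lte_mul_pinfty// ge0_fin_numE.
exists (fun k => @rV_uncons R n @^-1` F k) => [|k].
  by rewrite -preimage_bigcup -FT preimage_setT.
have [mFk Fk] := mF k; split.
  by rewrite -[X in measurable X]setTI; exact: measurable_rV_uncons.
rewrite /rV_prod_measure /pushforward.
suff -> : @rV_cons R n @^-1` (@rV_uncons R n @^-1` F k) = F k by [].
by apply/seteqP; split => z /=; rewrite rV_consK.
Qed.

HB.instance Definition _ := Measure_isSigmaFinite.Build _ _ _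
  (rV_prod_measure m) rV_prod_measure_sigma_finite.

End rV_prod_measure.

(* L^(n+1) is the image of L^1 \x L^n under (x, y) |-> row_mx x y; L^0 is the unit
   mass on the one-point space. *)
Fixpoint lebesgue_rV (R : realType) n :
    {sigma_finite_measure set (borel 'rV[R]_n) -> \bar R} :=
  match n with
  | 0 => @dirac _ (borel 'rV[R]_0) 0 R
  | n'.+1 => rV_prod_measure (lebesgue_rV R n')
  end.


Section density.
Context d (T : measurableType d) (R : realType).
Variables (mu : {measure set T -> \bar R}) (f : {mfun T >-> R}).
Local Open Scope ereal_scope.

Definition pos_density (A : set T) := \int[mu]_(x in A) (Num.max (f x) 0%R)%:E.

Let mf : measurable_fun setT (fun x => (Num.max (f x) 0%R)%:E).
Proof. by apply/measurable_EFinP; exact: measurable_maxr. Qed.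

Let f0 x : 0 <= (Num.max (f x) 0%R)%:E.
Proof. by rewrite lee_fin le_max lexx orbT. Qed.

Let pos_density0 : pos_density set0 = 0.
Proof. exact: integral_set0. Qed.

Let pos_density_ge0 A : 0 <= pos_density A.
Proof. by apply: integral_ge0. Qed.

HB.instance Definition _ := isMeasure.Build _ _ _ pos_density
  pos_density0 pos_density_ge0 (semi_sigma_additive_nng_induced mf f0).

End density.

(* Library charges are finite; here a signed measure is given by its Jordan
   decomposition, so that both parts may be infinite. *)
Record signed_measure d (T : measurableType d) (R : realType) := SignedMeasure {
  pos_part : {measure set T -> \bar R} ;
  neg_part : {measure set T -> \bar R} ;
  mutually_singular : exists2 D, measurable D &
    pos_part (~` D) = 0%E /\ neg_part D = 0%E }.

Definition total_variation d (T : measurableType d) (R : realType)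
    (kappa : signed_measure T R) : {measure set T -> \bar R} :=
  measure_add (pos_part kappa) (neg_part kappa).

Lemma density_singular d (T : measurableType d) (R : realType)
    (mu : {measure set T -> \bar R}) (f : {mfun T >-> R}) :
  exists2 D, measurable D &
    pos_density mu f (~` D) = 0%E /\ pos_density mu (- f) D = 0%E.
Proof.
exists (f @^-1` `[0, +oo[) => [|].
  by rewrite -[X in measurable X]setTI; exact: measurable_funP.
by split; apply: integral0_eq => x /=; rewrite in_itv/= andbT => fx0;
  congr EFin; apply/max_idPr; rewrite ?oppr_le0// ltW// ltNge; exact/negP.
Qed.

Definition signed_density d (T : measurableType d) (R : realType)
    (mu : {measure set T -> \bar R}) (f : {mfun T >-> R}) : signed_measure T R :=
  SignedMeasure (density_singular mu f).

Section euclidean.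
Context (R : realType) (d : nat).
Implicit Types (V : set 'rV[R]_d) (G : 'rV[R]_d -> 'M[R]_d).

Definition half_space : set 'rV[R]_d :=
  [set x | forall i : 'I_d, i.+1 = d -> 0 <= x 0 i].

Definition bilin (A : 'M[R]_d) (x y : 'rV[R]_d) : R := (x *m A *m y^T) 0 0.

Definition scalar_product (A : 'M[R]_d) :=
  A^T = A /\ forall x, x != 0 -> 0 < bilin A x x.

(* The norm of 'rV[R]_d is the sup norm, which is equivalent to the Euclidean
   one. *)
Definition locally_lipschitz m (D : set 'rV[R]_d) (f : 'rV[R]_d -> 'rV[R]_m) :=
  forall x, D x -> exists2 N, nbhs x N & exists k : R, k.-lipschitz_(D `&` N) f.

Fixpoint Ck k (f : 'rV[R]_d -> R) : Prop :=
  continuous f /\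
  if k is k'.+1 then
    forall i, (forall x, derivable f x (delta_mx 0 i)) /\
      Ck k' (fun x => 'D_(delta_mx 0 i) f x)
  else True.

Definition smooth f := forall k, Ck k f.

Definition compactly_supported (T : zmodType) V (f : 'rV[R]_d -> T) :=
  exists K, [/\ compact K, K `<=` V & forall x, V x -> ~ K x -> f x = 0].

Definition test_function V (f : 'rV[R]_d -> R) :=
  [/\ smooth f, compactly_supported V f & forall x, ~ V x -> f x = 0].

(* The L^2-norm over V of the 1-form om for the metric G and its volume. *)
Definition form_norm V G (om : 'rV[R]_d -> 'rV[R]_d) : \bar R :=
  ((\int[lebesgue_rV R d]_(x in V)
     (bilin (invmx (G x)) (om x) (om x) * Num.sqrt (\det (G x)))%:E) `^ 2^-1)%E.

End euclidean.

Definition paracompact (T : topologicalType) :=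
  forall (I : Type) (U : I -> set T), (forall i, open (U i)) ->
    \bigcup_i U i = setT ->
  exists (J : Type) (W : J -> set T),
    [/\ forall j, open (W j), \bigcup_j W j = setT,
        forall j, exists i, W j `<=` U i &
        forall x : T, exists2 N, nbhs x N & finite_set [set j | W j `&` N !=set0]].

Record lipschitz_manifold (R : realType) (d : nat) := LipschitzManifold {
  carrier :> ptopologicalType ;
  chart_index : Type ;
  chart_dom : chart_index -> set carrier ;
  chart : chart_index -> carrier -> 'rV[R]_d ;
  chart_inv : chart_index -> 'rV[R]_d -> carrier ;
  manifold_hausdorff : hausdorff_space carrier ;
  manifold_second_countable : @second_countable carrier ;
  manifold_connected : connected [set: carrier] ;
  manifold_paracompact : paracompact carrier ;
  chart_dom_open : forall a, open (chart_dom a) ;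
  chart_dom_cover : \bigcup_a chart_dom a = setT ;
  atlas_locally_finite : forall x : carrier,
    exists2 N, nbhs x N & finite_set [set a | chart_dom a `&` N !=set0] ;
  atlas_countable :
    exists2 B, countable B & \bigcup_(a in B) chart_dom a = setT ;
  chart_continuous : forall a, {within chart_dom a, continuous (chart a)} ;
  chart_inv_continuous : forall a,
    {within chart a @` chart_dom a, continuous (chart_inv a)} ;
  chartK : forall a x, chart_dom a x -> chart_inv a (chart a x) = x ;
  chart_image_open : forall a, open (chart a @` chart_dom a) \/
    exists2 O, open O & chart a @` chart_dom a = O `&` @half_space R d ;
  transition_lipschitz : forall a b, locally_lipschitz
    (chart a @` (chart_dom a `&` chart_dom b)) (chart b \o chart_inv a)
}.

Section charts.
Context (R : realType) (d : nat) (M : lipschitz_manifold R d).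

Definition chart_image (a : chart_index M) : set 'rV[R]_d :=
  chart a @` chart_dom a.

Definition overlap (a b : chart_index M) : set 'rV[R]_d :=
  chart a @` (chart_dom a `&` chart_dom b).

Definition transition (a b : chart_index M) : 'rV[R]_d -> 'rV[R]_d :=
  chart b \o chart_inv a.

End charts.

(* With row vectors, d(transition b a) at y is xi |-> xi *m 'J (transition b a) y;
   metric_compatible says that g_b is the push-forward of g_a under
   transition a b, the inverse of transition b a, and a.e. differentiability is
   Rademacher's theorem. The L^2-norm of 1-forms is conformally invariant for
   d = 2, so that metric_form_bound alone does not give metric_elliptic. *)
Record lr_manifold (R : realType) (d : nat) := LRManifold {
  lr_base :> lipschitz_manifold R d ;
  metric : chart_index lr_base -> 'rV[R]_d -> 'M[R]_d ;
  metric_scalar_product : forall a x,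
    chart_image a x -> scalar_product (metric a x) ;
  metric_borel : forall a i j, measurable_fun (chart_image a : set (borel 'rV[R]_d))
    (fun x : borel 'rV[R]_d => metric a x i j) ;
  metric_compatible : forall a b, {ae lebesgue_rV R d, forall y, overlap b a y ->
    differentiable (transition b a) y /\
    metric b y = 'J (transition b a) y *m metric a (transition b a y) *m
      ('J (transition b a) y)^T} ;
  metric_form_bound : forall a, exists2 c : R, 1 <= c &
    forall om : 'rV[R]_d -> 'rV[R]_d,
      (forall i, smooth (fun x => om x 0 i)) ->
      compactly_supported (chart_image a) om ->
      ((c^-1)%:E * form_norm (chart_image a) (fun=> 1%:M) om
        <= form_norm (chart_image a) (metric a) om)%E /\
      (form_norm (chart_image a) (metric a) om
        <= c%:E * form_norm (chart_image a) (fun=> 1%:M) om)%E ;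
  metric_elliptic : forall a, exists2 lam : R, 1 <= lam &
    {ae lebesgue_rV R d, forall x, chart_image a x -> forall xi,
      lam^-1 * bilin 1%:M xi xi <= bilin (metric a x) xi xi <=
      lam * bilin 1%:M xi xi}
}.

Section analysis.
Context (R : realType) (d : nat) (M : lr_manifold R d).
Implicit Types (f h phi : M -> R) (w : chart_index M -> 'rV[R]_d -> 'rV[R]_d).

Local Notation leb := (lebesgue_rV R d).

Definition volume_density (a : chart_index M) (x : 'rV[R]_d) : R :=
  Num.sqrt (\det (metric a x)).

Definition volume_measure (v : {measure set (borel M) -> \bar R}) :=
  forall a f, measurable_fun setT (f : borel M -> R) ->
    (forall x, 0 <= f x) -> (exists c, forall x, f x <= c) ->
    (forall x, ~ chart_dom a x -> f x = 0) ->
    (\int[v]_x (f x)%:E =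
     \int[leb]_(y in chart_image a) (f (chart_inv a y) * volume_density a y)%:E)%E.

(* A measurable 1-form, given by its representatives in the charts, which are
   related by pull-back. *)
Definition one_form w :=
  (forall a i, measurable_fun (chart_image a : set (borel 'rV[R]_d))
     (fun x : borel 'rV[R]_d => w a x 0 i)) /\
  (forall a b, {ae leb, forall y, overlap b a y ->
     w b y = w a (transition b a y) *m ('J (transition b a) y)^T}).

Definition locally_L2 (V : set 'rV[R]_d) (om : 'rV[R]_d -> 'rV[R]_d) :=
  forall K, compact K -> K `<=` V ->
    (\int[leb]_(x in K) (bilin 1%:M (om x) (om x))%:E < +oo)%E.

(* w = df; the test functions are supported away from the boundary of M. *)
Definition weak_differential f w :=
  one_form w /\
  forall a, locally_L2 (chart_image a) (w a) /\
    forall (eta : 'rV[R]_d -> R) i, test_function (interior (chart_image a)) eta ->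
      \int[leb]_(x in chart_image a) (f (chart_inv a x) * 'D_(delta_mx 0 i) eta x)
      = - \int[leb]_(x in chart_image a) (w a x 0 i * eta x).

(* G = <df, dh> for the co-metric *)
Definition is_grad_dot f h (G : M -> R) :=
  measurable_fun setT (G : borel M -> R) /\
  exists wf wh, [/\ weak_differential f wf, weak_differential h wh &
    forall a, {ae leb, forall x, chart_image a x ->
      G (chart_inv a x) = bilin (invmx (metric a x)) (wf a x) (wh a x)}].

Definition grad_dot f h : M -> R := xget (fun=> 0) [set G | is_grad_dot f h G].

Variable v : {measure set (borel M) -> \bar R}.

Definition L2 f := (f : borel M -> R) \in Lfun v 2%:E.

Definition W12 f :=
  L2 f /\ exists2 G, is_grad_dot f f G & (\int[v]_x (G x)%:E < +oo)%E.

(* The polarisation of E(f) = 1/2 \int |df|^2 dv, with domain W12. *)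
Definition energy f h : R := 2^-1 * \int[v]_x grad_dot f h x.

(* The generator of the Dirichlet form: f is in its domain and it maps f to h. *)
Definition half_laplacian f h :=
  [/\ W12 f, L2 h & forall phi, W12 phi -> energy f phi = - \int[v]_x (h x * phi x)].

Definition sqr_dist f h : R := \int[v]_x (f x - h x) ^+ 2.

(* P t = exp (t Laplacian / 2): the strongly continuous semigroup of symmetric
   contractions of L^2 with generator half_laplacian. It acts on representatives. *)
Record heat_flow (P : R -> (M -> R) -> M -> R) : Prop := HeatFlow {
  heat_flow_L2 : forall t f, 0 <= t -> L2 f -> L2 (P t f) ;
  heat_flow_ae : forall t f h, 0 <= t -> L2 f -> L2 h ->
    {ae v, forall x, f x = h x} -> {ae v, forall x, P t f x = P t h x} ;
  heat_flow_linear : forall t c f h, 0 <= t -> L2 f -> L2 h ->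
    {ae v, forall x, P t (fun y => c * f y + h y) x = c * P t f x + P t h x} ;
  heat_flow_symmetric : forall t f h, 0 <= t -> L2 f -> L2 h ->
    \int[v]_x (P t f x * h x) = \int[v]_x (f x * P t h x) ;
  heat_flow_contraction : forall t f, 0 <= t -> L2 f ->
    \int[v]_x (P t f x) ^+ 2 <= \int[v]_x (f x) ^+ 2 ;
  heat_flow_0 : forall f, L2 f -> {ae v, forall x, P 0 f x = f x} ;
  heat_flow_semigroup : forall s t f, 0 <= s -> 0 <= t -> L2 f ->
    {ae v, forall x, P (s + t) f x = P s (P t f) x} ;
  heat_flow_continuous : forall f, L2 f ->
    sqr_dist (P t f) f @[t --> 0^'+] --> (0 : R) ;
  heat_flow_generator : forall f h, L2 f -> L2 h ->
    (half_laplacian f h <->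
     sqr_dist (fun x => (P t f x - f x) / t) h @[t --> 0^'+] --> (0 : R))
}.

(* Distances on M are measured in charts; transitions being locally Lipschitz,
   the choice of charts does not matter. *)
Definition locally_hoelder (p : R -> M -> M -> R) :=
  forall (t : R) (x y : M) (a b : chart_index M),
    0 < t -> chart_dom a x -> chart_dom b y ->
  exists (U : set (R * (M * M))) (C gam : R),
    [/\ nbhs (t, (x, y)) U, 0 < gam <= 1 &
      forall t1 x1 y1 t2 x2 y2, U (t1, (x1, y1)) -> U (t2, (x2, y2)) ->
      `|p t1 x1 y1 - p t2 x2 y2| <=
        C * (`|t1 - t2| + `|chart a x1 - chart a x2|
             + `|chart b y1 - chart b y2|) `^ gam].

Record heat_kernel (p : R -> M -> M -> R) : Prop := HeatKernel {
  heat_kernel_gt0 : forall t x y, 0 < t -> 0 < p t x y ;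
  heat_kernel_hoelder : locally_hoelder p ;
  heat_kernel_flow : exists2 P, heat_flow P & forall t f, 0 < t -> L2 f ->
    {ae v, forall x, (P t f x)%:E = (\int[v]_y (p t x y * f y)%:E)%E}
}.

Definition capacity (A : set M) : \bar R :=
  ereal_inf [set (energy f f + \int[v]_x (f x) ^+ 2)%:E | f in
    [set f | W12 f /\ exists U : set M,
      [/\ open U, A `<=` U & {ae v, forall x, U x -> 1 <= f x}]]].

Definition polar (A : set M) := capacity A = 0%E.

Variable p : R -> M -> M -> R.

Definition kato_class (kappa : signed_measure (borel M) R) :=
  (forall A : set (borel M), measurable A -> polar A ->
     total_variation kappa A = 0%E) /\
  ereal_sup [set (\int[lebesgue_measure]_(s in `]0%R, t])
      \int[total_variation kappa]_y (p s x y)%:E)%E | x in [set: M]]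
    @[t --> 0^'+] --> 0%E.

Definition admissible_exponent (q : R) : Prop :=
  if d == 1%N then 1 <= q else d%:R / 2 < q.

Definition kernel_bound (Xi : M -> R) (Sigma : R -> R) (C : R) :=
  forall (x : M) (t : R), 0 < t <= 1 ->
    (ereal_sup [set (p t x y)%:E | y in [set: M]] <= (C * Sigma t * Xi x)%:E)%E.

(* Only the values of Sigma on ]0, 1] matter. *)
Record control_pair (Xi : M -> R) (Sigma : R -> R) : Prop := ControlPair {
  control_Xi_continuous : continuous Xi ;
  control_Xi_bounded_away : exists2 c : R, 0 < c & forall x, c <= Xi x ;
  control_Sigma_gt0 : forall t : R, 0 < t <= 1 -> 0 < Sigma t ;
  control_Sigma_borel : measurable_fun (`]0, 1]%classic : set R) Sigma ;
  control_kernel : exists2 C : R, 0 < C & kernel_bound Xi Sigma C ;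
  control_Sigma_integrable : forall q, admissible_exponent q ->
    exists2 C : R, 0 < C &
      (\int[lebesgue_measure]_(t in `]0%R, 1%R])
         (Sigma t `^ q^-1 * expR (- C * t))%:E < +oo)%E
}.

(* the norm of L^q(M, Xi v) *)
Definition weighted_norm (Xi : M -> R) (q : R) f : \bar R :=
  ((\int[v]_x (`|f x| `^ q * Xi x)%:E) `^ q^-1)%E.

Definition sum_Lq_Linfty (Xi : M -> R) (q : R) (k : {mfun borel M >-> R}) :=
  exists k1 k2 : {mfun borel M >-> R},
    [/\ (weighted_norm Xi q k1 < +oo)%E, (k2 : borel M -> R) \in Lfun v +oo%E &
        {ae v, forall x, k x = k1 x + k2 x}].

End analysis.

(* Main.v *)
Require Import Defs.
From HB Require Import structures.
From mathcomp Require Import all_boot all_order all_algebra.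
From mathcomp Require Import all_classical all_reals all_analysis.
From mathcomp Require Import measurable_realfun ring lra.
Set Implicit Arguments.
Unset Strict Implicit.
Unset Printing Implicit Defensive.
Import Order.TTheory GRing.Theory Num.Theory.
Import numFieldNormedType.Exports.
Local Open Scope classical_set_scope.
Local Open Scope ring_scope.

(** The estimate is Hoelder's inequality for the measure p(s,x,.) v, whose mass
    is at most 1: with c = C Sigma(s), the symmetry of the kernel turns the
    control bound into p(s,x,y) <= c Xi(y), hence
      int p(s,x,.) |k1| dv <= (int p(s,x,.) |k1|^q dv)^(1/q)
                           <= c^(1/q) ||k1||_(L^q(Xi v)),
    and int p(s,x,.) |k2| dv <= ||k2||_oo ([kernel_hoelder], [kernel_ess_sup],
    [kernel_sum_bound]). Integrated over ]0, t], the right-hand side tends to 0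
    uniformly in x because Sigma^(1/q) is integrable on ]0, 1]; polar sets are
    v-null because the energy is nonnegative, so that the capacity dominates v
    ([polar_null], [kato_density]).

    The substance is the bound on the mass ([kernel_mass_le1]): the heat flow is
    given as a symmetric contraction semigroup on L^2 with the right generator,
    and the Markov property has to be derived from that generator A. Let ramp1
    be the truncation of class C^(1,1) that vanishes up to 1 and whose derivative
    lies in [0, 1], and ramp2 its convex primitive.
    - The chain rule for weak differentials gives d(ramp1 u) = ramp1'(u) du,
      hence int (A u) ramp1(u) dv = - E(u, ramp1 u) <= 0
      ([weak_partial_chain], [half_laplacian_dissipative]).
    - By convexity of ramp2, this makes int ramp2(u) dv almost decrease in a
      backward Euler step of the flow; letting the step tend to 0 gives
      int ramp2(P_t u) dv <= int ramp2(u) dv on the domain of A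
      ([euler_step], [ramp2_flow_domain]). No derivative in time is taken.
    - The averages (1/eps) int_0^eps P_s f ds lie in the domain and tend to f
      ([flow_time_average], [domain_dense]), so the inequality extends to all
      nonnegative f in L^2. If f <= 1, its right-hand side vanishes, hence
      P_t f <= 1 almost everywhere ([flow_le1]).
    - Applied to indicators, this bounds the mass for almost every x; continuity
      of the kernel, the full support of v and Fatou's lemma give every x
      ([kernel_mass_set]).

    The chain rule is proved without mollifiers. A function f with weak
    derivative w in the direction e satisfies f(x+he) - f(x) = int_0^h w(x+se) ds
    for almost every x ([translation_ae]), because smooth bumps on boxes separate
    locally integrable functions ([fundamental_lemma]). Replacing derivatives by
    difference quotients in the identity to be proved then leaves errors that
    are all quadratic in h ([chain_rule_core]). *)

(** * Almost everywhere statements *)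

Lemma ae_imp d (T : measurableType d) (R : realType) (mu : {measure set T -> \bar R})
    (P Q : T -> Prop) : (forall x, P x -> Q x) ->
  {ae mu, forall x, P x} -> {ae mu, forall x, Q x}.
Proof. by move=> PQ; apply: negligibleS => x /= nQ /PQ. Qed.

Lemma ae_imp2 d (T : measurableType d) (R : realType) (mu : {measure set T -> \bar R})
    (P Q S : T -> Prop) : (forall x, P x -> Q x -> S x) ->
  {ae mu, forall x, P x} -> {ae mu, forall x, Q x} -> {ae mu, forall x, S x}.
Proof.
move=> PQ aP aQ; apply: negligibleS (negligibleU aP aQ) => x /= nS.
by have [p|np] := pselect (P x); [right=> /(PQ _ p)|left].
Qed.

Lemma ae_and d (T : measurableType d) (R : realType) (mu : {measure set T -> \bar R})
    (P Q : T -> Prop) :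
  {ae mu, forall x, P x} -> {ae mu, forall x, Q x} -> {ae mu, forall x, P x /\ Q x}.
Proof. by move=> aP aQ; exact: (ae_imp2 (fun x p q => conj p q) aP aQ). Qed.

(** * Lebesgue measure on row vectors *)

Definition box (R : realType) n (F : 'I_n -> set R) : set 'rV[R]_n :=
  [set x | forall i, F i (x 0 i)].

Lemma measurable_box (R : realType) n (F : 'I_n -> set R) :
  (forall i, measurable (F i)) -> measurable (box F : set (borel 'rV[R]_n)).
Proof.
move=> mF.
have -> : (box F : set (borel 'rV[R]_n)) =
   \bigcap_(i in [set: 'I_n]) ((fun z : borel 'rV[R]_n => (z : 'rV[R]_n) 0 i : R) @^-1` F i).
  by apply/seteqP; split=> [x h i _|x h i] /=; [exact: h|exact: (h i I)].
apply: fin_bigcap_measurable => // i _.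
rewrite -[X in measurable X]setTI.
exact: (measurable_borel_coord i).
Qed.

Lemma rV_cons_head (R : realType) n (z : R * borel 'rV[R]_n) :
  (rV_cons z : 'rV[R]_n.+1) 0 ord0 = z.1.
Proof.
case: z => x y.
transitivity (row_mx (x%:M : 'rV[R]_1) (y : 'rV[R]_n) 0 (lshift n 0)).
  by congr (row_mx _ _ _ _); exact/val_inj.
by rewrite row_mxEl mxE.
Qed.

Lemma rV_cons_tail (R : realType) n (z : R * borel 'rV[R]_n) i :
  (rV_cons z : 'rV[R]_n.+1) 0 (lift ord0 i) = (z.2 : 'rV[R]_n) 0 i.
Proof.
case: z => x y.
transitivity (row_mx (x%:M : 'rV[R]_1) (y : 'rV[R]_n) 0 (rshift 1 i)).
  by congr (row_mx _ _ _ _); exact/val_inj.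
by rewrite row_mxEr.
Qed.

(** A box is the image of a product of its first side with the box of the other
    sides, so the product formula is an induction on the dimension. *)
Lemma lebesgue_rV_box (R : realType) n (F : 'I_n -> set R) :
  (forall i, measurable (F i)) ->
  (lebesgue_rV R n (box F) = \prod_(i < n) lebesgue_measure (F i))%E.
Proof.
elim: n F => [|n ih] F mF.
  by rewrite big_ord0 /= diracE mem_set// => -[].
rewrite big_ord_recl /= /rV_prod_measure /pushforward.
have -> : @rV_cons R n @^-1` box F =
    F ord0 `*` (box (fun i => F (lift ord0 i)) : set (borel 'rV[R]_n)).
  apply/seteqP; split=> [z h|z [h1 h2] i] /=.
    split=> [|i] /=; first by rewrite -rV_cons_head; exact: h.
    by rewrite -rV_cons_tail; exact: h.
  have [->|[j ->]] : i = ord0 \/ exists j, i = lift ord0 j.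
    by case: (unliftP ord0 i) => [j ->|->]; [right; exists j|left].
  - by rewrite rV_cons_head.
  - by rewrite rV_cons_tail; exact: h2.
rewrite product_measure1E ?ih//; first exact: mF.
by apply: measurable_box => i; exact: mF.
Qed.

(** A translate of Lebesgue measure gives every interval its length, and
    Lebesgue measure is determined by these values. *)
Lemma lebesgue_measure_shift (R : realType) (c : R) (A : set R) : measurable A ->
  lebesgue_measure ((fun x => x + c) @^-1` A) = lebesgue_measure A.
Proof.
move=> mA.
have mf : measurable_fun [set: measurableTypeR R] (fun x : measurableTypeR R => x + c : measurableTypeR R).
  exact: measurable_funD.
apply/esym.
apply: (@lebesgue_measure_unique R
  (measure_function_pushforward__canonical__measure_function_Measure lebesgue_measure mf)) => //= _ [[a b]] _ <-.
rewrite /pushforward (_ : _ @^-1` _ = `](a - c), (b - c)]%classic); last first.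
  by apply/seteqP; split=> x /=; rewrite !in_itv/= ltrBlDr lerBrDr.
rewrite !lebesgue_measure_itv/= !lte_fin ltrD2r.
by case: ifP => // _; congr EFin; lra.
Qed.

Lemma measurable_shift (R : realType) n (z : 'rV[R]_n) :
  measurable_fun setT (fun x : borel 'rV[R]_n => (x : 'rV[R]_n) + z : borel 'rV[R]_n).
Proof.
apply: measurable_fun_rV => i; under eq_fun do rewrite mxE.
by apply: measurable_funD => //; exact: measurable_borel_coord.
Qed.

(** Cavalieri: the first coordinate of the shift permutes the slices, the other
    ones shift each slice, whose measure is invariant by induction. *)
Lemma lebesgue_rV_shift (R : realType) n (z : 'rV[R]_n) (A : set 'rV[R]_n) :
  measurable (A : set (borel 'rV[R]_n)) ->
  lebesgue_rV R n ((fun x => x + z) @^-1` A) = lebesgue_rV R n A.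
Proof.
elim: n z A => [|n ih] z A mA.
  congr (lebesgue_rV R 0 _); apply/funext => x /=; congr (A _).
  by apply/rowP => -[].
pose z' : 'rV[R]_n := rsubmx (z : 'rV[R]_(1 + n)).
rewrite /= /rV_prod_measure /pushforward /product_measure1.
pose B := @rV_cons R n @^-1` A.
have mB : measurable B.
  by rewrite -[B]setTI; apply: (@measurable_rV_cons R n).
transitivity (\int[@lebesgue_measure R]_t (lebesgue_rV R n (xsection B ((t : R) + z 0 0)%R)))%E.
  apply: eq_integral => t _; rewrite /=.
  rewrite -(ih z' (xsection B (t + z 0 0))); last exact: measurable_xsection.
  congr (lebesgue_rV R n _); apply/seteqP; split=> y; rewrite /xsection /= !inE /B /=;
    suff -> : (rV_cons (t, y) : 'rV[R]_n.+1) + z = rV_cons (t + z 0 0, (y : 'rV[R]_n) + z') by [];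
    apply/rowP => i;
    (have [->|[j ->]] : i = ord0 \/ exists j, i = lift ord0 j
      by case: (unliftP ord0 i) => [j ->|->]; [right; exists j|left]);
    rewrite mxE ?rV_cons_head ?rV_cons_tail //= ?mxE; congr (_ + z 0 _); exact/val_inj.
pose g t := lebesgue_rV R n (xsection B t).
rewrite -[LHS]/(\int[@lebesgue_measure R]_t ((g \o (fun t : R => t + z 0 0)%R) t))%E.
have mf : measurable_fun [set: measurableTypeR R] (fun x : measurableTypeR R => x + z 0 0 : measurableTypeR R).
  exact: measurable_funD.
have mg : measurable_fun setT g by exact: measurable_fun_xsection.
rewrite -[LHS](ge0_integral_pushforward mf _ measurableT)//.
apply: eq_measure_integral => D mD _.
exact: lebesgue_measure_shift.
Qed.

Lemma ge0_integral_shift (R : realType) n (z : 'rV[R]_n) (f : 'rV[R]_n -> \bar R) :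
  measurable_fun setT (f : borel 'rV[R]_n -> \bar R) -> (forall x, 0 <= f x)%E ->
  (\int[lebesgue_rV R n]_x f ((x : 'rV[R]_n) + z)%R = \int[lebesgue_rV R n]_x f x)%E.
Proof.
move=> mf f0.
rewrite -[LHS](ge0_integral_pushforward (measurable_shift z) _ measurableT)//.
apply: eq_measure_integral => [|? D mD _]; first exact: measurable_shift.
exact: lebesgue_rV_shift.
Qed.

Lemma integral_shift (R : realType) n (z : 'rV[R]_n) (f : 'rV[R]_n -> \bar R) :
  measurable_fun setT (f : borel 'rV[R]_n -> \bar R) ->
  (\int[lebesgue_rV R n]_x f ((x : 'rV[R]_n) + z)%R = \int[lebesgue_rV R n]_x f x)%E.
Proof.
move=> mf; rewrite integralE [RHS]integralE; congr (_ - _)%E.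
  have h := @ge0_integral_shift _ _ z (f^\+)%E (measurable_funepos mf) (funepos_ge0 f).
  by rewrite -h; apply: eq_integral => x _; rewrite ?funeposE ?funenegE.
have h := @ge0_integral_shift _ _ z (f^\-)%E (measurable_funeneg mf) (funeneg_ge0 f).
  by rewrite -h; apply: eq_integral => x _; rewrite ?funeposE ?funenegE.
Qed.

Lemma Rintegral_shift (R : realType) n (z : 'rV[R]_n) (f : 'rV[R]_n -> R) :
  measurable_fun setT (f : borel 'rV[R]_n -> R) ->
  \int[lebesgue_rV R n]_x f ((x : 'rV[R]_n) + z)%R = \int[lebesgue_rV R n]_x f x.
Proof.
move=> mf; rewrite /Rintegral; congr fine.
by apply: (@integral_shift _ _ z (EFin \o f)); exact/measurable_EFinP.
Qed.

Lemma lebesgue_rV_hyperplane (R : realType) n (i : 'I_n) :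
  lebesgue_rV R n [set x : 'rV[R]_n | x 0 i = 0] = 0%E.
Proof.
pose F (j : 'I_n) : set R := if j == i then [set 0] else setT.
rewrite (_ : [set _ | _] = box F); last first.
  apply/seteqP; split=> [x /= xi j|x /(_ i)]; rewrite /F; last by rewrite eqxx.
  by case: eqP => // ->.
rewrite lebesgue_rV_box => [|j]; last by rewrite /F; case: ifP.
by rewrite (bigD1 i)//= /F eqxx lebesgue_measure_set1 mul0e.
Qed.

Lemma lebesgue_rV_oobox_gt0 (R : realType) n (a b : 'I_n -> R) :
  (forall i, a i < b i) -> (0 < lebesgue_rV R n (box (fun i => `]a i, b i[%classic)))%E.
Proof.
move=> ab; rewrite lebesgue_rV_box//.
elim/big_ind : _ => // [x y|i _]; first exact: mule_gt0.
by rewrite lebesgue_measure_itv/= lte_fin ab lte_fin subr_gt0.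
Qed.

Lemma lebesgue_rV_ccbox_fin (R : realType) n (a b : 'I_n -> R) :
  (lebesgue_rV R n (box (fun i => `[a i, b i]%classic)) < +oo)%E.
Proof.
rewrite lebesgue_rV_box//.
suff : (\prod_(i < n) lebesgue_measure `[a i, b i]%classic)%E \is a fin_num by rewrite fin_num_abs; apply: le_lt_trans; exact: lee_abs.
elim/big_ind : _ => // [x y|i _]; first exact: fin_numM.
by rewrite lebesgue_measure_itv/=; case: ifP.
Qed.

(** * Smooth bumps on boxes *)

(** P(1/x) exp(-c/x) for x > 0, extended by 0. The family is closed under
    differentiation, P becoming [flat' c P], so that one induction yields
    smoothness; P = 1 gives the bumps. *)
Definition flat (R : realType) (c : R) (P : {poly R}) (x : R) : R :=
  if 0 < x then P.[x^-1] * expR (- (c / x)) else 0.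

(** The power of y strengthens the claim for the induction on P: in P = Q X + a
    the factor X goes into the power. *)
Lemma expR_poly_bounded (R : realType) (c : R) (P : {poly R}) (k : nat) : 0 < c ->
  exists K : R, forall y : R, 0 <= y -> `|P.[y] * y ^+ k| * expR (- (c * y)) <= K.
Proof.
move=> c0; elim/poly_ind: P k => [k|P a ih k].
  by exists 0 => y _; rewrite horner0 mul0r normr0 mul0r.
have [K1 hK1] := ih k.+1.
exists (K1 + `|a| * (k.+1`!%:R / c ^+ k.+1 + 1)) => y y0.
rewrite !hornerE mulrDl -mulrA -exprS.
apply: (le_trans (ler_wpM2r (expR_ge0 _) (ler_normD _ _))).
rewrite mulrDl lerD ?hK1// normrM -mulrA ler_wpM2l//.
rewrite ger0_norm ?exprn_ge0// expRN ler_pdivrMr ?expR_gt0//.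
have cy0 : 0 <= c * y by rewrite mulr_ge0// ltW.
have [y1|y1] := leP 1 y.
  have h := expR_ge1Dxn k cy0.
  have cN : 0 < c ^+ k.+1 by rewrite exprn_gt0.
  have f0 : 0 < (k.+1)`!%:R :> R by rewrite ltr0n fact_gt0.
  have -> : y ^+ k = (k.+1`!%:R / c ^+ k.+1) * ((c ^+ k.+1 * y ^+ k) / k.+1`!%:R).
    by field; rewrite !gt_eqF ?ltr0n ?fact_gt0 //.
  have e0 := expR_gt0 (c * y).
  rewrite mulrDl mul1r.
  apply: ler_wpDr; first exact: ltW.
  rewrite ler_wpM2l ?divr_ge0 ?(ltW cN) ?(ltW f0)//.
  apply: le_trans h; apply: ler_wpDl => //.
  rewrite ler_wpM2r ?invr_ge0 ?(ltW f0)// exprMn ler_wpM2l ?(ltW cN)//.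
  by rewrite exprS ler_peMl// exprn_ge0.
apply: (@le_trans _ _ 1); first by rewrite exprn_ile1// ltW.
rewrite -[leLHS]mul1r ler_pM//.
  by rewrite ler_wpDl// divr_ge0// exprn_ge0// ltW.
by rewrite -[leLHS]addr0; apply: le_trans (expR_ge1Dx _); rewrite lerD2l.
Qed.

(** A quadratic bound makes the derivative at 0 vanish; the factor y^2 that
    P(y) exp(-cy) absorbs is x^(-2). *)
Lemma flat_bound (R : realType) (c : R) (P : {poly R}) : 0 < c ->
  exists K : R, forall x, `|flat c P x| <= K * x ^+ 2.
Proof.
move=> c0; have [K hK] := expR_poly_bounded P 2 c0.
exists K => x; rewrite /flat; case: ifPn => [x0|_]; last first.
  have := hK 0 (lexx _); rewrite normr0 => h; rewrite mulr_ge0 ?sqr_ge0//.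
  by apply: le_trans h; rewrite mulr_ge0// expR_ge0.
rewrite -ler_pdivrMr ?exprn_gt0//.
have xi : 0 <= x^-1 by rewrite invr_ge0 ltW.
have := hK _ xi; rewrite normrM (ger0_norm (exprn_ge0 2 xi)) exprVn => h.
by rewrite normrM (ger0_norm (expR_ge0 _)) mulrAC.
Qed.

Definition flat' (R : realType) (c : R) (P : {poly R}) : {poly R} :=
  'X^2 * (c *: P - P^`()).

Lemma is_derive_flat (R : realType) (c : R) (P : {poly R}) (x : R) : 0 < c ->
  is_derive x 1 (flat c P) (flat c (flat' c P) x).
Proof.
move=> c0; have [x0|x0|->] := ltgtP x 0.
- rewrite {2}/flat ltNge (ltW x0)/=.
  apply: (@near_eq_is_derive _ _ _ (cst 0)).
    by near=> y; rewrite /flat ifF//; apply/negbTE; rewrite -leNgt ltW//; near: y; exact: lt_nbhsl.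
- have e : {near x, (fun y => P.[y^-1] * expR (- (c * y^-1))) =1 flat c P}.
    by near=> y; rewrite /flat ifT//; near: y; exact: lt_nbhsr.
  apply: (near_eq_is_derive e).
  have xn : x != 0 by rewrite gt_eqF.
  have dV : is_derive x 1 (fun y : R => y^-1) (- x ^- 2).
    apply: is_derive_eq; first exact: (@is_deriveV _ id).
    by rewrite scaler1.
  rewrite /flat x0 /flat' !hornerE.
  apply: is_derive_eq.
  rewrite /GRing.scale/= exprVn; field.
  exact: xn.
- rewrite {2}/flat ltxx.
  have [K hK] := flat_bound P c0.
  suff h : (fun h => h^-1 *: (flat c P (h *: 1 + 0) - flat c P 0)) @ 0^' --> (0 : R).
    by split; [apply/cvg_ex; exists 0|apply/cvg_lim].
  apply/cvgr0Pnorm_le => e e0.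
  have K1 : 0 < `|K| + 1 by rewrite ltr_pwDr.
  near=> h.
  have h0 : h != 0 by near: h; exact: nbhs_dnbhs_neq.
  rewrite /flat ltxx subr0 addr0 -/(flat c P (h *: 1)) [h *: 1]mulr1 normrZ normfV.
  rewrite ler_pdivrMl ?normr_gt0//.
  apply: (le_trans (hK h)).
  rewrite -(real_normK (num_real h)) expr2 mulrA mulrC ler_wpM2l//.
  have : `|h| < e / (`|K| + 1).
    by near: h; apply: dnbhs0_lt; rewrite divr_gt0.
  rewrite ltr_pdivlMr// => hh.
  apply: le_trans (ltW hh); rewrite mulrC ler_wpM2l//.
  by rewrite (le_trans (ler_norm _))// lerDl.
Unshelve. all: by end_near.
Qed.

Lemma continuous_flat (R : realType) (c : R) (P : {poly R}) : 0 < c -> continuous (flat c P).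
Proof.
move=> c0 x; apply: differentiable_continuous; apply/derivable1_diffP.
by have [] := is_derive_flat P x c0.
Qed.

(** Reduces directional derivatives to calculus in one variable: the difference
    quotients are the same function of the step. *)
Lemma is_derive_line (R : realType) (V : normedModType R) (f : V -> R) (x v : V) (s df : R) :
  is_derive s 1 (fun t : R => f (t *: v + x)) df <-> is_derive (s *: v + x) v f df.
Proof.
have e : (fun h : R => h^-1 *: (((fun t : R => f (t *: v + x)) \o shift s) (h *: 1) - f (s *: v + x))) =
  (fun h : R => h^-1 *: ((f \o shift (s *: v + x)) (h *: v) - f (s *: v + x))).
  by apply/funext => h /=; rewrite [h *: 1]mulr1 scalerDl addrA.
have d1 : derivable (fun t : R => f (t *: v + x)) s 1 = derivable f (s *: v + x) v.
  exact: (f_equal (fun F : R -> R => cvg (F @ 0^')) e).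
have d2 : 'D_1 (fun t : R => f (t *: v + x)) s = 'D_v f (s *: v + x).
  exact: (f_equal (fun F : R -> R => lim (F @ 0^')) e).
by split=> -[h1 h2]; split; [rewrite -d1|rewrite -d2|rewrite d1|rewrite d2].
Qed.

Lemma CkS (R : realType) d k (f : 'rV[R]_d -> R) : Ck k.+1 f -> Ck k f.
Proof.
elim: k f => [|k ih] f [cf h]; first by split.
by split=> // i; have [h1 h2] := h i; split=> //; exact: ih.
Qed.

Lemma CkD (R : realType) d k (f g : 'rV[R]_d -> R) :
  Ck k f -> Ck k g -> Ck k (fun x => f x + g x).
Proof.
elim: k f g => [|k ih] f g [cf hf] [cg hg]; split=> //;
  try by move=> x; apply: continuousD; [exact: cf|exact: cg].
move=> i; have [f1 f2] := hf i; have [g1 g2] := hg i; split.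
  by move=> x; apply: derivableD.
have -> : 'D_(delta_mx 0 i) (fun x => f x + g x) =
    (fun x => 'D_(delta_mx 0 i) f x + 'D_(delta_mx 0 i) g x).
  by apply/funext => x; rewrite (deriveD (f1 x) (g1 x)).
exact: ih.
Qed.

Lemma CkM (R : realType) d k (f g : 'rV[R]_d -> R) :
  Ck k f -> Ck k g -> Ck k (fun x => f x * g x).
Proof.
elim: k f g => [|k ih] f g hf hg; have [cf hf'] := hf; have [cg hg'] := hg; split=> //;
  try by move=> x; apply: continuousM; [exact: cf|exact: cg].
move=> i; have [f1 f2] := hf' i; have [g1 g2] := hg' i; split.
  by move=> x; apply: derivableM.
have -> : 'D_(delta_mx 0 i) (fun x => f x * g x) =
    (fun x => f x * 'D_(delta_mx 0 i) g x + g x * 'D_(delta_mx 0 i) f x).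
  by apply/funext => x; rewrite (deriveM (f1 x) (g1 x)).
by apply: CkD; apply: ih => //; exact: CkS.
Qed.

Lemma Ck_cst (R : realType) d k (a : R) : Ck k (fun _ : 'rV[R]_d => a).
Proof.
elim: k a => [|k ih] a; split=> //; try exact: cst_continuous.
move=> i; split; first by move=> x; exact: derivable_cst.
have -> : 'D_(delta_mx 0 i) (fun _ : 'rV[R]_d => a) = (fun=> 0).
  by apply/funext => x; rewrite derive_cst.
exact: ih.
Qed.

Lemma Ck_prod (R : realType) d k (I : finType) (f : I -> 'rV[R]_d -> R) :
  (forall i, Ck k (f i)) -> Ck k (fun x => \prod_i f i x).
Proof.
move=> h; rewrite -(_ : \big[(fun f g : 'rV[R]_d -> R => fun x => f x * g x)/(fun=> 1)]_i f i = (fun x => \prod_i f i x)).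
  by elim/big_ind : _ => // [|f1 g1]; [exact: Ck_cst|exact: CkM].
apply/funext => x; elim/big_rec2 : _ => // i y z _ ->; done.
Qed.

(** The affine change of variable and the factor r make the statement stable
    under partial derivatives, which only change r and P. *)
Lemma Ck_flat (R : realType) d k (c r s t : R) (P : {poly R}) (i : 'I_d) : 0 < c ->
  Ck k (fun x : 'rV[R]_d => r * flat c P (s * x 0 i + t)).
Proof.
move=> c0.
have cont r' P' : continuous (fun x : 'rV[R]_d => r' * flat c P' (s * x 0 i + t)).
  move=> x; apply: (@continuousM _ _ (fun=> r') (fun x : 'rV[R]_d => flat c P' (s * x 0 i + t))).
    exact: cst_continuous.
  apply: (@continuous_comp _ _ _ (fun x : 'rV[R]_d => s * x 0 i + t) (flat c P')); last exact: continuous_flat.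
  apply: (@continuousD _ _ _ (fun x : 'rV[R]_d => s * x 0 i) (fun=> t)); last exact: cst_continuous.
  apply: (@continuousM _ _ (fun=> s) (fun x : 'rV[R]_d => x 0 i)); first exact: cst_continuous.
  exact: coord_continuous.
elim: k r P => [|k ih] r P; split=> //.
move=> j.
have D x : is_derive x (delta_mx 0 j) (fun x : 'rV[R]_d => r * flat c P (s * x 0 i + t))
    ((r * s * (i == j)%:R) * flat c (flat' c P) (s * x 0 i + t)).
  rewrite -[x in is_derive x]add0r -[X in is_derive (X + _)](scale0r (delta_mx 0 j)).
  apply/is_derive_line.
  have -> : (fun h : R => r * flat c P (s * (h *: delta_mx 0 j + x) 0 i + t)) =
     (fun h : R => r * (flat c P \o (fun h : R => (s * (i == j)%:R) * h + (s * x 0 i + t))) h).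
    by apply/funext => h /=; rewrite !mxE eqxx /=; congr (_ * flat _ _ _); ring.
  have h1 : is_derive (0 : R) 1 (fun h : R => (s * (i == j)%:R) * h + (s * x 0 i + t)) (s * (i == j)%:R).
    by apply: is_derive_eq; rewrite /GRing.scale/=; ring.
  have h2 := is_derive_flat P (s * (i == j)%:R * 0 + (s * x 0 i + t)) c0.
  apply: is_derive_eq; rewrite /GRing.scale/= mulr0 add0r; ring.
split; first by move=> x; have [] := D x.
have -> : 'D_(delta_mx 0 j) (fun x : 'rV[R]_d => r * flat c P (s * x 0 i + t)) =
  (fun x => (r * s * (i == j)%:R) * flat c (flat' c P) (s * x 0 i + t)).
  by apply/funext => x; have [] := D x.
exact: ih.
Qed.

Lemma continuous_borel_measurable (R : realType) (T : ptopologicalType) (D : set T) (f : T -> R) :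
  measurable (D : set (borel T)) ->
  (forall O, open O -> exists2 U, open U & D `&` f @^-1` O = D `&` U) ->
  measurable_fun (D : set (borel T)) (f : borel T -> R).
Proof.
move=> mD h; apply: (measurability _ (RGenOpens.measurableE R)) => _ [_ [a [b ->]] <-].
have oab : open (`]a, b[%classic : set R) by exact: interval_open.
have [U oU e] := h _ oab.
rewrite [X in measurable X](_ : _ = (D : set (borel T)) `&` (U : set (borel T))) //.
by apply: measurableI => //; exact: open_borel.
Qed.

Lemma continuous_borel_measurableT (R : realType) (T : ptopologicalType) (f : T -> R) :
  continuous f -> measurable_fun setT (f : borel T -> R).
Proof.
move=> cf; apply: continuous_borel_measurable => // O oO.
exists (f @^-1` O) => //; apply: open_comp => // x _; exact: cf.
Qed.

Definition oobox (R : realType) n (a b : 'I_n -> R) : set 'rV[R]_n :=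
  box (fun i => `]a i, b i[%classic).
Definition ccbox (R : realType) n (a b : 'I_n -> R) : set 'rV[R]_n :=
  box (fun i => `[a i, b i]%classic).

Lemma measurable_oobox (R : realType) n (a b : 'I_n -> R) :
  measurable (oobox a b : set (borel 'rV[R]_n)).
Proof. by apply: measurable_box => i; exact: measurable_itv. Qed.

Lemma measurable_ccbox (R : realType) n (a b : 'I_n -> R) :
  measurable (ccbox a b : set (borel 'rV[R]_n)).
Proof. by apply: measurable_box => i; exact: measurable_itv. Qed.

Lemma sub_oobox_ccbox (R : realType) n (a b : 'I_n -> R) : oobox a b `<=` ccbox a b.
Proof.
by move=> x h i; have := h i; rewrite /= !in_itv /= => /andP[? ?]; rewrite !ltW.
Qed.

Lemma compact_ccbox (R : realType) n (a b : 'I_n -> R) : compact (ccbox a b).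
Proof.
have := @rV_compact R n (fun i => `[a i, b i]%classic) (fun i => @segment_compact R (a i) (b i)).
by congr compact.
Qed.

Lemma compact_borel (R : realType) n (K : set 'rV[R]_n) : compact K ->
  measurable (K : set (borel 'rV[R]_n)).
Proof.
move=> cK; have /closed_openC oK : closed K by apply: compact_closed => //; exact: norm_hausdorff.
by rewrite -[K]setCK; apply: measurableC; exact: open_borel.
Qed.

Lemma coord_le_norm (R : realType) n (x : 'rV[R]_n) i : `|x 0 i| <= `|x|.
Proof.
rewrite [leRHS](_ : _ = mx_norm x)// mx_normrE.
exact: (le_bigmax _ (fun ij : 'I_1 * 'I_n => `|x ij.1 ij.2|) (0, i)).
Qed.

Lemma compact_sub_ccbox (R : realType) n (K : set 'rV[R]_n) : compact K ->
  exists r : R, 0 < r /\ K `<=` ccbox (fun=> - r) (fun=> r).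
Proof.
move=> /compact_bounded /pinfty_ex_gt0 [r r0 Kr]; exists r; split=> // x Kx i /=.
rewrite in_itv /= -ler_norml; apply: le_trans (Kr _ Kx).
exact: coord_le_norm.
Qed.

Lemma compact_lebesgue_fin (R : realType) n (K : set 'rV[R]_n) : compact K ->
  (lebesgue_rV R n K < +oo)%E.
Proof.
move=> cK; have [r [_ Kr]] := compact_sub_ccbox cK.
apply: le_lt_trans (lebesgue_rV_ccbox_fin (fun=> - r) (fun=> r)).
by apply: le_measure => //; rewrite inE; [exact: compact_borel|exact: measurable_ccbox].
Qed.

(** Every open set is a countable union of boxes with rational data. Boxes are
    stable under intersection, which makes them fit for a Dynkin argument. *)
Lemma oobox_salgebra (R : realType) n :
  @measurable _ (borel 'rV[R]_n) =
  <<s [set B | exists a b : 'I_n -> R, B = oobox a b] >>.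
Proof.
apply/seteqP; split; last first.
  apply: smallest_sub; first exact: sigma_algebra_measurable.
  by move=> _ [a [b ->]]; exact: measurable_oobox.
apply: smallest_sub; first exact: smallest_sigma_algebra.
move=> V oV.
pose b (q : 'rV[rat]_n * nat) :=
  [set y : 'rV[R]_n | forall i, `|y 0 i - ratr (q.1 0 i)| < q.2.+1%:R^-1].
pose F k := if unpickle k is Some q then
  if `[< b q `<=` V >] then b q else set0 else set0.
have -> : V = \bigcup_k F k.
  apply/seteqP; split => [x /= Vx|x [k _]]; last first.
    by rewrite /F; case: unpickle => //= q; case: asboolP => // bO; exact: bO.
  have [q /= [bq bO]] := rV_rat_ball oV Vx.
  by exists (pickle q) => //; rewrite /F pickleK asboolT.
apply: sigma_algebra_bigcup => k; rewrite /F.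
case: unpickle => [q|]; last exact: sigma_algebra0.
case: asboolP => _; last exact: sigma_algebra0.
apply: sub_gen_smallest; exists (fun i => ratr (q.1 0 i) - q.2.+1%:R^-1), (fun i => ratr (q.1 0 i) + q.2.+1%:R^-1).
by apply/seteqP; split=> x h i; have := h i; rewrite /= ltr_distl in_itv.
Qed.

Lemma oobox_setI (R : realType) n (a b a' b' : 'I_n -> R) :
  oobox a b `&` oobox a' b' =
  oobox (fun i => Num.max (a i) (a' i)) (fun i => Num.min (b i) (b' i)).
Proof.
apply/seteqP; split=> [x [h h'] i|x h].
  have := h i; have := h' i; rewrite /= !in_itv/= => /andP[? ?] /andP[? ?].
  by rewrite gt_max lt_min; apply/andP; split; apply/andP.
by split=> i; have := h i; rewrite /= !in_itv/= gt_max lt_min => /andP[/andP[? ?] /andP[? ?]]; apply/andP.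
Qed.

Lemma oobox_setI_closed (R : realType) n :
  setI_closed [set B | exists a b : 'I_n -> R, B = oobox a b].
Proof.
move=> _ _ [a [b ->]] [a' [b' ->]].
by rewrite oobox_setI; exists (fun i => Num.max (a i) (a' i)), (fun i => Num.min (b i) (b' i)).
Qed.

Definition box_bump (R : realType) n (c : R) (a b : 'I_n -> R) (x : 'rV[R]_n) : R :=
  \prod_i (flat c 1 (x 0 i - a i) * flat c 1 (b i - x 0 i)).

Lemma flat1E (R : realType) (c x : R) : flat c 1 x = if 0 < x then expR (- (c / x)) else 0.
Proof. by rewrite /flat hornerC mul1r. Qed.

Lemma smooth_box_bump (R : realType) n (c : R) (a b : 'I_n -> R) : 0 < c ->
  smooth (box_bump c a b).
Proof.
move=> c0 k; apply: Ck_prod => i; apply: CkM.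
  have := @Ck_flat R n k c 1 1 (- a i) 1 i c0; congr Ck; apply/funext => x; by rewrite !mul1r.
have := @Ck_flat R n k c 1 (-1) (b i) 1 i c0; congr Ck; apply/funext => x.
by rewrite mul1r mulN1r addrC.
Qed.

Lemma box_bump_out (R : realType) n (c : R) (a b : 'I_n -> R) x :
  ~ oobox a b x -> box_bump c a b x = 0.
Proof.
move=> /existsNP[i /negP]; rewrite /= in_itv/= negb_and -!leNgt => h.
apply/eqP/prodf_eq0; exists i => //; rewrite !flat1E.
rewrite !subr_gt0 !ltNge.
by case/orP : h => ->; rewrite ?mul0r ?mulr0.
Qed.

Lemma flat1_ge0 (R : realType) (c x : R) : 0 <= flat c 1 x.
Proof. by rewrite flat1E; case: ifP => // _; exact: expR_ge0. Qed.

Lemma flat1_le1 (R : realType) (c x : R) : 0 < c -> flat c 1 x <= 1.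
Proof.
by move=> c0; rewrite flat1E; case: ifP => // x0; rewrite expR_le1 oppr_le0 divr_ge0// ltW.
Qed.

Lemma box_bump_ge0 (R : realType) n (c : R) (a b : 'I_n -> R) x : 0 <= box_bump c a b x.
Proof. by apply: prodr_ge0 => i _; rewrite mulr_ge0// flat1_ge0. Qed.

Lemma box_bump_le1 (R : realType) n (c : R) (a b : 'I_n -> R) x : 0 < c -> box_bump c a b x <= 1.
Proof.
move=> c0; apply: prodr_ile1 => i _; rewrite mulr_ge0 ?flat1_ge0//=.
by rewrite mulr_ile1 ?flat1_ge0 ?flat1_le1.
Qed.

Lemma flat1_cvg (R : realType) (x : R) : 0 < x -> flat n.+1%:R^-1 1 x @[n --> \oo] --> (1 : R).
Proof.
move=> x0.
have h : - (k.+1%:R^-1 / x) @[k --> \oo] --> (0 : R).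
  rewrite -[X in _ --> X]oppr0 -[X in _ --> - X](mul0r x^-1); apply: cvgN.
  by apply: cvgM; [exact: cvg_harmonic|exact: cvg_cst].
have ce : {for (0 : R), continuous (@expR R)} by exact: continuous_expR.
have : expR (- (k.+1%:R^-1 / x)) @[k --> \oo] --> expR (0 : R) by exact: (continuous_cvg _ ce h).
rewrite expR0; apply: cvg_trans; apply: near_eq_cvg.
by apply: nearW => k; rewrite flat1E x0.
Qed.

(** As c tends to 0 the bumps tend to the indicator of the open box; this plays
    the part of mollifying the indicator. *)
Lemma box_bump_cvg (R : realType) n (a b : 'I_n -> R) x : oobox a b x ->
  box_bump k.+1%:R^-1 a b x @[k --> \oo] --> (1 : R).
Proof.
move=> h; rewrite /box_bump.
pose F i (k : nat) : R := flat k.+1%:R^-1 1 (x 0 i - a i) * flat k.+1%:R^-1 1 (b i - x 0 i).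
have hF i : F i k @[k --> \oo] --> (1 : R).
  have := h i; rewrite /= in_itv /= => /andP[h1 h2].
  by rewrite -[X in _ --> X]mulr1; apply: cvgM; apply: flat1_cvg; rewrite subr_gt0.
elim: (index_enum _) => [|i s ih].
  by rewrite (_ : (fun _ => _) = fun=> 1); [exact: cvg_cst|apply/funext => k; rewrite big_nil].
rewrite (_ : (fun _ => _) = (fun k => F i k * \prod_(j <- s) F j k)); last first.
  by apply/funext => k; rewrite big_cons.
by rewrite -[X in _ --> X]mulr1; exact: cvgM.
Qed.

Lemma test_box_bump (R : realType) n (V : set 'rV[R]_n) (c : R) (a b : 'I_n -> R) : 0 < c ->
  ccbox a b `<=` V -> test_function V (box_bump c a b).
Proof.
move=> c0 sV; split; first exact: smooth_box_bump.
  exists (ccbox a b); split=> //; first exact: compact_ccbox.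
  by move=> x _ xn; apply: box_bump_out => /sub_oobox_ccbox.
by move=> x xV; apply: box_bump_out => /sub_oobox_ccbox/sV.
Qed.

(** * Test functions separate locally integrable functions *)

Definition locally_integrable (R : realType) n (V : set 'rV[R]_n) (g : 'rV[R]_n -> R) :=
  measurable_fun (V : set (borel 'rV[R]_n)) (g : borel 'rV[R]_n -> R) /\
  forall K, compact K -> K `<=` V ->
    (lebesgue_rV R n).-integrable (K : set (borel 'rV[R]_n)) (EFin \o g).

(** Turns integrals over a chart image against a test function into integrals
    over the whole space, on which translations act. *)
Lemma Rintegral_mul_support d (T : measurableType d) (R : realType)
    (mu : {measure set T -> \bar R}) (V K : set T) (g eta : T -> R) :
  K `<=` V -> (forall x, ~ K x -> eta x = 0) ->
  \int[mu]_(x in V) (g x * eta x) = \int[mu]_x ((g \_ K) x * eta x).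
Proof.
move=> KV h; rewrite Rintegral_mkcond; apply: eq_Rintegral => x _.
rewrite !patchE; case: ifPn => [/set_mem Vx|/negP nV].
  by case: ifPn => // /negP nK; rewrite h ?mulr0 ?mul0r// => Kx; apply: nK; exact: mem_set.
by rewrite h ?mulr0// => Kx; apply: nV; apply: mem_set; exact: KV.
Qed.

Lemma locally_integrable_patch (R : realType) n (V K : set 'rV[R]_n) (g : 'rV[R]_n -> R) :
  locally_integrable V g -> compact K -> K `<=` V ->
  (lebesgue_rV R n).-integrable setT (EFin \o (g \_ K) : borel 'rV[R]_n -> \bar R).
Proof.
move=> [_ ig] cK KV; rewrite -restrict_EFin.
by apply/(integrable_mkcond _ (compact_borel cK)); exact: ig.
Qed.

Lemma integrable_mul_bounded d (T : measurableType d) (R : realType)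
    (mu : {measure set T -> \bar R}) (D : set T) (g h : T -> R) (M : R) :
  measurable D -> mu.-integrable D (EFin \o g) -> measurable_fun D h ->
  (forall x, D x -> `|h x| <= M) -> mu.-integrable D (fun x => (g x * h x)%:E).
Proof.
move=> mD ig mh hM.
have -> : (fun x => (g x * h x)%:E) = (fun x => (EFin \o g) x * (EFin \o h) x)%E by [].
apply: integrableMl => //; exists M; split; first exact: num_real.
by move=> r Mr x Dx /=; rewrite (le_trans (hM _ Dx))// ltW.
Qed.

Lemma smooth_measurable (R : realType) n (eta : 'rV[R]_n -> R) : smooth eta ->
  measurable_fun setT (eta : borel 'rV[R]_n -> R).
Proof. by move=> /(_ 0%N) [c _]; exact: continuous_borel_measurableT. Qed.

(** Dominated convergence along the bumps. The closed box lies in V, so that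
    the bumps are test functions and g is integrable near the box. *)
Lemma integral_oobox_eq0 (R : realType) n (V : set 'rV[R]_n) (g : 'rV[R]_n -> R) (a b : 'I_n -> R) :
  locally_integrable V g ->
  (forall eta, test_function V eta -> \int[lebesgue_rV R n]_(x in V) (g x * eta x) = 0) ->
  ccbox a b `<=` V -> (\int[lebesgue_rV R n]_(x in oobox a b) (g x)%:E = 0)%E.
Proof.
move=> lg hg sV; pose m := lebesgue_rV R n; pose B := ccbox a b.
have ig : m.-integrable setT (EFin \o (g \_ B) : borel 'rV[R]_n -> \bar R).
  exact: (locally_integrable_patch lg (compact_ccbox (a:=a) (b:=b)) sV).
have mg : measurable_fun setT (g \_ B : borel 'rV[R]_n -> R).
  by apply/measurable_EFinP; exact: measurable_int ig.
pose eta k := box_bump k.+1%:R^-1 a b.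
have seta k : smooth (eta k) by exact: smooth_box_bump.
pose f_ k (x : borel 'rV[R]_n) := ((g \_ B) x * eta k x)%:E.
pose f (x : borel 'rV[R]_n) := ((g \_ B) x * \1_(oobox a b) x)%:E.
have mf_ k : measurable_fun setT (f_ k).
  by apply/measurable_EFinP; apply: measurable_funM => //; exact: smooth_measurable.
have mf : measurable_fun setT f.
  apply/measurable_EFinP; apply: measurable_funM => //.
  by apply: measurable_indic; exact: measurable_oobox.
have eta1 k x : `|eta k x| <= 1 by rewrite ger0_norm ?box_bump_ge0// box_bump_le1.
have cvf : \forall x \ae m, setT x -> f_ ^~ x @ \oo --> f x.
  apply: aeW => x _; rewrite /f_ /f; apply: cvg_EFin; first by apply: nearW.
  apply: cvgM; first exact: cvg_cst.
  rewrite indicE; case: (boolP (x \in _)) => [/set_mem xo|/negP xo]; first exact: box_bump_cvg.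
  rewrite (_ : (fun _ => _) = fun=> 0); first exact: cvg_cst.
  by apply/funext => k; rewrite /= /eta box_bump_out// => h; apply: xo; exact: mem_set.
have dom : \forall x \ae m, forall n : nat, setT x -> (`|f_ n x| <= `|(EFin \o (g \_ B)) x|)%E.
  by apply: aeW => x k _; rewrite /f_ /= lee_fin normrM ler_piMr.
have [_ _] := @dominated_convergence _ _ _ m _ measurableT f_ f _ mf_ mf cvf (integrable_abse ig) dom.
rewrite (_ : [sequence _]_n = fun=> 0%E); last first.
  apply/funext => k /=.
  have := hg _ (test_box_bump (c := k.+1%:R^-1) _ sV); rewrite invr_gt0 ltr0Sn => /(_ isT).
  rewrite (@Rintegral_mul_support _ (borel 'rV[R]_n) _ _ _ B)//; last first.
    by move=> x xB; rewrite box_bump_out// => /sub_oobox_ccbox.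
  rewrite /Rintegral => h; rewrite -[LHS]fineK ?h//.
  apply: integrable_fin_num => //.
  by apply: (@integrable_mul_bounded _ _ _ _ _ _ _ 1) => //; exact: smooth_measurable.
move=> /(cvg_unique _ (cvg_cst 0%E)) => e; rewrite integral_mkcond.
rewrite [RHS]e//; apply: eq_integral => x _.
rewrite /f !patchE indicE; case: (boolP (x \in oobox a b)) => [/set_mem xo|_]; last by rewrite mulr0.
by rewrite ifT ?mulr1//; apply: mem_set; exact: sub_oobox_ccbox.
Qed.

(** Only boxes whose closure lies in V are used, so that their bumps are test
    functions of V. *)
Lemma oobox_cover (R : realType) n (V : set 'rV[R]_n) : open V ->
  exists S : nat -> set 'rV[R]_n, V = \bigcup_k S k /\
    forall k, S k = set0 \/ exists a b, S k = oobox a b /\ ccbox a b `<=` V.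
Proof.
move=> oV.
pose lo (q : 'rV[rat]_n * nat) (i : 'I_n) : R := ratr (q.1 0 i) - q.2.+1%:R^-1.
pose hi (q : 'rV[rat]_n * nat) (i : 'I_n) : R := ratr (q.1 0 i) + q.2.+1%:R^-1.
pose S k := if unpickle k is Some q then
  if `[< ccbox (lo q) (hi q) `<=` V >] then oobox (lo q) (hi q) else set0 else set0.
exists S; split; last first.
  move=> k; rewrite /S; case: unpickle => [q|]; last by left.
  by case: asboolP => [h|_]; [right; exists (lo q), (hi q)|left].
apply/seteqP; split => [x /= Vx|x [k _]]; last first.
  rewrite /S; case: unpickle => //= q; case: asboolP => // bO /sub_oobox_ccbox.
  exact: bO.
have /nbhs_ballP[e /= e0 eV] : nbhs x V by exact: open_nbhs_nbhs.
have [k _ ke] := near_infty_natSinv_lt (PosNum (divr_gt0 e0 (ltr0Sn R 1))).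
have {}ke := ke k (leqnn _).
have qE i : exists q : rat, `|x 0 i - ratr q| < k.+1%:R^-1.
  have : x 0 i - k.+1%:R^-1 < x 0 i + k.+1%:R^-1 by rewrite ltrD2l gtrN// invr_gt0.
  move=> /rat_in_itvoo[q]; rewrite in_itv/= => /andP[q1 q2].
  by exists q; rewrite ltr_norml; apply/andP; split; move: q1 q2; move: (k.+1%:R^-1) => r *; lra.
have [q qP] := choice qE.
exists (pickle (\row_i q i, k)) => //; rewrite /S pickleK asboolT => [i|y yq].
  by have := qP i; rewrite /= in_itv/= /lo /hi /= mxE ltr_distl.
apply: eV; split => // i j; rewrite [i]ord1 -ball_normE /=.
have := yq j; have := qP j; rewrite /= in_itv/= /lo /hi /= mxE -ler_distl => h1 h2.
apply: (le_lt_trans (ler_distD (ratr (q j)) _ _)).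
by move: ke h1 h2; rewrite (distrC (ratr _)) /=; move: (k.+1%:R^-1) => r *; lra.
Qed.

(** The integrals of g over small open boxes vanish. Open boxes are stable
    under intersection and generate the Borel sets, so by Dynkin induction the
    integrals over all Borel subsets of a small box vanish, and g with them. *)
Lemma fundamental_lemma (R : realType) n (V : set 'rV[R]_n) (g : 'rV[R]_n -> R) :
  open V -> locally_integrable V g ->
  (forall eta, test_function V eta -> \int[lebesgue_rV R n]_(x in V) (g x * eta x) = 0) ->
  {ae lebesgue_rV R n, forall x, V x -> g x = 0}.
Proof.
move=> oV lg hg; pose m := lebesgue_rV R n.
suff h a b : ccbox a b `<=` V -> {ae m, forall x, oobox a b x -> g x = 0}.
  have [S [VS hS]] := oobox_cover oV.
  have : \forall x \ae m, forall k, S k x -> g x = 0.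
    apply: ae_foralln => k; have [->|[a [b [-> sV]]]] := hS k; last exact: h.
    by apply: aeW => x [].
  by apply: ae_imp => x hx; rewrite VS => -[k _ Sx]; exact: hx Sx.
move=> sV; pose D : set (borel 'rV[R]_n) := oobox a b.
have mD : measurable D by exact: measurable_oobox.
have ig : m.-integrable D (EFin \o g).
  apply: (integrableS (measurable_ccbox a b) mD); first exact: sub_oobox_ccbox.
  by apply: lg.2 sV; exact: compact_ccbox.
have key (E : set (borel 'rV[R]_n)) : measurable E -> (\int[m]_(x in D `&` E) (g x)%:E = 0)%E.
  move=> mE.
  have : <<s [set B | exists a b : 'I_n -> R, B = oobox a b] >> E by rewrite -oobox_salgebra.
  apply: (@dynkin_induction _ (borel 'rV[R]_n) [set B | exists a b : 'I_n -> R, B = oobox a b]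
     (fun E => (\int[m]_(x in D `&` E) (g x)%:E = 0)%E)).
  - exact: oobox_salgebra.
  - exact: oobox_setI_closed.
  - rewrite setIT; exact: integral_oobox_eq0 lg hg sV.
  - move=> _ [a' [b' ->]].
    rewrite /D oobox_setI; apply: (integral_oobox_eq0 lg hg); apply: subset_trans sV => x h i.
    by have := h i; rewrite /= !in_itv/= ge_max le_min => /andP[/andP[-> _] /andP[-> _]].
  - move=> A mA h.
    have : (\int[m]_(x in (D `&` A) `|` (D `&` ~` A)) (g x)%:E = 0)%E.
      by rewrite -setIUr setUv setIT; exact: integral_oobox_eq0 lg hg sV.
    rewrite integral_setU//.
    + by rewrite [X in (X + _)%E]h add0e.
    + exact: measurableI.
    + by apply: measurableI => //; exact: measurableC.
    + by rewrite -setIUr setUv setIT; exact: measurable_int ig.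
    + by rewrite disj_set2E -setIIr setICr setI0.
  - move=> F mF tF h; rewrite setI_bigcupr integral_bigcup.
    + by apply: eseries0 => k _ _; exact: h.
    + by apply: trivIset_setIl.
    + by move=> k; exact: measurableI.
    + rewrite -setI_bigcupr; apply: (integrableS mD) => //.
      by apply: measurableI => //; exact: bigcupT_measurable.
apply: (ae_imp _ (@integral_ae_eq _ _ _ m D mD (cst 0%E) (EFin \o g) ig _ _)) => //.
- by move=> x h /h [].
- move=> E ED mE; rewrite integral0 -(key _ mE); congr integral.
  by apply/esym/setIidPr.
Qed.

(** * Square-integrable functions *)

Section square_integrable.
Context d (T : measurableType d) (R : realType) (mu : {measure set T -> \bar R}).
Implicit Types f g h : T -> R.

Definition sqint f := measurable_fun setT f /\ (\int[mu]_x (f x ^+ 2)%:E < +oo)%E.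

Lemma sqint_Lfun f : (f \in Lfun mu 2%:E) <-> sqint f.
Proof.
split=> [fL|[mf If]].
  split; first by move: fL; rewrite inE => /andP[]; rewrite inE.
  have /integrableP[_] := Lfun2_integrable_sqr fL.
  apply: le_lt_trans; under [leRHS]eq_integral do rewrite /= ger0_norm ?sqr_ge0//.
  by [].
rewrite inE; apply/andP; split; rewrite inE//= /finite_norm unlock.
apply: poweR_lty; move: If; under eq_integral => x _.
  rewrite (_ : (f x ^+ 2)%:E = (`|(EFin \o f) x| `^ 2)%E); last first.
    by rewrite /= powR_mulrn// real_normK// num_real.
  over.
by [].
Qed.

Lemma sqint_integrable f : sqint f -> mu.-integrable setT (fun x => (f x ^+ 2)%:E).
Proof.
move=> [mf If]; apply/integrableP; split; first by apply/measurable_EFinP; exact: measurable_funX.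
by under eq_integral do rewrite /= ger0_norm ?sqr_ge0//.
Qed.

Lemma le_sqint f g : measurable_fun setT f -> (forall x, `|f x| <= `|g x|) -> sqint g -> sqint f.
Proof.
move=> mf fg [mg Ig]; split=> //; apply: le_lt_trans Ig.
apply: ge0_le_integral => //.
- by move=> x _; rewrite lee_fin sqr_ge0.
- by apply/measurable_EFinP; exact: measurable_funX.
- by apply/measurable_EFinP; exact: measurable_funX.
- move=> x _; rewrite lee_fin -(real_normK (num_real (f x))) -(real_normK (num_real (g x))).
  by rewrite lerXn2r// ?nnegrE.
Qed.

Lemma sqintZ (c : R) f : sqint f -> sqint (fun x => c * f x).
Proof.
move=> sf; have [mf _] := sf; split; first exact: measurable_funM.
have /integrableP[_] := integrableZl measurableT (c ^+ 2) (sqint_integrable sf).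
apply: le_lt_trans; apply: ge0_le_integral => //.
- by move=> x _; rewrite lee_fin sqr_ge0.
- by apply/measurable_EFinP; apply: measurable_funX; exact: measurable_funM.
- apply: measurableT_comp => //; apply: emeasurable_funM => //.
  by apply/measurable_EFinP; exact: measurable_funX.
- by move=> x _; rewrite -EFinM lee_fin exprMn ler_norm.
Qed.

Lemma sqintD f g : sqint f -> sqint g -> sqint (fun x => f x + g x).
Proof.
move=> sf sg; have [mf _] := sf; have [mg _] := sg; split; first exact: measurable_funD.
have h := integrableZl measurableT 2 (integrableD measurableT (sqint_integrable sf) (sqint_integrable sg)).
have /integrableP[mh] := h.
apply: le_lt_trans; apply: ge0_le_integral => //.
- by move=> x _; rewrite lee_fin sqr_ge0.
- by apply/measurable_EFinP; apply: measurable_funX; exact: measurable_funD.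
- exact: measurableT_comp.
- move=> x _; rewrite /= lee_fin ger0_norm; last by rewrite mulr_ge0// addr_ge0// sqr_ge0.
  by have := sqr_ge0 (f x - g x); nra.
Qed.

Lemma sqintB f g : sqint f -> sqint g -> sqint (fun x => f x - g x).
Proof.
move=> sf sg; have := sqintD sf (sqintZ (-1) sg).
by under [X in sqint X -> _]eq_fun do rewrite mulN1r.
Qed.

Lemma sqint_mul f g : sqint f -> sqint g -> mu.-integrable setT (fun x => (f x * g x)%:E).
Proof.
move=> sf sg; have [mf _] := sf; have [mg _] := sg.
apply: le_integrable (integrableD measurableT (sqint_integrable sf) (sqint_integrable sg)) => //.
  by apply/measurable_EFinP; exact: measurable_funM.
move=> x _; rewrite /= lee_fin [leRHS]ger0_norm ?addr_ge0 ?sqr_ge0// ler_norml.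
have := sqr_ge0 (f x - g x); have := sqr_ge0 (f x + g x) => h1 h2.
by have := sqr_ge0 (f x); have := sqr_ge0 (g x) => h3 h4; apply/andP; split; nra.
Qed.

Lemma sqint_mul_bounded f g (c : R) : sqint f -> measurable_fun setT g ->
  (forall x, `|g x| <= c) -> sqint (fun x => g x * f x).
Proof.
move=> sf mg gc; have [mf _] := sf; apply: le_sqint (sqintZ c sf).
  exact: measurable_funM.
move=> x; rewrite !normrM ler_wpM2r//; exact: le_trans (gc x) (ler_norm _).
Qed.

Lemma Rintegral_sqr_ge0 f : 0 <= \int[mu]_x (f x ^+ 2).
Proof. by apply: Rintegral_ge0 => x _; exact: sqr_ge0. Qed.

Lemma Rintegral_sqrD f g : sqint f -> sqint g ->
  \int[mu]_x ((f x + g x) ^+ 2) =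
  \int[mu]_x (f x ^+ 2) + 2 * \int[mu]_x (f x * g x) + \int[mu]_x (g x ^+ 2).
Proof.
move=> sf sg.
have i1 := sqint_integrable sf; have i2 := sqint_integrable sg; have i3 := sqint_mul sf sg.
have i4 : mu.-integrable setT (EFin \o (fun x => 2 * (f x * g x))) by exact: (integrableZl measurableT 2 i3).
rewrite -RintegralZl// -RintegralD// -RintegralD//; last exact: (integrableD measurableT i1 i4).
by apply: eq_Rintegral => x _; ring.
Qed.

Lemma Rintegral_sqrZ (c : R) f : sqint f ->
  \int[mu]_x ((c * f x) ^+ 2) = c ^+ 2 * \int[mu]_x (f x ^+ 2).
Proof.
move=> sf; rewrite -RintegralZl//; last exact: (sqint_integrable sf).
by apply: eq_Rintegral => x _; rewrite exprMn.
Qed.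

(** The integral of (t f + g)^2 is nonnegative for every t; the minimising t
    gives the discriminant inequality. *)
Lemma cauchy_schwarz_sqr f g : sqint f -> sqint g ->
  (\int[mu]_x (f x * g x)) ^+ 2 <= \int[mu]_x (f x ^+ 2) * \int[mu]_x (g x ^+ 2).
Proof.
move=> sf sg.
set A := \int[mu]_x (f x ^+ 2); set B := \int[mu]_x (f x * g x); set C := \int[mu]_x (g x ^+ 2).
have A0 : 0 <= A by exact: Rintegral_sqr_ge0.
have C0 : 0 <= C by exact: Rintegral_sqr_ge0.
have key t : 0 <= t ^+ 2 * A + 2 * (t * B) + C.
  rewrite /A -Rintegral_sqrZ// /B -RintegralZl//; last exact: sqint_mul.
  rewrite (_ : \int[mu]_x (t * (f x * g x)) = \int[mu]_x ((t * f x) * g x)); last first.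
    by apply: eq_Rintegral => x _; rewrite mulrA.
  by rewrite /C -Rintegral_sqrD//; [exact: Rintegral_sqr_ge0|exact: sqintZ].
(* for A = 0 an affine function of t is bounded below, hence constant; the t
   chosen would give it the value -1 *)
have [A00|An0] := eqVneq A 0.
  rewrite A00 mul0r; have [->|Bn0] := eqVneq B 0; first by rewrite expr0n.
  have := key (- (C + 1) / (2 * B)); rewrite A00 mulr0 add0r.
  rewrite (_ : 2 * _ = - (C + 1)); first by lra.
  by field.
have := key (- B / A); rewrite (_ : _ + C = C - B ^+ 2 / A); last by field.
rewrite subr_ge0 ler_pdivrMr ?lt0r ?An0//.
by rewrite mulrC.
Qed.

Lemma cauchy_schwarz f g : sqint f -> sqint g ->
  `|\int[mu]_x (f x * g x)| <=
  Num.sqrt (\int[mu]_x (f x ^+ 2)) * Num.sqrt (\int[mu]_x (g x ^+ 2)).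
Proof.
move=> sf sg; rewrite -sqrtrM ?Rintegral_sqr_ge0// -sqrtr_sqr ler_wsqrtr//.
exact: cauchy_schwarz_sqr.
Qed.

End square_integrable.

(** Pairing a function with itself bounds its squared norm e by c sqrt e; this
    turns such a bound into one that does not involve e. *)
Lemma le_sqr_of_sqrt (R : rcfType) (c e : R) : 0 <= c -> 0 <= e -> e <= c * Num.sqrt e -> e <= c ^+ 2.
Proof.
move=> c0 e0 h; have [->|en0] := eqVneq e 0; first exact: sqr_ge0.
have se0 : 0 < Num.sqrt e by rewrite sqrtr_gt0 lt_neqAle eq_sym en0.
have : Num.sqrt e <= c by rewrite -(ler_pM2r se0) -expr2 sqr_sqrtr.
by move=> h'; rewrite -[leLHS]sqr_sqrtr// lerXn2r// ?nnegrE ?sqrtr_ge0.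
Qed.

Lemma Rintegral_indic_fine d (T : measurableType d) (R : realType) (mu : {measure set T -> \bar R}) (A : set T) :
  measurable A -> \int[mu]_x (\1_A x : R) = fine (mu A).
Proof. by move=> mA; rewrite /Rintegral integral_indic// setIT. Qed.

Lemma integrable_indic_fin d (T : measurableType d) (R : realType) (mu : {measure set T -> \bar R}) (A : set T) :
  measurable A -> (mu A < +oo)%E -> mu.-integrable setT (EFin \o (\1_A : T -> R)).
Proof.
move=> mA fA; apply/integrableP; split; first by apply/measurable_EFinP; exact: measurable_indic.
rewrite (_ : (fun x => _) = (fun x => (\1_A x)%:E)); first by rewrite integral_indic// setIT.
by apply/funext => x /=; rewrite ger0_norm.
Qed.

Lemma sqint_indic d (T : measurableType d) (R : realType) (mu : {measure set T -> \bar R}) (A : set T) :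
  measurable A -> (mu A < +oo)%E -> sqint mu (\1_A : T -> R).
Proof.
move=> mA fA; split; first exact: measurable_indic.
rewrite (_ : (fun x => _) = (fun x => (\1_A x)%:E)); first by rewrite integral_indic// setIT.
by apply/funext => x; rewrite indicE; case: (_ \in _); rewrite ?expr1n ?expr0n.
Qed.

(** * Integrals along coordinate lines *)

Lemma smooth_partial (R : realType) n (eta : 'rV[R]_n -> R) i : smooth eta ->
  smooth ('D_(delta_mx 0 i) eta).
Proof. by move=> h k; have [_ /(_ i)[]] := h k.+1. Qed.

Lemma smooth_derivable (R : realType) n (eta : 'rV[R]_n -> R) i x : smooth eta ->
  derivable eta x (delta_mx 0 i).
Proof. by move=> /(_ 1%N) [_ /(_ i)[+ _]]; exact. Qed.

Lemma smooth_continuous (R : realType) n (eta : 'rV[R]_n -> R) : smooth eta -> continuous eta.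
Proof. by move=> /(_ 0%N)[]. Qed.

Lemma derivable_addr (R : realType) (V : normedModType R) (f : V -> R) (z x v : V) :
  (derivable (fun x => f (x + z)) x v = derivable f (x + z) v) *
  ('D_v (fun x => f (x + z)) x = 'D_v f (x + z)).
Proof.
have e : (fun h : R => h^-1 *: (((fun x => f (x + z)) \o shift x) (h *: v) - f (x + z))) =
  (fun h : R => h^-1 *: ((f \o shift (x + z)) (h *: v) - f (x + z))).
  by apply/funext => h /=; rewrite addrA.
split; first exact: (f_equal (fun F : R -> R => cvg (F @ 0^')) e).
exact: (f_equal (fun F : R -> R => lim (F @ 0^')) e).
Qed.

Lemma Ck_addr (R : realType) n k (f : 'rV[R]_n -> R) (z : 'rV[R]_n) : Ck k f -> Ck k (fun x => f (x + z)).
Proof.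
have ct (g : 'rV[R]_n -> R) : continuous g -> continuous (fun x : 'rV[R]_n => g (x + z)).
  move=> cg x; apply: (@continuous_comp _ _ _ (fun x : 'rV[R]_n => x + z) g); last exact: cg.
  by apply: (@continuousD _ _ _ id (fun=> z)); [by move=> ?|exact: cst_continuous].
elim: k f => [|k ih] f [cf hf]; split=> //; try exact: ct.
move=> i; have [h1 h2] := hf i; split.
  by move=> x; rewrite derivable_addr; exact: h1.
have -> : 'D_(delta_mx 0 i) (fun x => f (x + z)) = (fun x => 'D_(delta_mx 0 i) f (x + z)).
  by apply/funext => x; rewrite derivable_addr.
exact: (ih ('D_(delta_mx 0 i) f) h2).
Qed.

Lemma smooth_addr (R : realType) n (f : 'rV[R]_n -> R) (z : 'rV[R]_n) : smooth f -> smooth (fun x => f (x + z)).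
Proof. by move=> h k; exact: Ck_addr. Qed.

Definition vanish_off (T : Type) (R : realType) (K : set T) (f : T -> R) :=
  forall x, ~ K x -> f x = 0.

Lemma test_function_support (R : realType) n (V : set 'rV[R]_n) eta :
  test_function V eta -> exists2 K, compact K /\ K `<=` V & vanish_off K eta.
Proof.
move=> [_ [K [cK KV hK]] hV]; exists K; first by [].
by move=> x nK; have [Vx|nV] := pselect (V x); [exact: hK|exact: hV].
Qed.

Lemma vanish_off_partial (R : realType) n (K : set 'rV[R]_n) (eta : 'rV[R]_n -> R) i :
  compact K -> vanish_off K eta -> vanish_off K ('D_(delta_mx 0 i) eta).
Proof.
move=> cK hK x nK.
have oK : open (~` K) by apply: closed_openC; apply: compact_closed => //; exact: norm_hausdorff.
rewrite (@near_eq_derive _ _ _ _ (fun=> 0)) ?derive_cst//.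
by near=> y; apply: hK; near: y; exact: open_nbhs_nbhs.
Unshelve. all: by end_near.
Qed.

Lemma vanish_off_bounded (R : realType) n (K : set 'rV[R]_n) (eta : 'rV[R]_n -> R) :
  compact K -> continuous eta -> vanish_off K eta ->
  exists2 M : R, 0 < M & forall x, `|eta x| <= M.
Proof.
move=> cK ce hK.
have : compact (eta @` K) by apply: continuous_compact => //; exact: continuous_subspaceT.
move=> /compact_bounded /pinfty_ex_gt0 [M M0 hM]; exists M => // x.
have [Kx|/hK ->] := pselect (K x); last by rewrite normr0 ltW.
by apply: hM; exists x.
Qed.

(** Test functions are followed backwards, along x - t e, because translations
    of the other factor are moved onto them. *)
Lemma partial_line (R : realType) n (eta : 'rV[R]_n -> R) i (x : 'rV[R]_n) (s : R) : smooth eta ->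
  is_derive s 1 (fun t : R => eta (x - t *: delta_mx 0 i))
    (- 'D_(delta_mx 0 i) eta (x - s *: delta_mx 0 i)).
Proof.
move=> se.
pose g (t : R) := eta (t *: delta_mx 0 i + x).
have -> : (fun t : R => eta (x - t *: delta_mx 0 i)) = g \o -%R.
  by apply/funext => t; rewrite /g /= scaleNr addrC.
have h : is_derive (- s) 1 g ('D_(delta_mx 0 i) eta (x - s *: delta_mx 0 i)).
  rewrite addrC -scaleNr; apply/is_derive_line; apply: derivableP.
  exact: smooth_derivable.
have h2 := @is_derive1_comp _ g -%R s _ _ h (is_deriveNid s 1).
apply: (is_derive_eq h2); rewrite /GRing.scale/=; ring.
Qed.

Lemma line_continuous (R : realType) n (eta : 'rV[R]_n -> R) (v x : 'rV[R]_n) : continuous eta ->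
  continuous (fun t : R => eta (x - t *: v)).
Proof.
move=> ce t; apply: (@continuous_comp _ _ _ (fun t : R => x - t *: v) eta); last exact: ce.
apply: (@continuousB _ _ _ (fun=> x) (fun t : R => t *: v)); first exact: cst_continuous.
exact: scalel_continuous.
Qed.

Lemma line_MVT (R : realType) n (eta : 'rV[R]_n -> R) i (x : 'rV[R]_n) (h : R) : smooth eta -> 0 < h ->
  exists2 c, 0 <= c <= h & eta x - eta (x - h *: delta_mx 0 i) =
    h * 'D_(delta_mx 0 i) eta (x - c *: delta_mx 0 i).
Proof.
move=> se h0.
have [||c ch e] := @MVT R (fun t => eta (x - t *: delta_mx 0 i))
   (fun s => - 'D_(delta_mx 0 i) eta (x - s *: delta_mx 0 i)) 0 h h0.
- by move=> s _; exact: partial_line.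
- by apply: continuous_subspaceT; apply: line_continuous; exact: smooth_continuous.
exists c; first by move: ch; rewrite in_itv/= => /andP[/ltW -> /ltW ->].
rewrite -[LHS]opprB; move: e; rewrite scale0r !subr0 => ->; ring.
Qed.

Lemma integral_line_partial (R : realType) n (eta : 'rV[R]_n -> R) i (x : 'rV[R]_n) (h : R) : smooth eta -> 0 < h ->
  (\int[lebesgue_measure]_(s in `[0%R, h]) ('D_(delta_mx 0 i) eta (x - s *: delta_mx 0 i))%:E =
   (eta x - eta (x - h *: delta_mx 0 i))%:E)%E.
Proof.
move=> se h0.
pose F (t : R) := - eta (x - t *: delta_mx 0 i).
have dF (s : R) : is_derive s 1 F ('D_(delta_mx 0 i) eta (x - s *: delta_mx 0 i)).
  by have hh := partial_line i x s se; apply: is_derive_eq; rewrite opprK.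
have cF : continuous F.
  move=> t; apply: continuousN; apply: line_continuous; exact: smooth_continuous.
rewrite (@continuous_FTC2 _ _ F)//.
- by rewrite /F scale0r subr0 -EFinB; congr EFin; ring.
- have cD : continuous (fun t : R => 'D_(delta_mx 0 i) eta (x - t *: delta_mx 0 i)).
    by apply: (@line_continuous _ _ ('D_(delta_mx 0 i) eta) (delta_mx 0 i) x); apply: smooth_continuous; exact: smooth_partial.
  exact: (continuous_subspaceT cD).
- split.
  + by move=> s _; have [] := dF s.
  + by apply: cvg_at_right_filter; exact: cF.
  + by apply: cvg_at_left_filter; exact: cF.
- by move=> s _; rewrite derive1E; have [] := dF s.
Qed.

Section product_measurability.
Context d1 d2 (T1 : measurableType d1) (T2 : measurableType d2) (R : realType).
Context (m1 : {sigma_finite_measure set T1 -> \bar R}) (m2 : {sigma_finite_measure set T2 -> \bar R}).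

Lemma measurable_integral1 (F : T1 * T2 -> \bar R) : measurable_fun setT F ->
  measurable_fun setT (fun y => \int[m1]_x F (x, y))%E.
Proof.
move=> mF; under eq_fun do rewrite integralE.
apply: emeasurable_funB.
  rewrite (_ : (fun y => _) = (fun y => \int[m1]_x (F^\+ (x, y)))%E); last first.
    by apply/funext => y; apply: eq_integral => x _; rewrite !funeposE.
  by apply: measurable_fun_fubini_tonelli_G; [exact: measurable_funepos|exact: funepos_ge0].
rewrite (_ : (fun y => _) = (fun y => \int[m1]_x (F^\- (x, y)))%E); last first.
  by apply/funext => y; apply: eq_integral => x _; rewrite !funenegE.
by apply: measurable_fun_fubini_tonelli_G; [exact: measurable_funeneg|exact: funeneg_ge0].
Qed.

Lemma measurable_integral2 (F : T1 * T2 -> \bar R) : measurable_fun setT F ->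
  measurable_fun setT (fun x => \int[m2]_y F (x, y))%E.
Proof.
move=> mF; under eq_fun do rewrite integralE.
apply: emeasurable_funB.
  rewrite (_ : (fun y => _) = (fun x => \int[m2]_y (F^\+ (x, y)))%E); last first.
    by apply/funext => y; apply: eq_integral => x _; rewrite !funeposE.
  by apply: measurable_fun_fubini_tonelli_F; [exact: measurable_funepos|exact: funepos_ge0].
rewrite (_ : (fun y => _) = (fun x => \int[m2]_y (F^\- (x, y)))%E); last first.
  by apply/funext => y; apply: eq_integral => x _; rewrite !funenegE.
by apply: measurable_fun_fubini_tonelli_F; [exact: measurable_funeneg|exact: funeneg_ge0].
Qed.

End product_measurability.

Section line_average.
Context (R : realType) (n : nat) (h : R) (v : 'rV[R]_n).
Hypothesis h0 : 0 < h.
Let m := lebesgue_rV R n.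
Let L : {sigma_finite_measure set (measurableTypeR R) -> \bar R} := @lebesgue_measure R.
Let I0 : set R := `[0, h]%classic.
Let mI0 : measurable_fun [set: R] (\1_I0 : R -> R).
Proof. by apply: measurable_indic; exact: measurable_itv. Qed.

Let LI0 : (\int[L]_s (\1_I0 s)%:E = h%:E)%E.
Proof.
rewrite (@integral_indic _ _ _ L setT measurableT I0); last exact: measurable_itv.
by rewrite setIT [LHS]lebesgue_measure_itv/= lte_fin h0 -EFinB subr0.
Qed.

Let iI0 : L.-integrable setT (fun s => (\1_I0 s)%:E).
Proof.
apply/integrableP; split; first by apply/measurable_EFinP.
by under eq_integral do rewrite /= ger0_norm//; rewrite LI0 ltry.
Qed.

Lemma measurable_line : measurable_fun setT
  (fun z : borel 'rV[R]_n * R => (z.1 : 'rV[R]_n) + z.2 *: v : borel 'rV[R]_n).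
Proof.
apply: measurable_fun_rV => j; under eq_fun do rewrite !mxE.
apply: measurable_funD.
  by apply: (measurableT_comp (measurable_borel_coord j)); exact: measurable_fst.
by apply: measurable_funM => //; exact: measurable_snd.
Qed.

Lemma measurable_line_fun (u : 'rV[R]_n -> R) : measurable_fun setT (u : borel 'rV[R]_n -> R) ->
  measurable_fun setT (fun z : borel 'rV[R]_n * R => \1_I0 z.2 * u ((z.1 : 'rV[R]_n) + z.2 *: v)).
Proof.
move=> mu; apply: measurable_funM.
  exact: (measurableT_comp mI0 measurable_snd).
exact: (measurableT_comp mu measurable_line).
Qed.

(** By translation invariance the integral over s of the L^1 norms of the
    shifts is h times the norm of u. *)
Lemma integrable_line (u : 'rV[R]_n -> R) : m.-integrable setT (EFin \o u : borel 'rV[R]_n -> \bar R) ->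
  (m \x L)%E.-integrable setT
    (fun z : borel 'rV[R]_n * R => (\1_I0 z.2 * u ((z.1 : 'rV[R]_n) + z.2 *: v))%:E).
Proof.
move=> iu; have mu : measurable_fun setT (u : borel 'rV[R]_n -> R).
  by apply/measurable_EFinP; exact: measurable_int iu.
apply/integrable21ltyP; first by apply/measurable_EFinP; exact: measurable_line_fun.
have /integrableP[_ iu'] := iu.
have e s : (\int[m]_x `|(\1_I0 s * u ((x : 'rV[R]_n) + s *: v))%R%:E| =
   (\int[m]_x `|(u x)%:E|) * (\1_I0 s)%:E)%E.
  rewrite -(@ge0_integral_shift R n (s *: v) (fun x => `|(u x)%:E|%E))//; last first.
    by apply: measurableT_comp => //; exact/measurable_EFinP.
  rewrite -ge0_integralZr//.
  - by apply: eq_integral => x _; rewrite /= normrM muleC ger0_norm.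
  - apply: measurableT_comp => //; apply/measurable_EFinP.
    exact: (measurableT_comp mu (measurable_shift _)).
under eq_integral do rewrite /= e.
rewrite ge0_integralZl//; last 2 first.
- by apply/measurable_EFinP.
- exact: integral_ge0.
rewrite LI0.
by rewrite muleC lte_mul_pinfty// lee_fin ltW.
Qed.

(** The product is dominated by u(x + s v)^2 + xi(x)^2, to which translation
    invariance applies. *)
Lemma integrable_line_mul (u xi : 'rV[R]_n -> R) :
  sqint m (u : borel 'rV[R]_n -> R) -> sqint m (xi : borel 'rV[R]_n -> R) ->
  (m \x L)%E.-integrable setT
    (fun z : borel 'rV[R]_n * R => (\1_I0 z.2 * u ((z.1 : 'rV[R]_n) + z.2 *: v) * xi z.1)%:E).
Proof.
move=> su sxi; have [mu iu] := su; have [mxi ixi] := sxi.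
have i1 := @integrable_line (fun x => u x ^+ 2) (sqint_integrable su).
have i2 : (m \x L)%E.-integrable setT
    (fun z : borel 'rV[R]_n * R => (\1_I0 z.2 * xi z.1 ^+ 2)%:E).
  apply/integrable21ltyP.
    apply/measurable_EFinP; apply: measurable_funM.
      exact: (measurableT_comp mI0 measurable_snd).
    by apply: measurable_funX; apply: (measurableT_comp mxi); exact: measurable_fst.
  have e s : (\int[m]_x `|(\1_I0 s * xi x ^+ 2)%R%:E| = (\int[m]_x (xi x ^+ 2)%:E) * (\1_I0 s)%:E)%E.
    rewrite -ge0_integralZr//.
    - by apply: eq_integral => x _; rewrite /= normrM muleC !ger0_norm// sqr_ge0.
    - by apply/measurable_EFinP; exact: measurable_funX.
    - by move=> x _; rewrite lee_fin sqr_ge0.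
  under eq_integral do rewrite /= e.
  rewrite ge0_integralZl//; last 2 first.
  - by apply/measurable_EFinP.
  - by apply: integral_ge0 => x _; rewrite lee_fin sqr_ge0.
  rewrite LI0.
  by rewrite muleC lte_mul_pinfty// lee_fin ltW.
apply: le_integrable (integrableD measurableT i1 i2) => //.
  apply/measurable_EFinP; apply: measurable_funM; first exact: measurable_line_fun.
  by apply: (measurableT_comp mxi); exact: measurable_fst.
move=> [x s] _; rewrite /= lee_fin -mulrDr -mulrA !normrM ler_wpM2l//.
set a := u _; set b := xi x.
rewrite -normrM [leRHS]ger0_norm ?addr_ge0 ?sqr_ge0// ler_norml.
have := sqr_ge0 (a - b); have := sqr_ge0 (a + b) => h1 h2.
by have := sqr_ge0 a; have := sqr_ge0 b => h3 h4; apply/andP; split; nra.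
Qed.

(** The integral of u over the segment from x to x + h v. The indicator keeps
    the integrand on the full product space, where Fubini is stated. *)
Definition line_int (u : 'rV[R]_n -> R) (x : 'rV[R]_n) : R :=
  \int[L]_s (\1_I0 s * u (x + s *: v)).

Lemma measurable_line_int (u : 'rV[R]_n -> R) : measurable_fun setT (u : borel 'rV[R]_n -> R) ->
  measurable_fun setT (line_int u : borel 'rV[R]_n -> R).
Proof.
move=> mu; rewrite /line_int /Rintegral.
apply: measurableT_comp => //.
have mF : measurable_fun setT (fun z : borel 'rV[R]_n * R => (\1_I0 z.2 * u ((z.1 : 'rV[R]_n) + z.2 *: v))%:E).
  by apply/measurable_EFinP; exact: measurable_line_fun.
exact: (measurable_integral2 L mF).
Qed.

(** [line_int] takes a junk value where the line integral is infinite; this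
    happens for almost no x. *)
Lemma line_int_mul_aux (u xi : 'rV[R]_n -> R) :
  m.-integrable setT (EFin \o u : borel 'rV[R]_n -> \bar R) ->
  {ae m, forall x : borel 'rV[R]_n, (\int[L]_s (\1_I0 s * u ((x : 'rV[R]_n) + s *: v) * xi x)%R%:E)%E =
     (line_int u x * xi x)%:E}.
Proof.
move=> iu; have aeh := ae_integrable1 (integrable_line iu).
apply: ae_imp aeh => x /= ix.
rewrite EFinM /line_int /Rintegral fineK; last exact: (integrable_fin_num measurableT ix).
by rewrite -integralZr.
Qed.

Lemma integrable_line_int (u : 'rV[R]_n -> R) :
  m.-integrable setT (EFin \o u : borel 'rV[R]_n -> \bar R) ->
  m.-integrable setT (EFin \o line_int u : borel 'rV[R]_n -> \bar R).
Proof.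
move=> iu; have mu : measurable_fun setT (u : borel 'rV[R]_n -> R).
  by apply/measurable_EFinP; exact: measurable_int iu.
have := integrable_fubini_F (integrable_line iu).
apply: le_integrable => //; first by apply/measurable_EFinP; exact: measurable_line_int.
move=> x _; rewrite /= /line_int /Rintegral /fubini_F /=.
by case: (\int[_]_y _)%E => [r| |] //=; rewrite ?normr0 ?leey.
Qed.

(** Exchanging the integrations expresses line integrals, seen through xi, by
    the pairings of xi with the shifts of u. *)
Lemma line_int_mul (u xi : 'rV[R]_n -> R) :
  m.-integrable setT (EFin \o u : borel 'rV[R]_n -> \bar R) ->
  sqint m (u : borel 'rV[R]_n -> R) -> sqint m (xi : borel 'rV[R]_n -> R) ->
  \int[m]_x (line_int u x * xi x) =
  \int[L]_s (\1_I0 s * \int[m]_x (u ((x : 'rV[R]_n) + s *: v)%R * xi x)).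
Proof.
move=> iu su sxi; have [mu _] := su; have [mxi _] := sxi.
have i1 := integrable_line_mul su sxi.
rewrite /Rintegral; congr fine.
transitivity (\int[m]_x \int[L]_s (\1_I0 s * u ((x : 'rV[R]_n) + s *: v) * xi x)%R%:E)%E.
  apply/esym/ae_eq_integral => //.
  - exact: (measurable_int _ (integrable_fubini_F i1)).
  - apply/measurable_EFinP; apply: measurable_funM => //; exact: measurable_line_int.
  - by apply: ae_imp (line_int_mul_aux xi iu).
rewrite (Fubini i1); apply: eq_integral => s _ /=.
have ss : sqint m (fun x : borel 'rV[R]_n => u ((x : 'rV[R]_n) + s *: v)).
  split; first exact: (measurableT_comp mu (measurable_shift _)).
  rewrite (@ge0_integral_shift R n (s *: v) (fun x => (u x ^+ 2)%:E))//; first by have [] := su.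
    by apply/measurable_EFinP; exact: measurable_funX.
  by move=> x; rewrite lee_fin sqr_ge0.
have is' := sqint_mul ss sxi.
rewrite EFinM fineK; last exact: (integrable_fin_num measurableT is').
rewrite -integralZl//; apply: eq_integral => x _.
by rewrite -EFinM mulrA.
Qed.

Lemma Rintegral_indic_approx (J : R -> R) (c B : R) :
  (forall s, 0 <= s <= h -> `|J s - c| <= B) -> measurable_fun setT (fun s : R => \1_I0 s * J s) ->
  `|\int[L]_s (\1_I0 s * J s) - h * c| <= h * B.
Proof.
move=> JB mJ.
have ic (b : R) : L.-integrable setT (fun s => (b * \1_I0 s)%:E) by exact: (integrableZl measurableT b iI0).
have Ic (b : R) : \int[L]_s (b * \1_I0 s) = h * b.
  rewrite /Rintegral; under eq_integral do rewrite EFinM.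
  by rewrite integralZl// LI0 -EFinM /= mulrC.
have le s : `|\1_I0 s * J s - c * \1_I0 s| <= B * \1_I0 s.
  rewrite indicE; case: (boolP (s \in I0)) => [/set_mem|_]; last by rewrite !mulr0 mul0r subr0 normr0.
  by rewrite /I0 /= in_itv/= => sI; rewrite !mulr1 mul1r JB.
have iK : L.-integrable setT (fun s => (\1_I0 s * J s - c * \1_I0 s)%:E).
  apply: le_integrable (ic B) => //.
    by apply/measurable_EFinP; apply: measurable_funB => //; exact: measurable_funM.
  by move=> s _; rewrite /= lee_fin (le_trans (le s))// ler_norm.
have iJ : L.-integrable setT (fun s => (\1_I0 s * J s)%:E).
  have := integrableD measurableT iK (ic c); apply: eq_integrable => // s _.
  by rewrite -EFinD subrK.
rewrite -(Ic c) -(RintegralB measurableT iJ (ic c)).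
apply: (le_trans (le_normr_Rintegral measurableT iK)).
rewrite -(Ic B); apply: le_Rintegral => //.
- exact: integrable_norm.
- exact: ic.
Qed.

Lemma Rintegral_indic_bound (J : R -> R) (B : R) :
  (forall s, 0 <= s <= h -> `|J s| <= B) -> measurable_fun setT (fun s : R => \1_I0 s * J s) ->
  `|\int[L]_s (\1_I0 s * J s)| <= h * B.
Proof.
move=> JB mJ; rewrite -[X in `|X|]subr0 -(mulr0 h); apply: Rintegral_indic_approx => // s hs.
by rewrite subr0; exact: JB.
Qed.

End line_average.

(** * The chain rule for weak partial derivatives *)

Lemma RintegralN d (T : measurableType d) (R : realType) (mu : {measure set T -> \bar R})
    (D : set T) (g : T -> R) : \int[mu]_(x in D) (- g x) = - \int[mu]_(x in D) g x.
Proof.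
rewrite /Rintegral integralE [in RHS]integralE.
have -> : (fun x => (- g x)%:E)^\+%E = (EFin \o g)^\-%E.
  by apply/funext => x; rewrite funeposE funenegE.
have -> : (fun x => (- g x)%:E)^\-%E = (EFin \o g)^\+%E.
  by apply/funext => x; rewrite funeposE funenegE /= opprK.
have := @integral_ge0 _ _ _ mu D _ (fun x _ => funepos_ge0 (EFin \o g) x).
have := @integral_ge0 _ _ _ mu D _ (fun x _ => funeneg_ge0 (EFin \o g) x).
case: (\int[mu]_(x in D) _ x)%E => [a| |] //; case: (\int[mu]_(x in D) _ x)%E => [b| |] //= _ _;
  rewrite ?oppr0 ?opprB//.
Qed.

Section shifts.
Context (R : realType) (n : nat).
Let m := lebesgue_rV R n.

Lemma sqint_shift (u : 'rV[R]_n -> R) (z : 'rV[R]_n) :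
  sqint m (u : borel 'rV[R]_n -> R) -> sqint m (fun x : borel 'rV[R]_n => u ((x : 'rV[R]_n) + z)).
Proof.
move=> [mu iu]; split; first exact: (measurableT_comp mu (measurable_shift _)).
rewrite (@ge0_integral_shift R n z (fun x => (u x ^+ 2)%:E))//.
  by apply/measurable_EFinP; exact: measurable_funX.
by move=> x; rewrite lee_fin sqr_ge0.
Qed.

Lemma sqr_norm_shift (u : 'rV[R]_n -> R) (z : 'rV[R]_n) : measurable_fun setT (u : borel 'rV[R]_n -> R) ->
  \int[m]_x (u ((x : 'rV[R]_n) + z) ^+ 2) = \int[m]_x (u x ^+ 2).
Proof.
move=> mu; apply: (@Rintegral_shift R n z (fun x => u x ^+ 2)).
exact: measurable_funX.
Qed.

Lemma sqint_bounded_support (K : set 'rV[R]_n) (u : 'rV[R]_n -> R) (c : R) : compact K ->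
  measurable_fun setT (u : borel 'rV[R]_n -> R) -> (forall x, `|u x| <= c) -> vanish_off K u ->
  sqint m (u : borel 'rV[R]_n -> R).
Proof.
move=> cK mu uc uK.
have c0 : 0 <= c by exact: le_trans (normr_ge0 _) (uc 0).
have s1 := sqint_indic (compact_borel cK) (compact_lebesgue_fin cK).
apply: le_sqint (sqintZ c s1) => // x; rewrite indicE.
case: (boolP (x \in K)) => [_|/negP nK]; first by rewrite mulr1 (le_trans (uc x))// ler_norm.
by rewrite uK ?normr0// => Kx; apply: nK; exact: mem_set.
Qed.

Lemma integrable_bounded_support (K : set 'rV[R]_n) (u : 'rV[R]_n -> R) (c : R) : compact K ->
  measurable_fun setT (u : borel 'rV[R]_n -> R) -> (forall x, `|u x| <= c) -> vanish_off K u ->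
  m.-integrable setT (EFin \o u : borel 'rV[R]_n -> \bar R).
Proof.
move=> cK mu uc uK.
have i1 := integrable_indic_fin (compact_borel cK) (compact_lebesgue_fin cK).
apply: le_integrable (integrableZl measurableT c i1) => //; first exact/measurable_EFinP.
move=> x _; rewrite /= lee_fin (le_trans _ (ler_norm _))// indicE.
case: (boolP (x \in K)) => [_|/negP nK]; first by rewrite mulr1.
by rewrite uK ?normr0 ?mulr0// => Kx; apply: nK; exact: mem_set.
Qed.

Lemma sqint_smooth (K : set 'rV[R]_n) (u : 'rV[R]_n -> R) : compact K -> smooth u ->
  vanish_off K u -> sqint m (u : borel 'rV[R]_n -> R).
Proof.
move=> cK su uK; have [c c0 uc] := vanish_off_bounded cK (smooth_continuous su) uK.
by apply: (sqint_bounded_support cK) uK => //; exact: smooth_measurable.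
Qed.

End shifts.

(** Here f and w are cut-offs to a compact set of a function and its weak
    derivative in the direction e. The hypothesis fw is the definition of a
    weak derivative for test functions shifted by at most del: those starting
    in U do not leave the region where the cut-off is invisible. *)
Section translation.
Context (R : realType) (n : nat) (i : 'I_n).
Let m := lebesgue_rV R n.
Let L : {sigma_finite_measure set (measurableTypeR R) -> \bar R} := @lebesgue_measure R.
Let e : 'rV[R]_n := delta_mx 0 i.
Context (f w : 'rV[R]_n -> R) (U : set 'rV[R]_n) (del : R).
Hypothesis sf : sqint m (f : borel 'rV[R]_n -> R).
Hypothesis sw : sqint m (w : borel 'rV[R]_n -> R).
Hypothesis iw : m.-integrable setT (EFin \o w : borel 'rV[R]_n -> \bar R).
Hypothesis oU : open U.
Hypothesis fw : forall theta (s : R), test_function U theta -> 0 <= s <= del ->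
  \int[m]_x (f x * 'D_e theta ((x : 'rV[R]_n) - s *: e)) =
  - \int[m]_x (w x * theta ((x : 'rV[R]_n) - s *: e)).

Let mf : measurable_fun setT (f : borel 'rV[R]_n -> R). Proof. by case: sf. Qed.
Let mw : measurable_fun setT (w : borel 'rV[R]_n -> R). Proof. by case: sw. Qed.

Lemma Rintegral_shiftN (u v : 'rV[R]_n -> R) (z : 'rV[R]_n) :
  measurable_fun setT (u : borel 'rV[R]_n -> R) -> measurable_fun setT (v : borel 'rV[R]_n -> R) ->
  \int[m]_x (u ((x : 'rV[R]_n) + z) * v x) = \int[m]_x (u x * v ((x : 'rV[R]_n) - z)).
Proof.
move=> mu mv; rewrite -(@Rintegral_shift R n z (fun x => u x * v (x - z))).
  by apply: eq_Rintegral => x _; rewrite addrK.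
apply: measurable_funM => //.
exact: (measurableT_comp mv (measurable_shift _)).
Qed.

(** Duality: the shift goes onto theta, theta(x - h e) - theta(x) is the
    integral of a derivative of theta, and fw trades that derivative for w. *)
Lemma translation_test (h : R) theta : 0 < h <= del -> test_function U theta ->
  \int[m]_x ((f ((x : 'rV[R]_n) + h *: e) - f x) * theta x) =
  \int[m]_x (line_int h e w x * theta x).
Proof.
move=> /andP[h0 hdel] tt; have [K [cK KU] hK] := test_function_support tt.
have [st _ _] := tt.
have mt := smooth_measurable st.
have sth : sqint m (theta : borel 'rV[R]_n -> R) by exact: sqint_smooth cK st hK.
have sD : smooth ('D_e theta) by exact: smooth_partial.
have vD : vanish_off K ('D_e theta) by exact: vanish_off_partial.
have sDq : sqint m ('D_e theta : borel 'rV[R]_n -> R) by exact: sqint_smooth cK sD vD.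
have mD := smooth_measurable sD.
have idx (g : 'rV[R]_n -> R) (s : R) : measurable_fun setT (g : borel 'rV[R]_n -> R) ->
    measurable_fun setT (fun x : borel 'rV[R]_n => g ((x : 'rV[R]_n) - s *: e)).
  by move=> mg; exact: (measurableT_comp mg (measurable_shift _)).
rewrite line_int_mul//.
transitivity (\int[L]_s (\1_(`[0, h]%classic : set R) s * - \int[m]_x (f x * 'D_e theta ((x : 'rV[R]_n) - s *: e)))); last first.
  apply: eq_Rintegral => s _; rewrite indicE; case: (boolP (s \in _)) => [/set_mem|_]; last by rewrite !mul0r.
  rewrite /= in_itv/= => /andP[s0 sh]; rewrite !mul1r fw//; last by rewrite s0 (le_trans sh).
  by rewrite opprK Rintegral_shiftN.
have e1 (s : R) : \int[m]_x (f x * 'D_e theta ((x : 'rV[R]_n) - s *: e)) =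
   \int[m]_x ('D_e theta ((x : 'rV[R]_n) + s *: - e) * f x).
  by apply: eq_Rintegral => x _; rewrite mulrC scalerN.
have iD : m.-integrable setT (EFin \o 'D_e theta : borel 'rV[R]_n -> \bar R).
  have [M M0 hM] := vanish_off_bounded cK (smooth_continuous sD) vD.
  exact: integrable_bounded_support cK mD hM vD.
transitivity (- \int[m]_x (line_int h (- e) ('D_e theta) x * f x)); last first.
  rewrite line_int_mul// -RintegralN.
  by apply: eq_Rintegral => s _; rewrite e1 mulrN.
have e2 x : line_int h (- e) ('D_e theta) x = theta x - theta (x - h *: e).
  rewrite /line_int /Rintegral.
  have h1 := integral_line_partial i x st h0; rewrite -/e integral_mkcond in h1.
  rewrite -[RHS]/(fine (theta x - theta (x - h *: e))%:E) -h1; congr fine.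
  apply: eq_integral => s _; rewrite patchE indicE.
  by case: ifPn => _; rewrite ?mul1r ?mul0r// scalerN.
transitivity (\int[m]_x (f ((x : 'rV[R]_n) + h *: e) * theta x - f x * theta x)).
  by apply: eq_Rintegral => x _; rewrite mulrBl.
transitivity (- \int[m]_x (f x * theta x - f x * theta ((x : 'rV[R]_n) - h *: e))); last first.
  by congr (- _); apply: eq_Rintegral => x _; rewrite -mulrBr e2 mulrC.
rewrite !RintegralB//.
- by rewrite Rintegral_shiftN// opprB.
- exact: sqint_mul.
- apply: sqint_mul => //; exact: (sqint_shift (- (h *: e)) sth).
- by apply: sqint_mul => //; exact: (sqint_shift (h *: e) sf).
- exact: sqint_mul.
Qed.

(** The fundamental theorem of calculus for weak derivatives. *)
Lemma translation_ae (h : R) : 0 < h <= del ->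
  {ae m, forall x, U x -> f ((x : 'rV[R]_n) + h *: e) - f x = line_int h e w x}.
Proof.
move=> hh; have /andP[h0 _] := hh.
pose g (x : 'rV[R]_n) := f (x + h *: e) - f x - line_int h e w x.
have ig K : compact K -> m.-integrable (K : set (borel 'rV[R]_n)) (EFin \o g).
  move=> cK; have s1 := sqint_indic (compact_borel cK) (compact_lebesgue_fin cK).
  have mK := compact_borel cK.
  have i1 : m.-integrable (K : set (borel 'rV[R]_n)) (fun x => (f ((x : 'rV[R]_n) + h *: e) - f x)%:E).
    have sd : sqint m (fun x : borel 'rV[R]_n => f ((x : 'rV[R]_n) + h *: e) - f x).
      by apply: sqintB => //; exact: (sqint_shift (h *: e) sf).
    have := integrableS measurableT mK (@subsetT _ _) (sqint_mul sd s1).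
    apply: eq_integrable => // x xK.
    by rewrite indicE xK mulr1.
  have i2 : m.-integrable (K : set (borel 'rV[R]_n)) (EFin \o line_int h e w).
    by apply: (integrableS measurableT) => //; exact: integrable_line_int.
  exact: (integrableB mK i1 i2).
have mg : measurable_fun setT (g : borel 'rV[R]_n -> R).
  apply: measurable_funB; last exact: measurable_line_int.
  apply: measurable_funB => //; exact: (measurableT_comp mf (measurable_shift _)).
have lg : locally_integrable U g.
  by split; [exact: measurable_funTS|move=> K cK _; exact: ig].
have := @fundamental_lemma R n U g oU lg; rewrite -/m => FL.
apply: ae_imp (FL _) => [x /= hx /hx /eqP|theta tt].
  by rewrite subr_eq0 => /eqP.
have [K [cK KU] hK] := test_function_support tt.
have [st _ _] := tt.
have sth : sqint m (theta : borel 'rV[R]_n -> R) by exact: sqint_smooth cK st hK.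
have [M M0 hM] := vanish_off_bounded cK (smooth_continuous st) hK.
rewrite (@Rintegral_mul_support _ (borel 'rV[R]_n) _ _ U U)//; last first.
  by move=> x nU; apply: hK => /KU.
transitivity (\int[m]_x ((f ((x : 'rV[R]_n) + h *: e) - f x) * theta x - line_int h e w x * theta x)).
  apply: eq_Rintegral => x _; rewrite patchE; case: ifPn => [_|/negP nU]; first by rewrite /g mulrBl.
  by rewrite hK ?mulr0 ?subr0// => /KU Ux; apply: nU; exact: mem_set.
rewrite RintegralB//.
- by rewrite translation_test// subrr.
- apply: sqint_mul => //; apply: sqintB => //; exact: (sqint_shift (h *: e) sf).
- apply: (@integrable_mul_bounded _ _ _ _ _ _ _ M) => //; first exact: integrable_line_int.
  exact: smooth_measurable.
Qed.

(** Made for xi = G(f) eta, of which only square integrability is known. *)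
Lemma translation_mul (h : R) (xi : 'rV[R]_n -> R) : 0 < h <= del ->
  sqint m (xi : borel 'rV[R]_n -> R) -> vanish_off U xi ->
  \int[m]_x ((f ((x : 'rV[R]_n) + h *: e) - f x) * xi x) =
  \int[L]_s (\1_(`[0, h]%classic : set R) s * \int[m]_x (w ((x : 'rV[R]_n) + s *: e) * xi x)).
Proof.
move=> hh sxi xiU; have /andP[h0 _] := hh.
rewrite -line_int_mul// /Rintegral; congr fine; apply: ae_eq_integral => //.
- apply/measurable_EFinP; apply: measurable_funM; last by case: sxi.
  apply: measurable_funB => //; exact: (measurableT_comp mf (measurable_shift _)).
- apply/measurable_EFinP; apply: measurable_funM; last by case: sxi.
  exact: measurable_line_int.
- apply: ae_imp (translation_ae hh) => x hx _; congr EFin.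
  have [Ux|nU] := pselect (U x); first by rewrite hx.
  by rewrite xiU// !mulr0.
Qed.

Lemma measurable_line_integral (u xi : 'rV[R]_n -> R) h (v : 'rV[R]_n) :
  sqint m (u : borel 'rV[R]_n -> R) -> sqint m (xi : borel 'rV[R]_n -> R) ->
  measurable_fun setT (fun s : R =>
    \1_(`[0, h]%classic : set R) s * \int[m]_x (u ((x : 'rV[R]_n) + s *: v) * xi x)).
Proof.
move=> [mu _] [mxi _]; apply: measurable_funM.
  by apply: measurable_indic; exact: measurable_itv.
apply: measurableT_comp => //.
have mF : measurable_fun setT (fun z : borel 'rV[R]_n * R => (u ((z.1 : 'rV[R]_n) + z.2 *: v) * xi z.1)%:E).
  apply/measurable_EFinP; apply: measurable_funM.
    exact: (measurableT_comp mu (measurable_line v)).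
  exact: (measurableT_comp mxi measurable_fst).
exact: (measurable_integral1 m mF).
Qed.

(** Increments of f are of first order in L^2: pair the increment with itself
    and bound the integral over s by Cauchy-Schwarz. *)
Lemma translation_sqr (h : R) (K : set 'rV[R]_n) : 0 < h <= del ->
  measurable (K : set (borel 'rV[R]_n)) -> K `<=` U ->
  \int[m]_x (((f ((x : 'rV[R]_n) + h *: e) - f x) * \1_K (x : 'rV[R]_n)) ^+ 2) <= h ^+ 2 * \int[m]_x (w x ^+ 2).
Proof.
move=> hh mK KU; have /andP[h0 _] := hh.
have mDl : sqint m (fun x : borel 'rV[R]_n => f ((x : 'rV[R]_n) + h *: e) - f x).
  by apply: sqintB => //; exact: (sqint_shift (h *: e) sf).
pose xi (x : 'rV[R]_n) := (f ((x : 'rV[R]_n) + h *: e) - f x) * \1_K (x : 'rV[R]_n).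
have sxi : sqint m (xi : borel 'rV[R]_n -> R).
  apply: le_sqint mDl.
    apply: measurable_funM; last exact: measurable_indic.
    apply: measurable_funB => //; exact: (measurableT_comp mf (measurable_shift _)).
  by move=> x; rewrite /xi normrM indicE; case: (x \in K); rewrite ?normr1 ?normr0 ?mulr1 ?mulr0.
have xiU : vanish_off U xi.
  by move=> x nU; rewrite /xi indicE memNset ?mulr0// => /KU.
have := translation_mul hh sxi xiU.
set A := \int[m]_x (_ ^+ 2); set B := \int[m]_x (_ ^+ 2).
have A0 : 0 <= A by exact: Rintegral_sqr_ge0.
have B0 : 0 <= B by exact: Rintegral_sqr_ge0.
have -> : \int[m]_x ((f ((x : 'rV[R]_n) + h *: e) - f x) * xi x) = A.
  apply: eq_Rintegral => x _; rewrite /xi indicE.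
  by case: (x \in K); rewrite /= ?mulr1 ?mulr0 ?expr2 ?mul0r.
move=> eA.
have : A <= h * (Num.sqrt B * Num.sqrt A).
  rewrite [leLHS]eA (le_trans (ler_norm _))// Rintegral_indic_bound//; last first.
    exact: measurable_line_integral.
  move=> s _; have ss := sqint_shift (s *: e) sw.
  apply: (le_trans (cauchy_schwarz ss sxi)).
  by rewrite sqr_norm_shift.
rewrite mulrA => /le_sqr_of_sqrt h'; rewrite -(sqr_sqrtr B0) -exprMn; apply: h' => //.
by rewrite mulr_ge0 ?sqrtr_ge0// ltW.
Qed.

(** F is the function of the chain rule and G its derivative. Up to O(h^2), the
    integral of h F(f) D eta is that of F(f) (eta - eta(. - h e)), hence the
    opposite of that of (F(f(. + h e)) - F(f)) eta. There the increment of F(f)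
    may be replaced by G(f) times that of f, and after pairing the latter by h
    w. [chain_error1], [chain_error2] and [chain_error3] bound the three
    errors. *)
Context (F G : R -> R) (Lip : R) (K : set 'rV[R]_n) (eta : 'rV[R]_n -> R).
Hypothesis Lip0 : 0 <= Lip.
Hypothesis mFun : measurable_fun setT F.
Hypothesis mGun : measurable_fun setT G.
Hypothesis F0 : forall a, `|F a| <= `|a|.
Hypothesis G1 : forall a, `|G a| <= 1.
Hypothesis GLip : forall a b, `|G a - G b| <= Lip * `|a - b|.
Hypothesis FG : forall a b, `|F b - F a - G a * (b - a)| <= Lip * (b - a) ^+ 2.
Hypothesis cK : compact K.
Hypothesis KU : K `<=` U.
Hypothesis seta : smooth eta.
Hypothesis etaK : vanish_off K eta.
Hypothesis del0 : 0 < del.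

Let mK : measurable (K : set (borel 'rV[R]_n)). Proof. exact: compact_borel. Qed.
Let meta := smooth_measurable seta.
Let setaq : sqint m (eta : borel 'rV[R]_n -> R). Proof. exact: sqint_smooth cK seta etaK. Qed.
Let sD : smooth ('D_e eta). Proof. exact: smooth_partial. Qed.
Let vD : vanish_off K ('D_e eta). Proof. exact: vanish_off_partial. Qed.
Let sDq : sqint m ('D_e eta : borel 'rV[R]_n -> R). Proof. exact: sqint_smooth cK sD vD. Qed.

Let sFf : sqint m (fun x : borel 'rV[R]_n => F (f x)).
Proof.
by apply: le_sqint sf => //; exact: (measurableT_comp mFun mf).
Qed.

Let mGf : measurable_fun setT (fun x : borel 'rV[R]_n => G (f x)).
Proof. exact: (measurableT_comp mGun mf). Qed.

Let xi (x : 'rV[R]_n) := G (f x) * eta x.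

Let sxi : sqint m (xi : borel 'rV[R]_n -> R).
Proof. exact: (sqint_mul_bounded setaq mGf (fun x => G1 (f x))). Qed.

Let xiU : vanish_off U xi.
Proof. by move=> x nU; rewrite /xi etaK ?mulr0// => /KU. Qed.

(* contains the supports of all shifts of eta by at most del *)
Let Ksweep : set 'rV[R]_n := (fun q : 'rV[R]_n * R => q.1 + q.2 *: e) @` (K `*` `[0, del]%classic).

Let cKsweep : compact Ksweep.
Proof.
apply: continuous_compact; last by apply: compact_setX => //; exact: segment_compact.
apply: continuous_subspaceT => q.
apply: (@continuousD _ _ _ (fun q : 'rV[R]_n * R => q.1) (fun q : 'rV[R]_n * R => q.2 *: e)).
  exact: cvg_fst.
apply: (@continuous_comp _ _ _ (fun q : 'rV[R]_n * R => q.2) (fun t : R => t *: e)).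
  exact: cvg_snd.
exact: scalel_continuous.
Qed.

Let line_Lip (phi : 'rV[R]_n -> R) (M : R) : smooth phi -> (forall x, `|'D_e phi x| <= M) ->
  forall x (s : R), 0 <= s -> `|phi x - phi (x - s *: e)| <= s * M.
Proof.
move=> sphi hM x s; rewrite le_eqVlt => /orP[/eqP <-|s0]; first by rewrite scale0r subr0 subrr normr0 mul0r.
have [c _ ->] := line_MVT i x sphi s0.
by rewrite normrM gtr0_norm// ler_pM2l.
Qed.

(** First-order Taylor expansion of eta. *)
Lemma chain_error1 : exists C : R, forall h, 0 < h <= del ->
  `|h * \int[m]_x (F (f x) * 'D_e eta x) -
    (\int[m]_x (F (f x) * eta x) - \int[m]_x (F (f x) * eta ((x : 'rV[R]_n) - h *: e)))| <= C * h ^+ 2.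
Proof.
have sDD : smooth ('D_e ('D_e eta)) by exact: smooth_partial.
have [M M0 hM] := vanish_off_bounded cK (smooth_continuous sDD) (vanish_off_partial i cK vD).
have s1 := sqint_indic (compact_borel cKsweep) (compact_lebesgue_fin cKsweep).
exists (Num.sqrt (\int[m]_x (F (f x) ^+ 2)) * (M * Num.sqrt (\int[m]_x (\1_Ksweep (x : 'rV[R]_n) ^+ 2)))).
move=> h hh; have /andP[h0 hd] := hh.
have setah : sqint m (fun x : borel 'rV[R]_n => eta ((x : 'rV[R]_n) - h *: e)) by exact: (sqint_shift (- (h *: e)) setaq).
pose E (x : 'rV[R]_n) := h * 'D_e eta x - (eta x - eta (x - h *: e)).
have sE : sqint m (E : borel 'rV[R]_n -> R) by apply: sqintB; [exact: sqintZ|exact: sqintB].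
have -> : h * \int[m]_x (F (f x) * 'D_e eta x) -
    (\int[m]_x (F (f x) * eta x) - \int[m]_x (F (f x) * eta ((x : 'rV[R]_n) - h *: e))) =
    \int[m]_x (F (f x) * E x).
  have i1 := sqint_mul sFf sDq; have i2 := sqint_mul sFf setaq; have i3 := sqint_mul sFf setah.
  have i4 := integrableZl measurableT h i1; have i5 := integrableB measurableT i2 i3.
  rewrite -RintegralZl// -(RintegralB measurableT i2 i3) -(RintegralB measurableT i4 i5).
  by apply: eq_Rintegral => x _; rewrite /E; ring.
apply: (le_trans (cauchy_schwarz sFf sE)); rewrite -mulrA ler_wpM2l ?sqrtr_ge0//.
have Eb x : `|E x| <= M * h ^+ 2 * \1_Ksweep x.
  rewrite indicE; case: (boolP (x \in _)) => [_|/negP nK]; last first.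
    have nKx : ~ K x.
      move=> Kx; apply: nK; apply: mem_set; exists (x, 0); last by rewrite /= scale0r addr0.
      by split=> //=; rewrite in_itv/= lexx ltW.
    have nKh : ~ K (x - h *: e).
      move=> Kx; apply: nK; apply: mem_set; exists (x - h *: e, h); last by rewrite /= subrK.
      by split=> //=; rewrite in_itv/= hd ltW.
    by rewrite /E vD// etaK// etaK// mulr0 !subr0 normr0 mulr0.
  have [c /andP[c0 ch] ec] := line_MVT i x seta h0.
  rewrite mulr1 /E ec -mulrBr normrM gtr0_norm// [leRHS](_ : _ = h * (h * M)); last by ring.
  rewrite ler_pM2l//; apply: (le_trans (line_Lip sD hM _ c0)).
  by rewrite ler_pM2r.
have -> : M * Num.sqrt (\int[m]_x (\1_Ksweep (x : 'rV[R]_n) ^+ 2)) * h ^+ 2 =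
  Num.sqrt (\int[m]_x ((M * h ^+ 2 * \1_Ksweep (x : 'rV[R]_n)) ^+ 2)).
  have Mh : 0 <= M * h ^+ 2 by rewrite mulr_ge0 ?sqr_ge0// ltW.
  by rewrite Rintegral_sqrZ// sqrtrM ?sqr_ge0// sqrtr_sqr ger0_norm//; ring.
rewrite ler_wsqrtr//; apply: le_Rintegral => //.
- exact: sqint_integrable.
- exact: (sqint_integrable (sqintZ (M * h ^+ 2) s1)).
- move=> x _; rewrite -(real_normK (num_real (E x))) lerXn2r// ?nnegrE//.
  by rewrite (le_trans _ (Eb x)).
Qed.

(** F is differentiable with quadratic error, and squared increments of f have
    integral of order h^2. *)
Lemma chain_error2 : exists C : R, forall h, 0 < h <= del ->
  `|\int[m]_x (F (f ((x : 'rV[R]_n) + h *: e)) * eta x) - \int[m]_x (F (f x) * eta x) -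
    \int[m]_x ((f ((x : 'rV[R]_n) + h *: e) - f x) * xi x)| <= C * h ^+ 2.
Proof.
have [M M0 hM] := vanish_off_bounded cK (smooth_continuous seta) etaK.
exists (Lip * M * \int[m]_x (w x ^+ 2)) => h hh; have /andP[h0 _] := hh.
pose D (x : borel 'rV[R]_n) := f ((x : 'rV[R]_n) + h *: e) - f x.
have sfh : sqint m (fun x : borel 'rV[R]_n => f ((x : 'rV[R]_n) + h *: e)) by exact: (sqint_shift (h *: e) sf).
have sFh : sqint m (fun x : borel 'rV[R]_n => F (f ((x : 'rV[R]_n) + h *: e))) by exact: (sqint_shift (h *: e) sFf).
have sDl : sqint m D by exact: sqintB.
have i1 := sqint_mul sFh setaq; have i2 := sqint_mul sFf setaq; have i3 := sqint_mul sDl sxi.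
have i12 := integrableB measurableT i1 i2.
rewrite -(RintegralB measurableT i1 i2) -(RintegralB measurableT i12 i3).
have i4 := integrableB measurableT i12 i3.
apply: (le_trans (le_normr_Rintegral measurableT i4)).
have sDK : sqint m (fun x : borel 'rV[R]_n => D x * \1_K (x : 'rV[R]_n)).
  have [mD _] := sDl; apply: le_sqint sDl.
    by apply: measurable_funM => //; exact: measurable_indic.
  by move=> x; rewrite normrM indicE; case: (x \in K); rewrite ?normr1 ?normr0 ?mulr1 ?mulr0.
have iDK := sqint_integrable sDK.
apply: (@le_trans _ _ (\int[m]_x ((Lip * M) * (D x * \1_K (x : 'rV[R]_n)) ^+ 2))).
  apply: le_Rintegral => //.
  - exact: integrable_norm.
  - exact: (integrableZl measurableT (Lip * M) iDK).
  move=> x _; rewrite /xi.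
  have -> : F (f ((x : 'rV[R]_n) + h *: e)) * eta x - F (f x) * eta x - D x * (G (f x) * eta x) =
    (F (f ((x : 'rV[R]_n) + h *: e)) - F (f x) - G (f x) * D x) * eta x by ring.
  have [Kx|nK] := pselect (K x); last first.
    by rewrite etaK// mulr0 normr0 indicE memNset// mulr0 expr0n mulr0.
  rewrite indicE mem_set// mulr1 normrM mulrAC ler_pM//.
  rewrite RintegralZl// -[leRHS]mulrA ler_wpM2l ?mulr_ge0 ?(ltW M0)//.
by rewrite [leRHS]mulrC; exact: translation_sqr.
Qed.

(** By [translation_mul] this is an average over s in [0, h] of the pairings of
    w with the shifts of xi = G(f) eta. A shift by s changes xi by O(s) in the
    pairing: G and eta are Lipschitz and increments of f are O(s) in L^2. *)
Lemma chain_error3 : exists C : R, forall h, 0 < h <= del ->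
  `|\int[m]_x ((f ((x : 'rV[R]_n) + h *: e) - f x) * xi x) - h * \int[m]_x (w x * xi x)| <= C * h ^+ 2.
Proof.
have [M M0 hM] := vanish_off_bounded cK (smooth_continuous seta) etaK.
have [M1 M10 hM1] := vanish_off_bounded cK (smooth_continuous sD) vD.
pose C := Lip * M * \int[m]_x (w x ^+ 2) + M1 * \int[m]_x `|w x|.
have C0 : 0 <= C.
  rewrite addr_ge0// mulr_ge0 ?Rintegral_sqr_ge0 ?mulr_ge0 ?(ltW M0) ?(ltW M10)//.
  exact: Rintegral_ge0.
exists C => h hh; have /andP[h0 hd] := hh.
rewrite (translation_mul hh sxi xiU) [leRHS](_ : _ = h * (C * h)); last by ring.
apply: Rintegral_indic_approx => //; last exact: measurable_line_integral.
move=> s /andP[s0 sh].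
apply: (@le_trans _ _ (C * s)); last by rewrite ler_wpM2l.
move: s0; rewrite le_eqVlt => /orP[/eqP <-|s0].
  rewrite mulr0 (_ : \int[m]_x (w ((x : 'rV[R]_n) + 0 *: e) * xi x) = \int[m]_x (w x * xi x)) ?subrr ?normr0//.
  by apply: eq_Rintegral => x _; rewrite scale0r addr0.
have sd : 0 < s <= del by rewrite s0 (le_trans sh).
rewrite Rintegral_shiftN//; last by case: sxi.
have setas : sqint m (fun x : borel 'rV[R]_n => eta ((x : 'rV[R]_n) - s *: e)) by exact: (sqint_shift (- (s *: e)) setaq).
have sxis : sqint m (fun x : borel 'rV[R]_n => xi ((x : 'rV[R]_n) - s *: e)) by exact: (sqint_shift (- (s *: e)) sxi).
(* the increment of xi is A + B, where B is the part due to eta and A the part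
   due to G(f) *)
pose B (x : 'rV[R]_n) := G (f x) * (eta (x - s *: e) - eta x).
have sB : sqint m (B : borel 'rV[R]_n -> R).
  exact: (sqint_mul_bounded (sqintB setas setaq) mGf (fun x => G1 (f x))).
pose A (x : 'rV[R]_n) := xi (x - s *: e) - xi x - B x.
have sA : sqint m (A : borel 'rV[R]_n -> R) by apply: sqintB => //; exact: sqintB.
have i1 := sqint_mul sw sxis; have i2 := sqint_mul sw sxi.
have i3 := sqint_mul sw sA; have i4 := sqint_mul sw sB.
rewrite -(RintegralB measurableT i1 i2).
rewrite (_ : \int[m]_x _ = \int[m]_x (w x * A x) + \int[m]_x (w x * B x)); last first.
  by rewrite -(RintegralD measurableT i3 i4); apply: eq_Rintegral => x _; rewrite /A; ring.
apply: (le_trans (ler_normD _ _)); rewrite /C mulrDl; apply: lerD.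
  apply: (le_trans (cauchy_schwarz sw sA)).
  set W := \int[m]_x (w x ^+ 2).
  have W0 : 0 <= W by exact: Rintegral_sqr_ge0.
  have LM : 0 <= Lip * M by rewrite mulr_ge0// ltW.
  pose q (x : 'rV[R]_n) := (f (x + s *: e) - f x) * \1_K x.
  have sq : sqint m (q : borel 'rV[R]_n -> R).
    have sdl : sqint m (fun x : borel 'rV[R]_n => f ((x : 'rV[R]_n) + s *: e) - f x).
      by apply: sqintB => //; exact: (sqint_shift (s *: e) sf).
    apply: le_sqint sdl.
      by apply: measurable_funM; [apply: measurable_funB => //; exact: (measurableT_comp mf (measurable_shift _))|exact: measurable_indic].
    by move=> x; rewrite normrM indicE; case: (x \in K); rewrite ?normr1 ?normr0 ?mulr1 ?mulr0.
  have sqs : sqint m (fun x : borel 'rV[R]_n => q ((x : 'rV[R]_n) - s *: e)) by exact: (sqint_shift (- (s *: e)) sq).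
  have Ab x : `|A x| <= Lip * M * `|q (x - s *: e)|.
    have -> : A x = (G (f (x - s *: e)) - G (f x)) * eta (x - s *: e) by rewrite /A /B /xi; ring.
    rewrite /q subrK indicE.
    have [Kx|nK] := pselect (K (x - s *: e)); last first.
      by rewrite etaK// memNset// !mulr0 normr0 mulr0.
    rewrite mem_set// mulr1 normrM mulrAC ler_pM//.
    by rewrite (distrC (f x)); exact: GLip.
  have hA : \int[m]_x (A x ^+ 2) <= (Lip * M * s) ^+ 2 * W.
    apply: (@le_trans _ _ (\int[m]_x ((Lip * M * q ((x : 'rV[R]_n) - s *: e)) ^+ 2))).
      apply: le_Rintegral => //.
      - exact: sqint_integrable.
      - exact: (sqint_integrable (sqintZ (Lip * M) sqs)).
      - move=> x _; rewrite -(real_normK (num_real (A x))) -(real_normK (num_real (_ * q _))).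
        rewrite lerXn2r// ?nnegrE// normrM (ger0_norm LM); exact: Ab.
    rewrite Rintegral_sqrZ// [leRHS](_ : _ = (Lip * M) ^+ 2 * (s ^+ 2 * W)); last by ring.
    rewrite ler_wpM2l ?sqr_ge0//.
    rewrite (@sqr_norm_shift R n q (- (s *: e))); last by case: sq.
    exact: translation_sqr.
  apply: (@le_trans _ _ (Num.sqrt W * Num.sqrt ((Lip * M * s) ^+ 2 * W))).
    by rewrite ler_wpM2l ?sqrtr_ge0// ler_wsqrtr.
  rewrite sqrtrM ?sqr_ge0// sqrtr_sqr ger0_norm ?mulr_ge0 ?(ltW s0) ?(ltW M0)//.
  by rewrite mulrCA -expr2 sqr_sqrtr// le_eqVlt; apply/orP; left; apply/eqP; ring.
have iaw := integrable_norm iw.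
apply: (le_trans (le_normr_Rintegral measurableT i4)).
rewrite (_ : M1 * \int[m]_x `|w x| * s = \int[m]_x ((M1 * s) * `|w x|)); last first.
  by rewrite RintegralZl//; ring.
apply: le_Rintegral => //.
- exact: integrable_norm.
- exact: (integrableZl measurableT (M1 * s) iaw).
- move=> x _; rewrite normrM mulrC ler_wpM2r// /B normrM.
  rewrite -[leRHS]mul1r ler_pM//.
  by rewrite distrC mulrC; apply: line_Lip => //; exact: ltW.
Qed.

(** The difference of both sides, multiplied by h, is O(h^2). *)
Lemma chain_rule_core :
  \int[m]_x (F (f x) * 'D_e eta x) = - \int[m]_x (G (f x) * w x * eta x).
Proof.
have [C1 h1] := chain_error1; have [C2 h2] := chain_error2; have [C3 h3] := chain_error3.
apply/eqP; rewrite -subr_eq0 opprK.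
rewrite (_ : \int[m]_x (G (f x) * w x * eta x) = \int[m]_x (w x * xi x)); last first.
  by apply: eq_Rintegral => x _; rewrite /xi; ring.
set A := _ + _.
have key h : 0 < h <= del -> `|A| <= (C1 + C2 + C3) * h.
  move=> hh; have /andP[h0 _] := hh; have := h1 _ hh; have := h2 _ hh; have := h3 _ hh.
  rewrite (@Rintegral_shiftN (fun x => F (f x)) eta (h *: e))//; last exact: (measurableT_comp mFun mf).
  set a := \int[m]_x ((f _ - f x) * xi x); set b := \int[m]_x (F (f x) * eta x).
  set c := \int[m]_x (F (f x) * eta _); set p := \int[m]_x (F (f x) * 'D_e eta x); set q := \int[m]_x (w x * xi x).
  rewrite -/p -/q => e3 e2 e1.
  rewrite -(ler_pM2l h0) -{1}(gtr0_norm h0) -normrM.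
  rewrite (_ : h * A = (h * p - (b - c)) - (c - b - a) - (a - h * q)); last by rewrite /A -/p -/q; ring.
  apply: (le_trans (ler_normB _ _)); apply: (le_trans (lerD (ler_normB _ _) (lexx _))).
  by apply: (le_trans (lerD (lerD e1 e2) e3)); rewrite le_eqVlt; apply/orP; left; apply/eqP; ring.
rewrite -normr_le0; apply/ler_addgt0Pl => eps eps0; rewrite addr0.
pose C := C1 + C2 + C3.
pose h := Num.min del (eps / (`|C| + 1)).
have C0 : 0 < `|C| + 1 by rewrite ltr_pwDr.
have h0 : 0 < h by rewrite lt_min del0 divr_gt0.
have hd : h <= del by rewrite ge_min lexx.
apply: (le_trans (key h _)); first by rewrite h0.
have : h <= eps / (`|C| + 1) by rewrite ge_min lexx orbT.
rewrite ler_pdivlMr// => hh; apply: le_trans hh; rewrite mulrC ler_wpM2l ?ltW// -/C.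
by rewrite (le_lt_trans (ler_norm _))// ltrDl.
Qed.

End translation.

Definition locally_sqint (R : realType) n (V : set 'rV[R]_n) (f : 'rV[R]_n -> R) :=
  [/\ measurable (V : set (borel 'rV[R]_n)),
   measurable_fun (V : set (borel 'rV[R]_n)) (f : borel 'rV[R]_n -> R) &
   forall K, compact K -> K `<=` V ->
    (\int[lebesgue_rV R n]_(x in K) (f x ^+ 2)%:E < +oo)%E].

Lemma sqint_patch (R : realType) n (V K : set 'rV[R]_n) (f : 'rV[R]_n -> R) :
  locally_sqint V f -> compact K -> K `<=` V ->
  sqint (lebesgue_rV R n) (f \_ K : borel 'rV[R]_n -> R).
Proof.
move=> [mV mf If] cK KV; have mK := compact_borel cK; split.
  by apply/(measurable_restrictT _ mK); exact: measurable_funS mf.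
rewrite (_ : (\int[_]_x _ = \int[lebesgue_rV R n]_(x in K) (f x ^+ 2)%:E)%E); first exact: If.
rewrite [RHS]integral_mkcond; apply: eq_integral => x _.
by rewrite !patchE; case: ifP => // _; rewrite expr0n.
Qed.

Lemma integrable_patch (R : realType) n (V K : set 'rV[R]_n) (f : 'rV[R]_n -> R) :
  locally_sqint V f -> compact K -> K `<=` V ->
  (lebesgue_rV R n).-integrable setT (EFin \o (f \_ K) : borel 'rV[R]_n -> \bar R).
Proof.
move=> lf cK KV; have sfK := sqint_patch lf cK KV; have [mfK _] := sfK.
have iK := integrable_indic_fin (compact_borel cK) (compact_lebesgue_fin cK).
apply: le_integrable (integrableD measurableT (sqint_integrable sfK) iK) => //.
  exact/measurable_EFinP.
move=> x _; rewrite /= patchE indicE lee_fin; case: (x \in K) => /=; last by rewrite expr0n addr0.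
rewrite [leRHS]ger0_norm ?addr_ge0 ?sqr_ge0//.
rewrite -(real_normK (num_real (f x))); have := sqr_ge0 (`|f x| - 1); have := normr_ge0 (f x).
by move: (`|f x|) => a a0; nra.
Qed.

Lemma locally_sqint_integrable (R : realType) n (V : set 'rV[R]_n) (f : 'rV[R]_n -> R) :
  locally_sqint V f -> locally_integrable V f.
Proof.
move=> lf; split; first by case: lf.
move=> K cK KV; have := integrable_patch lf cK KV.
by rewrite -restrict_EFin => /(integrable_mkcond _ (compact_borel cK)).
Qed.

(** A compact subset of V keeps a positive distance to the complement, so it
    can be thickened to a compact K2 that contains all small shifts of a
    neighbourhood U. *)
Lemma compact_margin (R : realType) n (K V : set 'rV[R]_n) (v : 'rV[R]_n) :
  compact K -> open V -> K `<=` V -> `|v| <= 1 ->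
  exists del : R, exists K2 U : set 'rV[R]_n, [/\ 0 < del, compact K2 /\ K2 `<=` V, open U, K `<=` U &
    forall x (s : R), U x -> `|s| <= del -> K2 (x + s *: v)].
Proof.
move=> cK oV KV v1.
pose P (r : R) (y : 'rV[R]_n) := forall z, `|z - y| <= r -> V z.
have [del [del0 hdel]] : exists del : R, 0 < del /\ K `<=` P del.
  have /compact_near_coveringP/(_ R (0^'+) P) := cK.
  have FF : Filter (0^'+ : set_system R) by exact: at_right_proper_filter.
  move=> /(_ FF) h.
  have {h} : \forall r \near 0^'+, K `<=` P r.
    apply: h => x Kx.
    have /nbhs_ballP[r /= r0 rV] : nbhs x V by apply: open_nbhs_nbhs; split => //; exact: KV.
    exists (ball x (r / 2), [set s : R | 0 < s < r / 2]) => /=.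
      split; first by apply: nbhsx_ballx; rewrite divr_gt0.
      near=> s; rewrite /=; apply/andP; split; near: s; first exact: nbhs_right_gt.
      by apply: nbhs_right_lt; rewrite divr_gt0.
    move=> [y s] /= [+ /andP[s0 sr]] z zy; rewrite -ball_normE /= => xy.
    apply: rV; rewrite -ball_normE /=.
    by rewrite (le_lt_trans (ler_distD y _ _))// [ltRHS](splitr r) ltr_leD// distrC (le_trans zy)// ltW.
  move=> h; near (0 : R)^'+ => r; exists r; split=> //; near: r => //; exact: nbhs_right_gt.
pose K2 := (fun q : 'rV[R]_n * 'rV[R]_n => q.1 + q.2) @` (K `*` ccbox (fun=> - del) (fun=> del)).
exists (del / 2), K2, (\bigcup_(k in K) ball k (del / 2)); split.
- by rewrite divr_gt0.
- split.
    apply: continuous_compact; last by apply: compact_setX => //; exact: compact_ccbox.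
    apply: continuous_subspaceT => q; exact: add_continuous.
  move=> _ [[k z] [/= Kk zb] <-]; apply: (hdel k Kk).
  rewrite addrAC subrr add0r.
  rewrite [leLHS](_ : _ = mx_norm z)// mx_normrE; apply: bigmax_le; first exact: ltW.
  move=> [a b] _ /=; rewrite ord1; have := zb b; rewrite /= in_itv/= -ler_norml; exact.
- by apply: bigcup_open => k _; apply: ball_open; rewrite divr_gt0.
- by move=> k Kk; exists k => //; apply: ballxx; rewrite divr_gt0.
move=> x s [k Kk]; rewrite -ball_normE /= => xk sd.
exists (k, x + s *: v - k); last by rewrite /= addrC subrK.
split=> //= j; rewrite /= in_itv/= -ler_norml (le_trans (coord_le_norm _ _))//.
rewrite addrAC (le_trans (ler_normD _ _))// (splitr del) lerD//.
  by rewrite distrC ltW.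
by rewrite normrZ -[leRHS]mulr1 ler_pM.
Unshelve. all: by end_near.
Qed.

Lemma norm_delta_le1 (R : realType) n (i : 'I_n) : `|delta_mx 0 i : 'rV[R]_n| <= 1.
Proof.
rewrite [leLHS](_ : _ = mx_norm (delta_mx 0 i : 'rV[R]_n))// mx_normrE; apply: bigmax_le => //.
by move=> [a b] _ /=; rewrite mxE; case: (_ && _); rewrite ?normr1 ?normr0.
Qed.

(** Cut-offs to the compact set provided by [compact_margin] satisfy the
    hypotheses of [chain_rule_core] near the support of eta. *)
Lemma weak_partial_chain (R : realType) n (i : 'I_n) (V : set 'rV[R]_n) (f w : 'rV[R]_n -> R)
    (F G : R -> R) (Lip : R) :
  open V -> locally_sqint V f -> locally_sqint V w ->
  (forall eta, test_function V eta ->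
    \int[lebesgue_rV R n]_(x in V) (f x * 'D_(delta_mx 0 i) eta x) =
    - \int[lebesgue_rV R n]_(x in V) (w x * eta x)) ->
  0 <= Lip -> measurable_fun setT F -> measurable_fun setT G ->
  (forall a, `|F a| <= `|a|) -> (forall a, `|G a| <= 1) ->
  (forall a b, `|G a - G b| <= Lip * `|a - b|) ->
  (forall a b, `|F b - F a - G a * (b - a)| <= Lip * (b - a) ^+ 2) ->
  forall eta, test_function V eta ->
    \int[lebesgue_rV R n]_(x in V) (F (f x) * 'D_(delta_mx 0 i) eta x) =
    - \int[lebesgue_rV R n]_(x in V) (G (f x) * w x * eta x).
Proof.
move=> oV lf lw hfw L0 mF mG F0 G1 GL FG eta teta.
have [K [cK KV] etaK] := test_function_support teta.
have [seta _ _] := teta.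
have [del [K2 [U [del0 [cK2 K2V] oU KU UK2]]]] := compact_margin cK oV KV (norm_delta_le1 R i).
have KK2 : K `<=` K2.
  move=> x Kx; have := UK2 x 0 (KU _ Kx); rewrite normr0 scale0r addr0; apply; exact: ltW.
have sf := sqint_patch lf cK2 K2V; have sw := sqint_patch lw cK2 K2V.
have iw := integrable_patch lw cK2 K2V.
have core := @chain_rule_core R n i (f \_ K2) (w \_ K2) U del sf sw iw oU _ F G Lip K eta
  L0 mF mG F0 G1 GL FG cK KU seta etaK del0.
rewrite (@Rintegral_mul_support _ (borel 'rV[R]_n) R (lebesgue_rV R n) V K2 (fun x => F (f x)) ('D_(delta_mx 0 i) eta) K2V); last first.
  by move=> x nK; apply: (vanish_off_partial i cK etaK) => /KK2.
rewrite (@Rintegral_mul_support _ (borel 'rV[R]_n) R (lebesgue_rV R n) V K2 (fun x => G (f x) * w x) eta K2V); last first.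
  by move=> x nK; apply: etaK => /KK2.
transitivity (\int[lebesgue_rV R n]_x (F ((f \_ K2) x) * 'D_(delta_mx 0 i) eta x)).
  apply: eq_Rintegral => x _; rewrite !patchE; case: ifPn => // /negP nK.
  by rewrite (vanish_off_partial i cK etaK) ?mulr0// => /KK2 Kx; apply: nK; exact: mem_set.
rewrite core.
  congr (- _); apply: eq_Rintegral => x _; rewrite !patchE; case: ifPn => // _.
  by rewrite mulr0.
move=> theta s tt /andP[s0 sd].
have [Kt [cKt KtU] hKt] := test_function_support tt.
have [st _ _] := tt.
have K2s x : Kt (x - s *: delta_mx 0 i) -> K2 x.
  move=> /KtU Ux; have := UK2 _ s Ux; rewrite subrK; apply.
  by rewrite ger0_norm.
pose th (x : 'rV[R]_n) := theta (x + - (s *: delta_mx 0 i)).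
have tth : test_function V th.
  split; first exact: smooth_addr.
    exists ((fun x => x + s *: delta_mx 0 i) @` Kt); split.
    - apply: continuous_compact => //; apply: continuous_subspaceT => x.
      by apply: (@continuousD _ _ _ id (fun=> s *: delta_mx 0 i)); [move=> ?|exact: cst_continuous].
    - by move=> _ [x Kx <-]; apply: K2V; apply: K2s; rewrite addrK.
    - move=> x _ nx; rewrite /th hKt// => Kx; apply: nx; exists (x - s *: delta_mx 0 i) => //.
      by rewrite subrK.
  by move=> x nV; rewrite /th hKt// => /K2s/K2V.
have := hfw _ tth.
rewrite (@Rintegral_mul_support _ (borel 'rV[R]_n) R (lebesgue_rV R n) V K2 f ('D_(delta_mx 0 i) th) K2V); last first.
  move=> x nK; rewrite /th derivable_addr (vanish_off_partial i cKt hKt)// => /K2s.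
  exact: nK.
rewrite (@Rintegral_mul_support _ (borel 'rV[R]_n) R (lebesgue_rV R n) V K2 w th K2V); last first.
  by move=> x nK; rewrite /th hKt// => /K2s.
move=> <-; apply: eq_Rintegral => x _; by rewrite /th derivable_addr.
Qed.

(** * Elliptic metrics and the volume measure *)

Lemma bilin1_ge0 (R : realType) n (x : 'rV[R]_n) : 0 <= bilin 1%:M x x.
Proof.
rewrite /bilin mulmx1 mxE sumr_ge0// => i _.
by rewrite mxE -expr2 sqr_ge0.
Qed.

Lemma bilin1E (R : realType) n (x : 'rV[R]_n) : bilin 1%:M x x = \sum_i x 0 i ^+ 2.
Proof. by rewrite /bilin mulmx1 mxE; apply: eq_bigr => i _; rewrite mxE expr2. Qed.

(** One step of elimination: det A is the corner entry times the determinant of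
    the Schur complement S, and S inherits the bounds because S(y,y) is a value
    of A at a vector with last coordinates y, and at most the value of A at
    (0,y). *)
Lemma det_elliptic (R : realType) n (A : 'M[R]_n) (c C : R) : 0 < c -> A^T = A ->
  (forall x, c * bilin 1%:M x x <= bilin A x x <= C * bilin 1%:M x x) ->
  c ^+ n <= \det A <= C ^+ n.
Proof.
move=> c0; elim: n A => [|n ih] A sA hA; first by rewrite det_mx00 !expr0 lexx.
pose a : R := (ulsubmx (A : 'M[R]_(1 + n))) 0 0.
pose b : 'rV[R]_n := ursubmx (A : 'M[R]_(1 + n)).
pose D : 'M[R]_n := drsubmx (A : 'M[R]_(1 + n)).
have eA : A = block_mx a%:M b b^T D :> 'M[R]_(1 + n).
  rewrite -[LHS](submxK (A : 'M[R]_(1 + n))) /a /b /D -mx11_scalar; congr block_mx.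
  by rewrite trmx_ursub sA.
have sD : D^T = D by rewrite /D trmx_drsub sA.
have bA (x : 'rV[R]_1) (y : 'rV[R]_n) :
    bilin (A : 'M[R]_(1 + n)) (row_mx x y) (row_mx x y) =
    ((x *m a%:M + y *m b^T) *m x^T + (x *m b + y *m D) *m y^T) 0 0.
  by rewrite /bilin eA mul_row_block tr_row_mx mul_row_col.
have b1 (x : 'rV[R]_1) (y : 'rV[R]_n) :
    bilin 1%:M (row_mx x y : 'rV[R]_(1 + n)) (row_mx x y) = x 0 0 ^+ 2 + bilin 1%:M y y.
  rewrite /bilin !mulmx1 tr_row_mx mul_row_col mxE; congr (_ + _).
  by rewrite mxE big_ord1 mxE expr2.
have /andP[ca aC] : c <= a <= C.
  have := hA (row_mx 1%:M 0 : 'rV[R]_(1 + n)); rewrite bA b1.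
  rewrite !mul0mx !addr0 !mul1mx trmx1 mulmx1 trmx0 mulmx0 addr0 /bilin !mul0mx !mxE eqxx.
  by rewrite expr1n addr0 !mulr1.
have a0 : 0 < a by exact: lt_le_trans ca.
pose S := D - a^-1 *: (b^T *m b).
have sS : S^T = S by rewrite /S linearB linearZ /= trmx_mul trmxK sD.
have bS (y : 'rV[R]_n) : exists x : 'rV[R]_1,
    bilin (A : 'M[R]_(1 + n)) (row_mx x y) (row_mx x y) = bilin S y y.
  exists (- (a^-1 *: (y *m b^T))); rewrite bA mulNmx -scalemxAl mul_mx_scalar scalerA mulVf ?gt_eqF//.
  rewrite scale1r addNr mul0mx add0r /bilin /S mulmxBr; congr ((_ *m _) 0 0).
  by rewrite mulNmx -scalemxAl -scalemxAr mulmxA addrC.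
have hS y : c * bilin 1%:M y y <= bilin S y y <= C * bilin 1%:M y y.
  apply/andP; split.
    have [x <-] := bS y; have /andP[+ _] := hA (row_mx x y : 'rV[R]_(1 + n)).
    apply: le_trans; rewrite ler_pM2l// b1 lerDr; exact: sqr_ge0.
  apply: (@le_trans _ _ (bilin D y y)).
    have e : y *m S *m y^T = y *m D *m y^T - a^-1 *: ((y *m b^T) *m (y *m b^T)^T).
      by rewrite /S mulmxBr mulmxBl -scalemxAr -scalemxAl trmx_mul trmxK !mulmxA.
    rewrite /bilin e.
    have -> (X Y : 'M[R]_1) : (X - a^-1 *: (Y *m Y^T)) 0 0 = X 0 0 - a^-1 * Y 0 0 ^+ 2.
      by rewrite !mxE big_ord1 mxE expr2.
    by rewrite gerBl mulr_ge0 ?sqr_ge0// invr_ge0 ltW.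
  have := hA (row_mx 0 y : 'rV[R]_(1 + n)); rewrite bA b1 !mul0mx !add0r trmx0 mulmx0 add0r.
  by rewrite mxE expr0n add0r => /andP[].
have detA : \det A = a * \det S.
  have -> : A = block_mx 1%:M 0 (a^-1 *: b^T) 1%:M *m block_mx a%:M b 0 S :> 'M[R]_(1 + n).
    rewrite mulmx_block eA !mul1mx !mul0mx ?mulmx0 ?addr0 mul_mx_scalar scalerA mulfV ?gt_eqF//.
    by rewrite scale1r /S -scalemxAl addrC subrK.
  have h1 := det_lblock (1%:M : 'M[R]_1) (a^-1 *: b^T) (1%:M : 'M[R]_n).
  have h2 := det_ublock (a%:M : 'M[R]_1) b S.
  by rewrite det_mulmx [X in X * _]h1 [X in _ * X]h2 !det1 !mul1r det_scalar1.
have /andP[h1 h2] := ih S sS hS.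
have S0 : 0 <= \det S by apply: le_trans h1; rewrite exprn_ge0// ltW.
rewrite detA !exprS; apply/andP; split; apply: ler_pM => //; rewrite ?exprn_ge0// ltW//.
Qed.

Lemma within_preimage_open (T U : topologicalType) (A : set T) (f : T -> U) (B : set U) :
  {within A, continuous f} -> open B -> exists2 O, open O & A `&` f @^-1` B = A `&` O.
Proof.
move=> /continuousP cf oB; have /open_subspaceP[W oW e] := cf _ oB.
by exists W => //; rewrite setIC -e setIC.
Qed.

Lemma measurable_half_space (R : realType) d : measurable (@half_space R d : set (borel 'rV[R]_d)).
Proof.
pose F (i : 'I_d) : set R := if i.+1 == d then `[0, +oo[%classic else setT.
rewrite (_ : @half_space R d = box F); last first.
  apply/seteqP; split=> x h i; have := h i; rewrite /F; case: eqP => // e.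
    by move=> /(_ e) h'; rewrite /= in_itv/= h'.
  by rewrite /= in_itv/= andbT.
by apply: measurable_box => i; rewrite /F; case: ifP.
Qed.

Lemma ae_countable d (T : measurableType d) (R : realType) (mu : {measure set T -> \bar R})
    (I : Type) (B : set I) (P : I -> T -> Prop) : countable B ->
  (forall i, B i -> {ae mu, forall x, P i x}) -> {ae mu, forall x, forall i, B i -> P i x}.
Proof.
move=> /countable_injP[f fi] h.
have : {ae mu, forall x, forall k, forall i, B i -> f i = k -> P i x}.
  apply: ae_foralln => k.
  have [[i [Bi fik]]|nk] := pselect (exists i, B i /\ f i = k).
    apply: ae_imp (h i Bi) => x Px j Bj fjk.
    suff -> : j = i by [].
    by apply: fi; rewrite ?inE// fjk.
  by apply: aeW => x i Bi fik; exfalso; apply: nk; exists i.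
by apply: ae_imp => x h' i Bi; exact: (h' (f i) i Bi erefl).
Qed.

Section chart_measurability.
Context (R : realType) (d : nat) (M : lr_manifold R d).
Implicit Types a b : chart_index M.

Lemma measurable_chart_dom a : measurable (chart_dom a : set (borel M)).
Proof. by apply: open_borel; exact: chart_dom_open. Qed.

Lemma measurable_chart_image a : measurable (chart_image a : set (borel 'rV[R]_d)).
Proof.
have [oI|[W oW e]] := chart_image_open a; first exact: open_borel.
rewrite [X in measurable X]e; apply: measurableI; first exact: open_borel.
exact: measurable_half_space.
Qed.

Lemma chart_image_dom a y : chart_image a y -> chart_dom a (chart_inv a y).
Proof. by move=> [x xa <-]; rewrite chartK. Qed.

Lemma chart_invK a y : chart_image a y -> chart a (chart_inv a y) = y.
Proof. by move=> [x xa <-]; rewrite chartK. Qed.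

Lemma measurable_chart_preimage a (N : set 'rV[R]_d) : measurable (N : set (borel 'rV[R]_d)) ->
  measurable (chart_dom a `&` chart a @^-1` N : set (borel M)).
Proof.
move=> mN; pose f : borel M -> borel 'rV[R]_d := chart a.
suff mf : measurable_fun (chart_dom a : set (borel M)) f.
  by have := mf (measurable_chart_dom a) _ mN.
apply: (@measurability _ _ _ (borel 'rV[R]_d) _ _ (@open 'rV[R]_d)) => // _ [V oV <-].
have cc : {within chart_dom a, continuous (chart a)} by exact: chart_continuous.
have [W oW e] := within_preimage_open cc oV.
rewrite [X in measurable X]e; apply: measurableI; [exact: measurable_chart_dom|exact: open_borel].
Qed.

Lemma measurable_chart_inv a :
  measurable_fun (chart_image a : set (borel 'rV[R]_d)) (chart_inv a : borel 'rV[R]_d -> borel M).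
Proof.
apply: (@measurability _ _ _ (borel M) _ _ (@open M)) => // _ [V oV <-].
have cc : {within chart_image a, continuous (chart_inv a)} by exact: chart_inv_continuous.
have [W oW e] := within_preimage_open cc oV.
rewrite [X in measurable X]e; apply: measurableI; [exact: measurable_chart_image|exact: open_borel].
Qed.

Lemma measurable_pullback a (f : M -> R) : measurable_fun setT (f : borel M -> R) ->
  measurable_fun (chart_image a : set (borel 'rV[R]_d)) (fun y : borel 'rV[R]_d => f (chart_inv a y)).
Proof.
move=> mf; have mi := @measurable_chart_inv a.
exact: (@measurableT_comp _ _ _ _ _ _ (f : borel M -> R) _ (chart_inv a : borel 'rV[R]_d -> borel M) mf mi).
Qed.

Lemma density_bounds a : exists c C : R, 0 < c /\
  {ae lebesgue_rV R d, forall y, chart_image a y -> c <= volume_density a y <= C}.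
Proof.
have [lam lam1 h] := metric_elliptic a.
have lam0 : 0 < lam by exact: lt_le_trans lam1.
exists (Num.sqrt (lam^-1 ^+ d)), (Num.sqrt (lam ^+ d)); split.
  by rewrite sqrtr_gt0 exprn_gt0// invr_gt0.
apply: ae_imp h => y h ya; have [sy _] := metric_scalar_product ya.
have li : 0 < lam^-1 by rewrite invr_gt0.
have /andP[d1 d2] := det_elliptic li sy (h ya).
by rewrite /volume_density !ler_wsqrtr.
Qed.

Lemma measurable_det n dT (T : measurableType dT) (D : set T) (A : T -> 'M[R]_n) :
  (forall i j, measurable_fun D (fun x => A x i j)) -> measurable_fun D (fun x => \det (A x)).
Proof.
move=> mA; rewrite /determinant; apply: measurable_sum => s.
by apply: measurable_funM => //; apply: measurable_prod => i _; exact: mA.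
Qed.

Lemma measurable_volume_density a :
  measurable_fun (chart_image a : set (borel 'rV[R]_d)) (volume_density a : borel 'rV[R]_d -> R).
Proof.
have msq : measurable_fun setT (@Num.sqrt R).
  by apply: continuous_measurable_fun; exact: sqrt_continuous.
apply: (measurableT_comp msq); apply: measurable_det => i j.
exact: metric_borel.
Qed.

End chart_measurability.

Section volume.
Context (R : realType) (d : nat) (M : lr_manifold R d).
Context (v : {measure set (borel M) -> \bar R}) (v_volume : volume_measure v).
Implicit Types a b : chart_index M.
Let leb := lebesgue_rV R d.

Lemma volume_set a (S : set (borel M)) : measurable S -> S `<=` chart_dom a ->
  (v S = \int[leb]_(y in chart_image a) (\1_S (chart_inv a y) * volume_density a y)%:E)%E.
Proof.
move=> mS Sa; rewrite -(v_volume (f := \1_S)).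
- by rewrite integral_indic// setIT.
- exact: measurable_indic.
- by move=> x; rewrite indicE.
- by exists 1 => x; rewrite indicE; case: (_ \in _).
- by move=> x nx; rewrite indicE memNset// => /Sa.
Qed.

Lemma volume_null a (N : set 'rV[R]_d) : measurable (N : set (borel 'rV[R]_d)) -> leb N = 0%E ->
  v (chart_dom a `&` chart a @^-1` N) = 0%E.
Proof.
move=> mN N0; rewrite (@volume_set a); [|exact: measurable_chart_preimage|by move=> x []].
rewrite (@ae_eq_integral _ _ _ leb (chart_image a) (cst 0%E)) ?integral0//.
- exact: measurable_chart_image.
- apply/measurable_EFinP; apply: measurable_funM; last exact: measurable_volume_density.
  apply: (@measurable_pullback _ _ _ a (\1_(chart_dom a `&` chart a @^-1` N))).
  by apply: measurable_indic; exact: measurable_chart_preimage.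
- exists N; split=> // y /= /not_implyP[ya]; apply: contra_notP => nN.
  rewrite indicE memNset ?mul0r// => -[_ /=].
  by rewrite chart_invK.
Qed.

(** Charts pull Lebesgue-null sets back to null sets, and countably many charts
    cover M. *)
Lemma ae_chart (P : M -> Prop) :
  (forall a, {ae leb, forall y, chart_image a y -> P (chart_inv a y)}) -> {ae v, forall x, P x}.
Proof.
move=> h; have [B cB covB] := atlas_countable M.
have : {ae v, forall x, forall a, B a -> chart_dom a x -> P x}.
  apply: ae_countable => // a _.
  have [N [mN N0 hN]] := h a.
  exists (chart_dom a `&` chart a @^-1` N); split.
  - exact: measurable_chart_preimage.
  - exact: volume_null.
  - move=> x /= /not_implyP[xa nP]; split=> //; apply: hN => /= h'; apply: nP.
    by rewrite -(chartK xa); apply: h'; exists x.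
apply: ae_imp => x hx; have : [set: M] x by [].
by rewrite -covB => -[a Ba ax]; exact: hx Ba ax.
Qed.

End volume.

Section volume_finiteness.
Context (R : realType) (d : nat) (M : lr_manifold R d).
Context (v : {measure set (borel M) -> \bar R}) (v_volume : volume_measure v).
Implicit Types a b : chart_index M.
Let leb := lebesgue_rV R d.

(** The volume formula speaks of bounded functions supported in a chart domain;
    truncation and monotone convergence remove the bound, and restricting to
    the domain leaves an inequality. *)
Lemma volume_integral_le a (g : M -> R) : measurable_fun setT (g : borel M -> R) ->
  (forall x, 0 <= g x) ->
  (\int[leb]_(y in chart_image a) (g (chart_inv a y) * volume_density a y)%:E <=
   \int[v]_x (g x)%:E)%E.
Proof.
move=> mg g0.
pose gk (k : nat) (x : M) : R := Num.min (g x) k%:R * \1_(chart_dom a) x.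
have m1 : measurable_fun setT (\1_(chart_dom a) : borel M -> R).
  by apply: measurable_indic; exact: measurable_chart_dom.
have mgk k : measurable_fun setT (gk k : borel M -> R).
  by apply: measurable_funM => //; apply: measurable_minr.
have gk0 k x : 0 <= gk k x by rewrite /gk mulr_ge0// le_min g0 ler0n.
have rho0 y : 0 <= volume_density a y by exact: sqrtr_ge0.
have le1 (x : M) : \1_(chart_dom a) x <= 1 :> R by rewrite indicE; case: (_ \in _).
have mfk k : measurable_fun (chart_image a : set (borel 'rV[R]_d))
    (fun y : borel 'rV[R]_d => (gk k (chart_inv a y) * volume_density a y)%:E).
  apply/measurable_EFinP; apply: measurable_funM; last exact: measurable_volume_density.
  exact: (@measurable_pullback _ _ _ a (gk k)).
have h := @cvg_monotone_convergence _ _ _ leb _ (measurable_chart_image a)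
  (fun k y => (gk k (chart_inv a y) * volume_density a y)%:E) mfk.
have cvg1 : (\int[leb]_(y in chart_image a) (gk k (chart_inv a y) * volume_density a y)%:E)%E @[k --> \oo] -->
   (\int[leb]_(y in chart_image a) (g (chart_inv a y) * volume_density a y)%:E)%E.
  rewrite [X in _ --> X](_ : _ = (\int[leb]_(y in chart_image a) limn (fun k => (gk k (chart_inv a y) * volume_density a y)%:E))%E).
    apply: h.
    - by move=> k y ya; rewrite lee_fin mulr_ge0.
    - move=> y ya k l kl; rewrite lee_fin ler_wpM2r// ler_wpM2r//.
      by rewrite le_min !ge_min lexx /= ler_nat kl orbT.
  apply: eq_integral => y /set_mem ya; apply/esym/cvg_lim => //.
  apply: cvg_near_cst; near=> k; congr (_ * _)%:E.
  rewrite /gk indicE mem_set ?mulr1; last exact: chart_image_dom.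
  apply/min_idPl; near: k; exact: nbhs_infty_ger.
apply: (cvge_le _ cvg1).
apply: nearW => k.
rewrite -(v_volume (f := gk k))//.
- apply: ge0_le_integral => //.
  + by move=> x _; rewrite lee_fin.
  + exact/measurable_EFinP.
  + exact/measurable_EFinP.
  + move=> x _; rewrite lee_fin -[leRHS]mulr1 ler_pM// ?le_min ?g0//=.
    by rewrite ge_min lexx.
- exists k%:R => x; rewrite -[leRHS]mulr1 ler_pM// ?le_min ?g0//=.
  by rewrite ge_min lexx orbT.
- by move=> x nx; rewrite /gk indicE memNset// mulr0.
Unshelve. all: by end_near.
Qed.

(** The density is bounded in each chart. *)
Lemma volume_bounded_chart a (N : set 'rV[R]_d) : measurable (N : set (borel 'rV[R]_d)) ->
  (leb N < +oo)%E -> (v (chart_dom a `&` chart a @^-1` N) < +oo)%E.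
Proof.
move=> mN Nfin; have [c [C [c0 hC]]] := density_bounds a.
rewrite (volume_set v_volume (a := a)); [|exact: measurable_chart_preimage|by move=> x []].
have mi := measurable_chart_image a.
have m1 : measurable_fun setT (\1_N : borel 'rV[R]_d -> R) by exact: measurable_indic.
apply: (@le_lt_trans _ _ (\int[leb]_(y in chart_image a) (`|C| * \1_N (y : 'rV[R]_d))%:E)%E).
  apply: ae_ge0_le_integral => //.
  - by move=> y _; rewrite lee_fin mulr_ge0// sqrtr_ge0.
  - apply/measurable_EFinP; apply: measurable_funM; last exact: measurable_volume_density.
    apply: (@measurable_pullback _ _ _ a (\1_(chart_dom a `&` chart a @^-1` N))).
    by apply: measurable_indic; exact: measurable_chart_preimage.
  - by apply/measurable_EFinP; apply: measurable_funM => //; exact: measurable_funTS.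
  apply: ae_imp hC => y h ya; have /andP[h1 h2] := h ya; rewrite lee_fin !indicE.
  have [yN|nN] := pselect (N y).
    rewrite (mem_set yN) mulr1 (@le_trans _ _ (volume_density a y))//; last first.
      by rewrite (le_trans h2)// ler_norm.
    by rewrite -[leRHS]mul1r ler_wpM2r ?sqrtr_ge0//; case: (_ \in _).
  by rewrite memNset ?mul0r ?mulr_ge0// => -[_ /=]; rewrite chart_invK.
under eq_integral do rewrite EFinM.
rewrite ge0_integralZl//.
- rewrite lte_mul_pinfty// integral_indic//; apply: le_lt_trans Nfin.
  by apply: le_measure; rewrite ?inE//; exact: measurableI.
- by apply/measurable_EFinP; exact: measurable_funTS.
Qed.

(** Bounded pieces of countably many charts cover M. *)
Lemma volume_sigma_finite : sigma_finite setT v.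
Proof.
have [B /countable_injP[f fi] covB] := atlas_countable M.
pose box r : set 'rV[R]_d := ccbox (fun=> - r%:R) (fun=> r%:R).
pose S (k : nat) (r : nat) : set M :=
  [set x | exists2 a, B a /\ f a = k & (chart_dom a `&` chart a @^-1` (box r)) x].
have hS k r : measurable (S k r : set (borel M)) /\ (v (S k r) < +oo)%E.
  have [[a [Ba fa]]|nk] := pselect (exists a, B a /\ f a = k).
    rewrite (_ : S k r = chart_dom a `&` chart a @^-1` (box r)); last first.
      apply/seteqP; split=> [x [b [Bb fb]]|x xa]; last by exists a.
      suff -> : b = a by [].
      by apply: fi; rewrite ?inE// fb.
    split; first by apply: measurable_chart_preimage; exact: measurable_ccbox.
    apply: volume_bounded_chart; [exact: measurable_ccbox|exact: lebesgue_rV_ccbox_fin].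
  rewrite (_ : S k r = set0) ?measure0//; apply/seteqP; split=> // x [a h _].
  by apply: nk; exists a.
exists (fun k => if unpickle k is Some q then S q.1 q.2 else set0); last first.
  by move=> k; case: unpickle => [[p q]|] //; rewrite measure0.
apply/seteqP; split=> // x _; have : [set: M] x by [].
rewrite -covB => -[a Ba xa].
have [r [_ Kr]] := @compact_sub_ccbox R d [set chart a x] (@compact_set1 _ _).
exists (pickle (f a, Num.truncn r + 1)%N) => //; rewrite pickleK /=.
exists a => //; split=> //= i; have := Kr _ erefl i; rewrite /= !in_itv/= => /andP[h1 h2].
have rk : r <= (Num.truncn r + 1)%:R by rewrite addn1 ltW// truncnS_gt.
by rewrite (le_trans _ h1) ?lerN2// (le_trans h2).
Qed.

Lemma open_chart_preimage a (N : set 'rV[R]_d) : open N -> open (chart_dom a `&` chart a @^-1` N).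
Proof.
move=> oN; have cc : {within chart_dom a, continuous (chart a)} by exact: chart_continuous.
have [W oW ->] := within_preimage_open cc oN.
by apply: openI => //; exact: chart_dom_open.
Qed.

Lemma chart_cover (x : M) : exists a, chart_dom a x.
Proof. by have : [set: M] x by []; rewrite -(chart_dom_cover M) => -[a _ ?]; exists a. Qed.

Lemma volume_locally_finite (x : M) : exists U, [/\ open U, U x & (v U < +oo)%E].
Proof.
have [a xa] := chart_cover x.
pose N : set 'rV[R]_d := oobox (fun i => chart a x 0 i - 1) (fun i => chart a x 0 i + 1).
have oN : open N.
  rewrite (_ : N = ball (chart a x) 1); first exact: ball_open.
  apply/seteqP; split=> y.
    by move=> h; split=> // i j; rewrite [i]ord1 -ball_normE /= distrC ltr_distl; have := h j; rewrite /= in_itv.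
  by move=> [_ h] j; have := h 0 j; rewrite -ball_normE /= distrC ltr_distl in_itv.
exists (chart_dom a `&` chart a @^-1` N); split.
- exact: open_chart_preimage.
- by split=> // i; rewrite /= in_itv/= gtrBl ltrDl ltr01.
- apply: volume_bounded_chart; first exact: measurable_oobox.
  apply: le_lt_trans (lebesgue_rV_ccbox_fin (fun i => chart a x 0 i - 1) (fun i => chart a x 0 i + 1)).
  apply: le_measure; rewrite ?inE; [exact: measurable_oobox|exact: measurable_ccbox|exact: sub_oobox_ccbox].
Qed.

(** At a boundary point of M the image of a chart is only a relative
    neighbourhood in the half space, but it contains the open cube whose lower
    corner is the point. There the density is bounded below. *)
Lemma volume_open_gt0 (U : set M) : open U -> U !=set0 -> (0 < v U)%E.
Proof.
move=> oU [x Ux]; have [a xa] := chart_cover x.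
have cc : {within chart_image a, continuous (chart_inv a)} by exact: chart_inv_continuous.
have [W oW eW] := within_preimage_open cc oU.
have [W' [oW' W'x hW']] : exists W', [/\ open W', W' (chart a x) &
    forall y, W' y -> (forall i : 'I_d, chart a x 0 i < y 0 i) -> chart_image a y /\ W y].
  have Wx : W (chart a x).
    have : (chart_image a `&` W) (chart a x).
      by rewrite -eW; split=> /=; [exists x|rewrite chartK].
    by case.
  have [oI|[V oV eV]] := chart_image_open a.
    by exists (chart_image a `&` W); split=> [||y []//]; [exact: openI|split=> //; exists x].
  have [Vx hx] : (V `&` @half_space R d) (chart a x) by rewrite -eV; exists x.
  exists (V `&` W); split=> //; first exact: openI.
  move=> y [Vy Wy] hy; split=> //; rewrite /chart_image eV; split=> // i di.
  by rewrite (le_trans (hx i di))// ltW.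
have /nbhs_ballP[e /= e0 eW'] : nbhs (chart a x) W' by exact: open_nbhs_nbhs.
pose Q : set 'rV[R]_d := oobox (fun i => chart a x 0 i) (fun i => chart a x 0 i + e).
have hQ y : Q y -> chart_image a y /\ W y.
  move=> Qy; apply: hW'.
    apply: eW'; split=> // i j; rewrite [i]ord1 -ball_normE /=.
    have := Qy j; rewrite /= in_itv/= => /andP[h1 h2].
    by rewrite distrC ltr_distl h2 andbT ltrBlDr (lt_trans h1)// ltrDl.
  by move=> i; have := Qy i; rewrite /= in_itv/= => /andP[].
have mQ : measurable (Q : set (borel 'rV[R]_d)) by exact: measurable_oobox.
have [c [C [c0 hC]]] := density_bounds a.
have mS := measurable_chart_preimage a mQ.
have QS : chart_dom a `&` chart a @^-1` Q `<=` U.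
  move=> z [za Qz]; have [iz Wz] := hQ _ Qz.
  have : (chart_image a `&` W) (chart a z) by [].
  by rewrite -eW => -[_ /=]; rewrite chartK.
apply: (@lt_le_trans _ _ (v (chart_dom a `&` chart a @^-1` Q))); last first.
  by apply: le_measure; rewrite ?inE//; exact: open_borel.
rewrite (volume_set v_volume (a := a) mS); last by move=> z [].
have mi := measurable_chart_image a.
apply: (@lt_le_trans _ _ (\int[leb]_(y in chart_image a) (c * \1_Q (y : 'rV[R]_d))%:E)%E).
  under eq_integral do rewrite EFinM.
  rewrite ge0_integralZl//; last 2 first.
  - by apply/measurable_EFinP; apply: measurable_funTS; exact: measurable_indic.
  - by rewrite lee_fin ltW.
  rewrite mule_gt0//.
  rewrite integral_indic// (_ : Q `&` chart_image a = Q).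
    by apply: lebesgue_rV_oobox_gt0 => i; rewrite ltrDl.
  by apply/setIidl => y /hQ[].
apply: ae_ge0_le_integral => //.
- by move=> y _; rewrite lee_fin mulr_ge0// ltW.
- by apply/measurable_EFinP; apply: measurable_funM => //; apply: measurable_funTS; exact: measurable_indic.
- by move=> y _; rewrite lee_fin mulr_ge0// sqrtr_ge0.
- apply/measurable_EFinP; apply: measurable_funM; last exact: measurable_volume_density.
  apply: (@measurable_pullback _ _ _ a (\1_(chart_dom a `&` chart a @^-1` Q))).
  exact: measurable_indic.
- apply: ae_imp hC => y h ya; have /andP[h1 h2] := h ya; rewrite lee_fin !indicE.
  have [yQ|nQ] := pselect (Q y).
    rewrite mem_set// mulr1 mem_set ?mul1r//; split; first exact: chart_image_dom.
    by rewrite /= chart_invK.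
  by rewrite memNset// mulr0 mulr_ge0 ?sqrtr_ge0.
Qed.

End volume_finiteness.

(** * Truncations of the line *)

Section truncation.
Context (R : realType).
Implicit Types a b r : R.

(** ramp is the derivative of ramp1, and ramp1 that of ramp2. All three are
    polynomials in excess and ramp, so that inequalities between them are
    polynomial on each of r <= 1, 1 <= r <= 2 and 2 <= r. *)
Definition excess r : R := Num.max (r - 1) 0.
Definition ramp r : R := Num.min (excess r) 1.
Definition ramp1 r : R := excess r * ramp r - ramp r ^+ 2 / 2.
Definition ramp2 r : R :=
  excess r ^+ 2 * ramp r / 2 - excess r * ramp r ^+ 2 / 2 + ramp r ^+ 3 / 6.

Lemma excess_cases r :
  [\/ r <= 1 /\ (excess r = 0 /\ ramp r = 0),
      1 <= r <= 2 /\ (excess r = r - 1 /\ ramp r = r - 1) |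
      2 <= r /\ (excess r = r - 1 /\ ramp r = 1)].
Proof.
rewrite /ramp /excess; case: (leP r 1) => [h|h].
  constructor 1; split=> //; rewrite (max_idPr _) ?subr_le0//; split=> //.
  by apply/min_idPl.
have e : Num.max (r - 1) 0 = r - 1 by apply/max_idPl; rewrite subr_ge0 ltW.
case: (leP r 2) => h2.
  constructor 2; rewrite e (ltW h); split=> //; split=> //.
  by apply/min_idPl; lra.
constructor 3; rewrite e (ltW h2); split=> //; split=> //.
by apply/min_idPr; lra.
Qed.

Lemma ramp_bound r : 0 <= ramp r <= 1.
Proof. by case: (excess_cases r) => -[h [h1 h2]]; rewrite h2; apply/andP; split; lra. Qed.

Lemma ramp_lipschitz a b : `|ramp a - ramp b| <= 1 * `|a - b|.
Proof.
rewrite mul1r; wlog ab : a b / a <= b.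
  by move=> h; case: (leP a b) => [|/ltW] /h //; rewrite distrC (distrC b).
rewrite distrC (distrC a) [leRHS]ger0_norm ?subr_ge0// ler_norml; apply/andP.
by case: (excess_cases a) => -[h1 [_ ->]]; case: (excess_cases b) => -[h2 [_ ->]]; split; lra.
Qed.

Lemma ramp1_bound r : 0 <= ramp1 r /\ ramp1 r <= `|r|.
Proof.
rewrite /ramp1; case: (excess_cases r) => -[h [-> ->]]; split; rewrite ?mul0r ?expr0n/= ?mul0r ?subr0//; try nra.
- by rewrite ger0_norm; nra.
- by rewrite ger0_norm; nra.
Qed.

Lemma ramp1_norm_le r : `|ramp1 r| <= `|r|.
Proof. by have [h1 h2] := ramp1_bound r; rewrite ger0_norm. Qed.

Lemma ramp1_taylor a b : `|ramp1 b - ramp1 a - ramp a * (b - a)| <= 1 * (b - a) ^+ 2.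
Proof.
rewrite mul1r /ramp1 ler_norml; apply/andP.
have s1 := sqr_ge0 (b - a); have s2 := sqr_ge0 (b - a - 1); have s3 := sqr_ge0 (b - a + 1).
case: (excess_cases a) => -[h1 [-> ->]]; case: (excess_cases b) => -[h2 [-> ->]]; split; nra.
Qed.

(** Convexity in the form of tangents, with ramp1 as the slope; this is how an
    Euler step uses it. *)
Lemma ramp2_convex a b : ramp2 a - ramp2 b <= ramp1 a * (a - b).
Proof.
rewrite /ramp2 /ramp1; have s1 := sqr_ge0 (a - b).
(* in each case the products are chosen so that the claim is a combination of
   them *)
have [x ->] : exists x, a = x + 1 by exists (a - 1); rewrite subrK.
have [y ->] : exists y, b = y + 1 by exists (b - 1); rewrite subrK.
case: (excess_cases (x + 1)) => -[h1 [-> ->]];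
  case: (excess_cases (y + 1)) => -[h2 [-> ->]]; rewrite ?addrK.
- by lra.
- have : 0 <= y ^+ 3 by rewrite exprn_ge0//; lra.
  by move=> ?; nra.
- have : 0 <= y * (y - 1) by rewrite mulr_ge0; lra.
  by move=> ?; nra.
- have : 0 <= x ^+ 2 * - y by rewrite mulr_ge0 ?sqr_ge0; lra.
  have : 0 <= x ^+ 3 by rewrite exprn_ge0//; lra.
  by move=> ? ?; nra.
- have : 0 <= (x - y) ^+ 2 * (2 * x + y) by rewrite mulr_ge0 ?sqr_ge0; lra.
  by move=> ?; nra.
- have : 0 <= (1 - x) ^+ 2 * (2 * x + 1) by rewrite mulr_ge0 ?sqr_ge0; lra.
  have : 0 <= (y - 1) * ((1 - x) * (1 + x)) by rewrite !mulr_ge0; lra.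
  have := sqr_ge0 (y - 1).
  by move=> ? ? ?; nra.
- have : 0 <= (x - 1) * x by rewrite mulr_ge0; lra.
  have : 0 <= (x - 1 / 2) * - y by rewrite mulr_ge0; lra.
  by move=> ? ?; nra.
- have : 0 <= (1 - y) ^+ 2 * (y + 2) by rewrite mulr_ge0 ?sqr_ge0; lra.
  have : 0 <= (x - 1) * (1 - y) by rewrite mulr_ge0; lra.
  have := sqr_ge0 (x - 1).
  by move=> ? ? ?; nra.
- by have := sqr_ge0 (x - y) => ?; nra.
Qed.

Lemma ramp2_eq0 r : r <= 1 -> ramp2 r = 0.
Proof.
rewrite /ramp2; case: (excess_cases r) => -[h [-> ->]] r1; try by lra.
by rewrite (_ : r = 1); lra.
Qed.

Lemma ramp2_ge0 r : 0 <= ramp2 r.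
Proof.
have := ramp2_convex 1 r; rewrite [ramp2 1]ramp2_eq0//.
rewrite (_ : ramp1 1 = 0) ?mul0r; first by lra.
by rewrite /ramp1; case: (excess_cases 1) => -[h [-> ->]]; lra.
Qed.

(** This is what makes the integral of ramp2 detect values above 1. *)
Lemma ramp2_gt1 r : 1 < r -> 0 < ramp2 r.
Proof.
rewrite /ramp2; case: (excess_cases r) => -[h [-> ->]] r1; first by lra.
  by have : 0 < (r - 1) ^+ 3 by [rewrite exprn_gt0// subr_gt0]; move=> ?; nra.
have : 0 <= (r - 2) * (r - 1) by rewrite mulr_ge0; lra.
by move=> ?; nra.
Qed.

Lemma ramp2_dist a b : `|ramp2 a - ramp2 b| <= `|a - b| * (`|a| + `|b|).
Proof.
have h x y : ramp2 x - ramp2 y <= `|x - y| * (`|x| + `|y|).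
  rewrite (le_trans (ramp2_convex x y))// (le_trans (ler_norm _))// normrM mulrC.
  by rewrite ler_wpM2l// (le_trans (ramp1_norm_le x))// lerDl.
by rewrite ler_norml lerNl opprB (addrC `|a|) (distrC a) !h /= distrC (addrC `|b|) h.
Qed.

Lemma measurable_excess : measurable_fun setT excess.
Proof. by apply: measurable_maxr => //; exact: measurable_funB. Qed.

Lemma measurable_ramp : measurable_fun setT ramp.
Proof. by apply: measurable_minr => //; exact: measurable_excess. Qed.

Lemma measurable_ramp1 : measurable_fun setT ramp1.
Proof.
have m1 := measurable_excess; have m2 := measurable_ramp.
by apply: measurable_funB; apply: measurable_funM => //; exact: measurable_funX.
Qed.

Lemma measurable_ramp2 : measurable_fun setT ramp2.
Proof.
have m1 := measurable_excess; have m2 := measurable_ramp.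
apply: measurable_funD; first apply: measurable_funB.
- by apply: measurable_funM => //; apply: measurable_funM => //; exact: measurable_funX.
- by apply: measurable_funM => //; apply: measurable_funM => //; exact: measurable_funX.
- by apply: measurable_funM => //; exact: measurable_funX.
Qed.

End truncation.

(** * Weak differentials and the energy *)

Section manifold_calculus.
Context (R : realType) (d : nat) (d_gt0 : (0 < d)%N) (M : lr_manifold R d).
Context (v : {measure set (borel M) -> \bar R}) (v_volume : volume_measure v).
Implicit Types a b : chart_index M.
Implicit Types (f h phi : M -> R) (w : chart_index M -> 'rV[R]_d -> 'rV[R]_d).
Let leb := lebesgue_rV R d.

(** The density is bounded below on a chart, so that square integrability for
    the volume implies it for Lebesgue measure. *)
Lemma L2_locally_sqint a f : L2 v f ->
  locally_sqint (interior (chart_image a)) (fun y => f (chart_inv a y)).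
Proof.
move=> /sqint_Lfun [mf If].
have mp := @measurable_pullback _ _ _ a f mf.
split.
- by apply: open_borel; exact: open_interior.
- by apply: measurable_funS mp; [exact: measurable_chart_image|exact: interior_subset].
move=> K cK KV; have [c [C [c0 hC]]] := density_bounds a.
have KI : K `<=` chart_image a by apply: subset_trans KV _; exact: interior_subset.
have mK : measurable (K : set (borel 'rV[R]_d)) := compact_borel cK.
have mi := measurable_chart_image a.
pose g (y : borel 'rV[R]_d) := (f (chart_inv a y) ^+ 2 * volume_density a y)%:E.
have mg : measurable_fun (chart_image a : set (borel 'rV[R]_d)) g.
  apply/measurable_EFinP; apply: measurable_funM; last exact: measurable_volume_density.
  exact: measurable_funX.
have g0 y : (0 <= g y)%E by rewrite lee_fin mulr_ge0 ?sqr_ge0 ?sqrtr_ge0.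
have mgK : measurable_fun (K : set (borel 'rV[R]_d)) g by exact: measurable_funS mg.
have mfK : measurable_fun (K : set (borel 'rV[R]_d)) (fun y : borel 'rV[R]_d => f (chart_inv a y)).
  exact: measurable_funS mp.
apply: (@le_lt_trans _ _ ((c^-1)%:E * \int[v]_x (f x ^+ 2)%:E)%E); last first.
  by rewrite lte_mul_pinfty// lee_fin invr_ge0 ltW.
apply: (@le_trans _ _ (\int[leb]_(y in K) ((c^-1)%:E * g y))%E).
  apply: ae_ge0_le_integral => //.
  - by move=> y _; rewrite lee_fin sqr_ge0.
  - by apply/measurable_EFinP; exact: measurable_funX.
  - by move=> y _; rewrite mule_ge0// lee_fin invr_ge0 ltW.
  - exact: measurable_funeM.
  apply: ae_imp hC => y hy Ky; have /andP[h1 _] := hy (KI _ Ky).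
  rewrite /g -EFinM lee_fin mulrCA -[leLHS]mulr1 ler_wpM2l ?sqr_ge0//.
  by rewrite ler_pdivlMl// mulr1.
rewrite ge0_integralZl//; last by rewrite lee_fin invr_ge0 ltW.
rewrite lee_pmul2l// ?lte_fin ?invr_gt0//.
apply: (@le_trans _ _ (\int[leb]_(y in chart_image a) g y)%E).
  by apply: ge0_subset_integral.
apply: (volume_integral_le v_volume a (g := fun x => f x ^+ 2)); first exact: measurable_funX.
by move=> x; exact: sqr_ge0.
Qed.

(** Test functions only see the interior of a chart image. What is left lies in
    the hyperplane bounding the half space. *)
Lemma chart_boundary_null a : {ae leb, forall y, chart_image a y -> interior (chart_image a) y}.
Proof.
have [oI|[W oW e]] := chart_image_open a.
  by apply: aeW => y; have /interior_id -> : open (chart_image a) by exact: oI.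
have ld : (d.-1 < d)%N by rewrite prednK.
pose l : 'I_d := Ordinal ld.
exists [set x : 'rV[R]_d | x 0 l = 0]; split; [|exact: lebesgue_rV_hyperplane|].
  rewrite -[X in measurable X]setTI.
  by have := measurable_borel_coord l measurableT (measurable_set1 0); apply.
move=> y /= /not_implyP[ya]; apply: contra_notP => y0.
have := ya; rewrite /chart_image e => -[Wy Hy].
have yl : 0 < y 0 l by rewrite lt_neqAle eq_sym Hy ?andbT ?prednK//; apply/eqP.
rewrite /interior.
apply: (@filterS _ (nbhs y) _ (W `&` [set z : 'rV[R]_d | 0 < z 0 l])).
  move=> z [Wz zl]; split=> // i id.
  suff -> : i = l by exact: ltW.
  by apply/val_inj; rewrite /= -[in RHS]id.
apply: filterI; first exact: open_nbhs_nbhs.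
apply: (@open_nbhs_nbhs 'rV[R]_d); split=> //.
apply: (@open_comp _ _ (fun z : 'rV[R]_d => z 0 l) [set r | 0 < r]); last exact: open_gt.
by move=> z _; exact: coord_continuous.
Qed.

Lemma one_form_locally_sqint a w i : one_form w -> locally_L2 (chart_image a) (w a) ->
  locally_sqint (interior (chart_image a)) (fun y => w a y 0 i).
Proof.
move=> [mw _] lw; have mi := measurable_chart_image a.
split.
- by apply: open_borel; exact: open_interior.
- by apply: measurable_funS (mw a i); [exact: mi|exact: interior_subset].
move=> K cK KV.
have KI : K `<=` chart_image a by apply: subset_trans KV _; exact: interior_subset.
have mK : measurable (K : set (borel 'rV[R]_d)) := compact_borel cK.
have mwK j : measurable_fun (K : set (borel 'rV[R]_d)) (fun y : borel 'rV[R]_d => w a y 0 j).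
  by apply: measurable_funS (mw a j).
apply: le_lt_trans (lw K cK KI); apply: ge0_le_integral => //.
- by move=> y _; rewrite lee_fin sqr_ge0.
- by apply/measurable_EFinP; exact: measurable_funX.
- apply/measurable_EFinP; rewrite (_ : (fun y => _) = (fun y => \sum_j w a y 0 j ^+ 2)); last first.
    by apply/funext => y; rewrite bilin1E.
  by apply: measurable_sum => j; exact: measurable_funX.
- move=> y _; rewrite lee_fin bilin1E (bigD1 i)//= lerDl sumr_ge0// => j _; exact: sqr_ge0.
Qed.

Lemma test_integral_interior a (g eta : 'rV[R]_d -> R) K :
  K `<=` interior (chart_image a) -> (forall x, ~ K x -> eta x = 0) ->
  \int[leb]_(x in chart_image a) (g x * eta x) =
  \int[leb]_(x in interior (chart_image a)) (g x * eta x).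
Proof.
move=> KV hK.
rewrite (@Rintegral_mul_support _ (borel 'rV[R]_d) R leb (interior (chart_image a)) K g eta KV hK).
apply: (@Rintegral_mul_support _ (borel 'rV[R]_d) R leb (chart_image a) K g eta) => //.
by apply: subset_trans KV _; exact: interior_subset.
Qed.

Lemma weak_differential_interior a f w i (eta : 'rV[R]_d -> R) : weak_differential f w ->
  test_function (interior (chart_image a)) eta ->
  \int[leb]_(x in interior (chart_image a)) (f (chart_inv a x) * 'D_(delta_mx 0 i) eta x) =
  - \int[leb]_(x in interior (chart_image a)) (w a x 0 i * eta x).
Proof.
move=> [_ /(_ a)[_ h]] te; have [K [cK KV] hK] := test_function_support te.
have hD := vanish_off_partial i cK hK.
rewrite -(@test_integral_interior a (fun x => w a x 0 i) eta K KV hK).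
rewrite -(@test_integral_interior a (fun x => f (chart_inv a x)) _ K KV hD).
exact: h.
Qed.

(** The fundamental lemma in the interior; the boundary is null. *)
Lemma weak_differential_unique a f w w' : weak_differential f w -> weak_differential f w' ->
  {ae leb, forall y, chart_image a y -> w a y = w' a y}.
Proof.
move=> dw dw'; set V := interior (chart_image a).
have lw i : locally_sqint V (fun y => w a y 0 i).
  by apply: one_form_locally_sqint; [case: dw|case: dw => _ /(_ a)[]].
have lw' i : locally_sqint V (fun y => w' a y 0 i).
  by apply: one_form_locally_sqint; [case: dw'|case: dw' => _ /(_ a)[]].
have h i : {ae leb, forall y, V y -> w a y 0 i - w' a y 0 i = 0}.
  have li := locally_sqint_integrable (lw i); have li' := locally_sqint_integrable (lw' i).
  apply: fundamental_lemma; first exact: open_interior.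
    split=> [|K cK KV].
      by apply: measurable_funB; [case: li|case: li'].
    rewrite (_ : _ \o _ = ((fun y => (w a y 0 i)%:E) \- (fun y => (w' a y 0 i)%:E))%E)//.
    have [_ i1] := li; have [_ i2] := li'.
    by apply: integrableB; [exact: compact_borel|exact: i1|exact: i2].
  move=> eta te; have [K [cK KV] hK] := test_function_support te.
  have e1 := weak_differential_interior i dw te; have e2 := weak_differential_interior i dw' te.
  have E : \int[leb]_(x in V) (w a x 0 i * eta x) = \int[leb]_(x in V) (w' a x 0 i * eta x).
    by apply/oppr_inj; rewrite -e1 -e2.
  have [seta _ _] := te; have meta := smooth_measurable seta.
  have [B B0 hB] := vanish_off_bounded cK (smooth_continuous seta) hK.
  have I1 := integrable_mul_bounded measurableT (locally_integrable_patch li cK KV) meta (fun x _ => hB x).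
  have I2 := integrable_mul_bounded measurableT (locally_integrable_patch li' cK KV) meta (fun x _ => hB x).
  move: E.
  rewrite (@Rintegral_mul_support _ (borel 'rV[R]_d) R leb V K (fun x => w a x 0 i) eta KV hK).
  rewrite (@Rintegral_mul_support _ (borel 'rV[R]_d) R leb V K (fun x => w' a x 0 i) eta KV hK).
  rewrite (@Rintegral_mul_support _ (borel 'rV[R]_d) R leb V K (fun x => w a x 0 i - w' a x 0 i) eta KV hK).
  move=> /eqP; rewrite -subr_eq0 -RintegralB// => /eqP E; rewrite -[RHS]E.
  apply: eq_Rintegral => x _; rewrite -mulrBl; congr (_ * _).
  by rewrite !patchE; case: ifP; rewrite ?subrr.
have hall : {ae leb, forall y, forall i, V y -> w a y 0 i - w' a y 0 i = 0}.
  have hc : countable [set: 'I_d] by exact: countableP.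
  have := ae_countable hc (fun i _ => h i).
  by apply: ae_imp => y hy i; exact: hy.
apply: ae_imp2 (chart_boundary_null a) hall => y hb hy ya; apply/rowP => i.
by apply/eqP; rewrite -subr_eq0; apply/eqP/hy/hb.
Qed.

End manifold_calculus.

Section bilinear.
Context (R : realType) (n : nat).

Lemma bilinZ (A : 'M[R]_n) (c1 c2 : R) x y :
  bilin A (c1 *: x) (c2 *: y) = c1 * c2 * bilin A x y.
Proof. by rewrite /bilin linearZ /= -!scalemxAl -scalemxAr scalerA mxE. Qed.

Lemma bilin_invmx_ge0 (A : 'M[R]_n) x : scalar_product A -> 0 <= bilin (invmx A) x x.
Proof.
move=> [sA pA]; have uA : A \in unitmx.
  rewrite unitmxE unitfE; apply/negP => /det0P[z z0 zA].
  by have := pA z z0; rewrite /bilin zA mul0mx mxE ltxx.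
have -> : bilin (invmx A) x x = bilin A (x *m invmx A) (x *m invmx A).
  by rewrite /bilin mulmxKV// trmx_mul trmx_inv sA mulmxA.
have [->|z0] := eqVneq (x *m invmx A) 0; first by rewrite /bilin !mul0mx mxE.
exact/ltW/pA.
Qed.

End bilinear.

Lemma Rintegral_ae_ge0 d (T : measurableType d) (R : realType) (mu : {measure set T -> \bar R})
    (f : T -> R) : measurable_fun setT f -> {ae mu, forall x, 0 <= f x} -> 0 <= \int[mu]_x f x.
Proof.
move=> mf f0; rewrite /Rintegral.
rewrite (@ae_eq_integral _ _ _ mu setT (fun x => (`|f x|)%:E) (EFin \o f))//.
- by rewrite fine_ge0// integral_ge0// => x _; rewrite lee_fin.
- exact/measurable_EFinP.
- by apply/measurable_EFinP; exact: measurableT_comp.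
- by apply: ae_imp f0 => x h _; rewrite ger0_norm.
Qed.

Section chain_rule_manifold.
Context (R : realType) (d : nat) (d_gt0 : (0 < d)%N) (M : lr_manifold R d).
Context (v : {measure set (borel M) -> \bar R}) (v_volume : volume_measure v).
Implicit Types a b : chart_index M.
Implicit Types (f h phi : M -> R) (w : chart_index M -> 'rV[R]_d -> 'rV[R]_d).
Let leb := lebesgue_rV R d.

Definition ramp_form f w : chart_index M -> 'rV[R]_d -> 'rV[R]_d :=
  fun a y => ramp (f (chart_inv a y)) *: w a y.

Lemma L2_measurable f : L2 v f -> measurable_fun setT (f : borel M -> R).
Proof. by move=> /sqint_Lfun []. Qed.

Lemma ramp_form_one_form f w : measurable_fun setT (f : borel M -> R) ->
  one_form w -> one_form (ramp_form f w).
Proof.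
move=> mf [mw cw]; split=> [a i|a b].
  rewrite (_ : (fun x => _) = (fun y => ramp (f (chart_inv a y)) * w a y 0 i)); last first.
    by apply/funext => y; rewrite mxE.
  apply: measurable_funM => //.
  have mp := @measurable_pullback _ _ _ a f mf.
  exact: (measurableT_comp (@measurable_ramp R) mp).
apply: ae_imp (cw a b) => y h oy; rewrite /ramp_form h// -scalemxAl; congr (ramp (f _) *: _).
by case: oy => x [xb xa] <-; rewrite /transition /= chartK// chartK.
Qed.

(** The chain rule in each chart; multiplication by ramp(f) respects the
    transformation rule of 1-forms. *)
Lemma weak_differential_ramp f w : L2 v f -> weak_differential f w ->
  weak_differential (fun x => ramp1 (f x)) (ramp_form f w).
Proof.
move=> f2 dw; have mf := L2_measurable f2; have [ow lw] := dw.
have oR := ramp_form_one_form mf ow.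
split=> // a; split.
  move=> K cK KI; have mK : measurable (K : set (borel 'rV[R]_d)) := compact_borel cK.
  have mi := measurable_chart_image a.
  have [mw _] := ow; have [mr _] := oR.
  have mq (u : chart_index M -> 'rV[R]_d -> 'rV[R]_d) :
      (forall i, measurable_fun (chart_image a : set (borel 'rV[R]_d)) (fun y : borel 'rV[R]_d => u a y 0 i)) ->
      measurable_fun (K : set (borel 'rV[R]_d)) (fun y : borel 'rV[R]_d => (bilin 1%:M (u a y) (u a y))%:E).
    move=> mu; apply/measurable_EFinP; rewrite (_ : (fun y => _) = (fun y => \sum_j u a y 0 j ^+ 2)); last first.
      by apply/funext => y; rewrite bilin1E.
    by apply: measurable_sum => j; apply: measurable_funX; apply: measurable_funS (mu j).
  apply: le_lt_trans ((lw a).1 K cK KI); apply: ge0_le_integral => //.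
  - by move=> y _; rewrite lee_fin bilin1_ge0.
  - by apply: mq => i; exact: mr.
  - by apply: mq => i; exact: mw.
  - move=> y _; rewrite lee_fin bilinZ -expr2 -[leRHS]mul1r ler_wpM2r ?bilin1_ge0//.
    by have /andP[h1 h2] := ramp_bound (f (chart_inv a y)); rewrite expr_le1.
move=> eta i te; have [K [cK KV] hK] := test_function_support te.
have hD := vanish_off_partial i cK hK.
rewrite (@test_integral_interior _ _ _ a (fun x => ramp_form f w a x 0 i) eta K KV hK).
rewrite (@test_integral_interior _ _ _ a (fun x => ramp1 (f (chart_inv a x))) _ K KV hD).
have lf := L2_locally_sqint v_volume a f2.
have lwi := one_form_locally_sqint i ow (lw a).1.
rewrite (weak_partial_chain (Lip := 1) (@open_interior _ _) lf lwi _ _ (@measurable_ramp1 R) (@measurable_ramp R))//.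
- by congr (- _); apply: eq_Rintegral => x _; rewrite mxE.
- by move=> eta' te'; exact: weak_differential_interior.
- exact: ramp1_norm_le.
- by move=> r; have /andP[h1 h2] := ramp_bound r; rewrite ger0_norm.
- exact: ramp_lipschitz.
- exact: ramp1_taylor.
Qed.

(** The two differentials of f behind G agree almost everywhere, and the
    co-metric is nonnegative. *)
Lemma grad_dot_ge0 f G : is_grad_dot f f G -> {ae v, forall x, 0 <= G x}.
Proof.
move=> [mG [wf [wh [df dh hG]]]]; apply: (ae_chart v_volume) => a.
apply: ae_imp2 (hG a) (weak_differential_unique d_gt0 a df dh) => y h1 h2 ya.
rewrite h1// h2// bilin_invmx_ge0//; exact: metric_scalar_product.
Qed.

(** The squared norm of d(ramp1 f) is ramp(f)^2 times that of df. *)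
Lemma W12_ramp f : W12 v f -> W12 v (fun x => ramp1 (f x)).
Proof.
move=> [f2 [G gG IG]]; have mf := L2_measurable f2; split.
  apply/sqint_Lfun; apply: le_sqint (proj1 (sqint_Lfun v f) f2) => [|x]; last exact: ramp1_norm_le.
  by apply: measurableT_comp => //; exact: measurable_ramp1.
have G0 := grad_dot_ge0 gG; have [mG [wf [wh [df dh hG]]]] := gG.
have mr : measurable_fun setT (fun x : borel M => ramp (f x)).
  by apply: measurableT_comp => //; exact: measurable_ramp.
have mH : measurable_fun setT (fun x : borel M => ramp (f x) ^+ 2 * `|G x|).
  by apply: measurable_funM; [exact: measurable_funX|exact: measurableT_comp].
(* G is nonnegative only almost everywhere *)
exists (fun x => ramp (f x) ^+ 2 * `|G x|).
  split=> //; exists (ramp_form f wf), (ramp_form f wh); split; [exact: weak_differential_ramp..|].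
  move=> a.
  apply: ae_imp2 (hG a) (weak_differential_unique d_gt0 a df dh) => y h1 h2 ya.
  rewrite bilinZ -expr2 h1// h2//; congr (_ * _).
  by rewrite ger0_norm// bilin_invmx_ge0//; exact: metric_scalar_product.
apply: le_lt_trans IG.
rewrite (@ae_eq_integral _ _ _ v setT (fun x => (`|G x|)%:E) (EFin \o G))//.
- apply: ge0_le_integral => //.
  + by move=> x _; rewrite lee_fin mulr_ge0 ?sqr_ge0.
  + exact/measurable_EFinP.
  + by apply/measurable_EFinP; exact: measurableT_comp.
  + move=> x _; rewrite lee_fin -[leRHS]mul1r ler_wpM2r//.
    by have /andP[h1 h2] := ramp_bound (f x); rewrite expr_le1.
- exact/measurable_EFinP.
- by apply/measurable_EFinP; exact: measurableT_comp.
- by apply: ae_imp G0 => x h _ /=; rewrite ger0_norm.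
Qed.

(** Where f has no gradient product, the chosen one is 0. *)
Lemma energy_ge0 f : 0 <= energy v f f.
Proof.
rewrite /energy mulr_ge0//; rewrite /grad_dot; case: xgetP => [G _ gG|_].
  by apply: Rintegral_ae_ge0; [case: gG|exact: grad_dot_ge0 gG].
by apply: Rintegral_ge0.
Qed.

(** The gradient product of f and ramp1(f) is ramp(f) |df|^2. *)
Lemma energy_ramp_ge0 f : L2 v f -> 0 <= energy v f (fun x => ramp1 (f x)).
Proof.
move=> f2; rewrite /energy mulr_ge0//; rewrite /grad_dot; case: xgetP => [G _ gG|_]; last by apply: Rintegral_ge0.
have [mG [wf [wh [df dh hG]]]] := gG; apply: Rintegral_ae_ge0 => //.
apply: (ae_chart v_volume) => a.
have dr := weak_differential_ramp f2 df.
apply: ae_imp2 (hG a) (weak_differential_unique d_gt0 a dh dr) => y h1 h2 ya.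
rewrite h1// h2// -[X in bilin _ X]scale1r bilinZ mul1r mulr_ge0//.
  by have /andP[] := ramp_bound (f (chart_inv a y)).
by apply: bilin_invmx_ge0; exact: metric_scalar_product.
Qed.

(** ramp1(f) is an admissible test function, and the pairing is -E(f, ramp1
    f). *)
Lemma half_laplacian_dissipative f h : half_laplacian v f h ->
  \int[v]_x (h x * ramp1 (f x)) <= 0.
Proof.
move=> [wf _ hE]; have wr := W12_ramp wf.
by rewrite -oppr_ge0 -hE//; apply: energy_ramp_ge0; case: wf.
Qed.

End chain_rule_manifold.

(** * Regularity and symmetry of the heat kernel *)

Section kernel_regularity.
Context (R : realType) (d : nat) (M : lr_manifold R d).
Context (v : {sigma_finite_measure set (borel M) -> \bar R}) (v_volume : volume_measure v).
Context (p : R -> M -> M -> R) (hk : heat_kernel v p).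
Implicit Types a b : chart_index M.

Lemma near_chart a (x : M) (del : R) : chart_dom a x -> 0 < del ->
  exists V, [/\ open V, V x, V `<=` chart_dom a & forall x', V x' -> `|chart a x' - chart a x| < del].
Proof.
move=> xa del0; exists (chart_dom a `&` chart a @^-1` ball (chart a x) del); split.
- by apply: open_chart_preimage; exact: ball_open.
- by split=> //; exact: ballxx.
- by move=> z [].
- by move=> z [_ /=]; rewrite -ball_normE /= distrC.
Qed.

(** Joint continuity, with a product neighbourhood, read off from the local
    Hoelder estimate. *)
Lemma kernel_near t x y e : 0 < t -> 0 < e ->
  exists (del : R) (V W : set M), [/\ 0 < del, open V /\ V x, open W /\ W y &
    forall t' x' y', `|t' - t| < del -> V x' -> W y' -> `|p t' x' y' - p t x y| < e].
Proof.
move=> t0 e0; have [a xa] := chart_cover x; have [b yb] := chart_cover y.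
have [U [C [gam [nU /andP[gam0 _] hU]]]] := heat_kernel_hoelder hk t0 xa yb.
case: (nU) => -[A B] /= [nA nB] AB.
case: nB => -[B1 B2] /= [nB1 nB2] BB.
have Utxy : U (t, (x, y)) by exact: nbhs_singleton nU.
have /nbhs_ballP[r /= r0 rA] := nA.
pose e' := e / (`|C| + 1).
have C1 : 0 < `|C| + 1 by rewrite ltr_wpDl.
have e'0 : 0 < e' by rewrite divr_gt0.
pose h := e' `^ gam^-1.
have h0 : 0 < h by rewrite powR_gt0.
have h30 : 0 < h / 3 by rewrite divr_gt0.
have [V [oV Vx _ hV]] := near_chart xa h30.
have [W [oW Wy _ hW]] := near_chart yb h30.
exists (Num.min r (h / 3)), (V `&` interior B1), (W `&` interior B2); split.
- by rewrite lt_min r0.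
- by split; [apply: openI => //; exact: open_interior|split].
- by split; [apply: openI => //; exact: open_interior|split].
move=> t' x' y' + [Vx' Bx'] [Wy' By']; rewrite lt_min => /andP[tr th].
have Uz : U (t', (x', y')).
  apply: AB; split=> /=; first by apply: rA; rewrite -ball_normE /= distrC.
  by apply: BB; split; exact: interior_subset.
apply: le_lt_trans (hU _ _ _ _ _ _ Uz Utxy) _.
set S := _ + _ + _; have S0 : 0 <= S by rewrite !addr_ge0.
have Sh : S < h.
  by rewrite /S; have := hV _ Vx'; have := hW _ Wy'; move: th; lra.
have Se : S `^ gam < e'.
  have := gt0_ltr_powR gam0 (_ : S \is Num.nneg) (_ : h \is Num.nneg) Sh.
  rewrite !nnegrE S0 (ltW h0) => /(_ isT isT).
  by rewrite /h -powRrM mulVf ?gt_eqF// powRr1 ?(ltW e'0).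
rewrite (@le_lt_trans _ _ ((`|C| + 1) * S `^ gam))//.
  by rewrite ler_wpM2r ?powR_ge0// (le_trans (ler_norm _))// lerDl.
by rewrite -ltr_pdivlMl// mulrC.
Qed.

(** The extension by 0 to nonpositive times is defined on a full product
    space. *)
Definition kernel0 (z : measurableTypeR R * borel M * borel M) : R :=
  if 0 < z.1.1 then p z.1.1 z.1.2 z.2 else 0.

Lemma kernel0E t x y : 0 < t -> kernel0 (t, x, y) = p t x y.
Proof. by rewrite /kernel0 /= => ->. Qed.

Lemma kernel0_ge0 z : 0 <= kernel0 z.
Proof. by rewrite /kernel0; case: ifP => // t0; rewrite ltW// (heat_kernel_gt0 hk). Qed.

(** The set is open, but measurability is for the product of the Borel
    sigma-algebras. Since M is second countable, the set is a countable union
    of open rectangles. *)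
Lemma measurable_kernel_gt (r : R) :
  measurable [set z : measurableTypeR R * borel M * borel M | 0 < z.1.1 /\ r < p z.1.1 z.1.2 z.2].
Proof.
have [B /countable_injP[f fi] [Bo Bb]] := manifold_second_countable M.
pose box (q : rat * rat) (V W : set M) : set (measurableTypeR R * borel M * borel M) :=
  [set z | ratr q.1 < z.1.1 < ratr q.2 /\ (V z.1.2 /\ W z.2)].
set S := [set z | _].
pose U i : set M := \bigcup_(V in [set V | B V /\ f V = i]) V.
have Uf V : B V -> U (f V) = V.
  move=> BV; apply/seteqP; split=> [x [V' [BV' fV'] V'x]|x Vx]; last by exists V.
  by have <- : V' = V by apply: fi; rewrite ?inE.
have oU i : open (U i) by apply: bigcup_open => V [BV _]; exact: Bo.
pose F k : set (measurableTypeR R * borel M * borel M) :=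
  if unpickle k is Some (q, i, j) then
    (if `[< box q (U i) (U j) `<=` S >] then box q (U i) (U j) else set0)
  else set0.
have -> : S = \bigcup_k F k.
  apply/seteqP; split => [[[t x] y] /= [t0 rp]|z [k _]]; last first.
    rewrite /F; case: unpickle => //= -[[q i] j].
    by case: asboolP => // sub; exact: sub.
  rewrite /= in t0 rp.
  have e0 : 0 < p t x y - r by rewrite subr_gt0.
  have [del [V [W [del0 [oV Vx] [oW Wy] hp]]]] := kernel_near x y t0 e0.
  have [V' [BV' V'x] V'V] := Bb x V (open_nbhs_nbhs (conj oV Vx)).
  have [W' [BW' W'y] W'W] := Bb y W (open_nbhs_nbhs (conj oW Wy)).
  have t1 : Num.max 0 (t - del) < t by rewrite gt_max t0 ltrBlDr ltrDl.
  have t2 : t < t + del by rewrite ltrDl.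
  have [q1] := rat_in_itvoo t1; rewrite in_itv/= gt_max => /andP[/andP[q10 q1d] q1t].
  have [q2] := rat_in_itvoo t2; rewrite in_itv/= => /andP[tq2 q2d].
  have [k Ek] : exists k, unpickle k = Some ((q1, q2), f V', f W').
    by eexists; exact: pickleK.
  apply: (ex_intro2 _ _ k I).
  rewrite /F Ek (Uf _ BV') (Uf _ BW') asboolT; first by rewrite /box /= q1t tq2.
  move=> [[t' x'] y'] [/= /andP[h1 h2] [Vx' Wy']]; rewrite /S /=.
  have td : `|t' - t| < del by rewrite ltr_norml; apply/andP; split; lra.
  have := hp _ _ _ td (V'V _ Vx') (W'W _ Wy'); rewrite ltr_norml => /andP[h3 _].
  by split; [exact: lt_trans h1|lra].
apply: bigcupT_measurable => k; rewrite /F; case: unpickle => //= -[[q i] j].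
case: asboolP => // _.
rewrite (_ : box _ _ _ = (`]ratr q.1, ratr q.2[%classic `*` U i) `*` U j); last first.
  by apply/seteqP; split=> [[[t x] y] /= [h [h1 h2]]|[[t x] y] /= [[h h1] h2]]; move: h; rewrite in_itv.
by apply: measurableX; [apply: measurableX => //|]; exact: open_borel.
Qed.

Lemma measurable_kernel0 : measurable_fun setT kernel0.
Proof.
apply: (@measurability _ _ _ _ _ _ _ (RGenOInfty.measurableE R)) => _ [_ [r ->] <-].
rewrite setTI.
have m0 : measurable [set z : measurableTypeR R * borel M * borel M | 0 < z.1.1].
  rewrite (_ : [set _ | _] = (`]0%R, +oo[%classic `*` setT) `*` setT).
    by apply: measurableX => //; exact: measurableX.
  by apply/seteqP; split=> [[[t x] y] /= h|[[t x] y] /= [[h _] _]]; move: h; rewrite in_itv/= andbT.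
rewrite (_ : _ @^-1` _ =
  [set z | 0 < z.1.1 /\ r < p z.1.1 z.1.2 z.2] `|` (if r < 0 then ~` [set z | 0 < z.1.1] else set0)).
  apply: measurableU; first exact: measurable_kernel_gt.
  by case: ifP => // _; exact: measurableC.
apply/seteqP; split=> [[[t x] y]|[[t x] y]]; rewrite /kernel0 /= in_itv/= andbT.
  by case: ifPn => [t0 h|t0 ->]; [left|right; apply/negP].
case=> [[-> //]|]; case: ifPn => // r0 /negP/negbTE -> //.
Qed.

End kernel_regularity.

Lemma ae_le_Rintegral d (T : measurableType d) (R : realType) (mu : {measure set T -> \bar R})
    (f g : T -> R) : mu.-integrable setT (EFin \o f) -> mu.-integrable setT (EFin \o g) ->
  {ae mu, forall x, f x <= g x} -> \int[mu]_x f x <= \int[mu]_x g x.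
Proof.
move=> If Ig fg; rewrite -subr_ge0 -RintegralB//; apply: Rintegral_ae_ge0.
  have /measurable_EFinP mf := measurable_int _ If; have /measurable_EFinP mg := measurable_int _ Ig.
  exact: measurable_funB.
by apply: ae_imp fg => x; rewrite subr_ge0.
Qed.

Lemma ae_eq_Rintegral d (T : measurableType d) (R : realType) (mu : {measure set T -> \bar R})
    (f g : T -> R) : measurable_fun setT f -> measurable_fun setT g ->
  {ae mu, forall x, f x = g x} -> \int[mu]_x f x = \int[mu]_x g x.
Proof.
move=> mf mg fg; rewrite /Rintegral; congr fine.
apply: ae_eq_integral => //; try exact/measurable_EFinP.
by apply: ae_imp fg => x -> _.
Qed.

Section kernel_symmetry.
Context (R : realType) (d : nat) (M : lr_manifold R d).
Context (v : {sigma_finite_measure set (borel M) -> \bar R}) (v_volume : volume_measure v).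
Context (p : R -> M -> M -> R) (hk : heat_kernel v p).
Context (P : R -> (M -> R) -> M -> R) (hP : heat_flow v P).
Hypothesis PE : forall t f, 0 < t -> L2 v f ->
  {ae v, forall x, (P t f x)%:E = (\int[v]_y (p t x y * f y)%:E)%E}.

Lemma kernel_gt0 t x y : 0 < t -> 0 < p t x y.
Proof. exact: heat_kernel_gt0 hk _ _ _. Qed.

Lemma kernel_ge0 t x y : 0 < t -> 0 <= p t x y.
Proof. by move=> t0; exact/ltW/kernel_gt0. Qed.

Lemma measurable_kernel_snd t x : 0 < t -> measurable_fun setT (fun y : borel M => p t x y).
Proof.
move=> t0; rewrite (_ : (fun y => _) = kernel0 p \o (fun y : borel M => (t, x, y))); last first.
  by apply/funext => y; rewrite /= kernel0E.
have mk := @measurable_kernel0 _ _ _ _ _ hk.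
apply: (measurableT_comp mk); exact: measurable_fun_pair.
Qed.

Lemma sqint_flow t f : 0 <= t -> L2 v f -> sqint v (P t f).
Proof. by move=> t0 f2; apply/sqint_Lfun; exact: heat_flow_L2. Qed.

Lemma flow_ge0 t f : 0 < t -> L2 v f -> (forall x, 0 <= f x) -> {ae v, forall x, 0 <= P t f x}.
Proof.
move=> t0 f2 f0; apply: ae_imp (PE t0 f2) => x h; rewrite -lee_fin h.
by apply: integral_ge0 => y _; rewrite lee_fin mulr_ge0// kernel_ge0.
Qed.

Lemma kernel_integral_indic t x (A : set (borel M)) : 0 < t -> measurable A ->
  (\int[v]_y (p t x y * \1_A y)%:E = \int[v]_(y in A) (p t x y)%:E)%E.
Proof.
move=> t0 mA; rewrite [RHS]integral_mkcond; apply: eq_integral => y _.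
by rewrite patchE indicE; case: ifP; rewrite ?mulr1 ?mulr0.
Qed.

Lemma L2_indic (A : set (borel M)) : measurable A -> (v A < +oo)%E -> L2 v (\1_A).
Proof. by move=> mA fA; apply/sqint_Lfun; exact: sqint_indic. Qed.

(* the pairing is the integral of the kernel over A x B *)
Let pairing_ge t (A B : set (borel M)) (c : R) : 0 < t -> measurable A -> measurable B ->
  (v A < +oo)%E -> (v B < +oo)%E -> 0 <= c -> (forall x y, A x -> B y -> c <= p t x y) ->
  c * fine (v B) * fine (v A) <= \int[v]_x (P t \1_B x * \1_A x).
Proof.
move=> t0 mA mB fA fB c0 hc; have B2 := L2_indic mB fB.
have sA := sqint_indic mA fA.
rewrite -(Rintegral_indic_fine v mA) -RintegralZl//; last exact: integrable_indic_fin.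
apply: ae_le_Rintegral.
- rewrite (_ : _ \o _ = (fun x => (c * fine (v B))%:E * (\1_A x)%:E)%E)//.
  by apply: integrableZl => //; exact: integrable_indic_fin.
- by apply: sqint_mul => //; apply: sqint_flow => //; exact: ltW.
apply: ae_imp (PE t0 B2) => x h; rewrite indicE; case: (boolP (x \in A)) => [/set_mem Ax|_]; rewrite ?mulr0// !mulr1.
rewrite -lee_fin h kernel_integral_indic// EFinM fineK ?ge0_fin_numE//.
rewrite -[(c%:E * _)%E](@integral_cst _ _ _ v B mB).
apply: ge0_le_integral => //.
- by apply/measurable_EFinP; apply: measurable_funTS; exact: measurable_kernel_snd.
- by move=> y By; rewrite lee_fin hc.
Qed.

Let pairing_le t (A B : set (borel M)) (c : R) : 0 < t -> measurable A -> measurable B ->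
  (v A < +oo)%E -> (v B < +oo)%E -> 0 <= c -> (forall x y, A x -> B y -> p t x y <= c) ->
  \int[v]_x (P t \1_B x * \1_A x) <= c * fine (v B) * fine (v A).
Proof.
move=> t0 mA mB fA fB c0 hc; have B2 := L2_indic mB fB.
have sA := sqint_indic mA fA.
rewrite -(Rintegral_indic_fine v mA) -RintegralZl//; last exact: integrable_indic_fin.
apply: ae_le_Rintegral.
- by apply: sqint_mul => //; apply: sqint_flow => //; exact: ltW.
- rewrite (_ : _ \o _ = (fun x => (c * fine (v B))%:E * (\1_A x)%:E)%E)//.
  by apply: integrableZl => //; exact: integrable_indic_fin.
apply: ae_imp (PE t0 B2) => x h; rewrite indicE; case: (boolP (x \in A)) => [/set_mem Ax|_]; rewrite ?mulr0// !mulr1.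
rewrite -lee_fin h kernel_integral_indic// EFinM fineK ?ge0_fin_numE//.
rewrite -[(c%:E * _)%E](@integral_cst _ _ _ v B mB).
apply: ge0_le_integral => //.
- by move=> y _; rewrite lee_fin kernel_ge0.
- by apply/measurable_EFinP; apply: measurable_funTS; exact: measurable_kernel_snd.
- by move=> y By; rewrite lee_fin hc.
Qed.

(** The flow is symmetric. If p t a b exceeded p t b a, pairing indicators of
    small neighbourhoods of a and b, where the kernel is nearly constant, would
    contradict that. *)
Lemma kernel_sym t x y : 0 < t -> p t x y = p t y x.
Proof.
move=> t0; suff h a b : p t a b <= p t b a by apply/eqP; rewrite eq_le !h.
rewrite leNgt; apply/negP => lt; pose e := (p t a b - p t b a) / 3.
have e0 : 0 < e by rewrite divr_gt0// subr_gt0.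
have [del1 [V1 [W1 [d1 [oV1 V1a] [oW1 W1b] h1]]]] := kernel_near hk a b t0 e0.
have [del2 [W2 [V2 [d2 [oW2 W2b] [oV2 V2a] h2]]]] := kernel_near hk b a t0 e0.
have [V3 [oV3 V3a fV3]] := volume_locally_finite v_volume a.
have [W3 [oW3 W3b fW3]] := volume_locally_finite v_volume b.
pose V := V1 `&` V2 `&` V3; pose W := W1 `&` W2 `&` W3.
have oV : open V by do 2 apply: openI => //.
have oW : open W by do 2 apply: openI => //.
have mV : measurable (V : set (borel M)) by exact: open_borel.
have mW : measurable (W : set (borel M)) by exact: open_borel.
have V0 : (0 < v V)%E by apply: (volume_open_gt0 v_volume) => //; exists a.
have W0 : (0 < v W)%E by apply: (volume_open_gt0 v_volume) => //; exists b.
have fV : (v V < +oo)%E.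
  apply: le_lt_trans fV3; apply: le_measure; rewrite ?inE//; first exact: open_borel.
  by move=> z [].
have fW : (v W < +oo)%E.
  apply: le_lt_trans fW3; apply: le_measure; rewrite ?inE//; first exact: open_borel.
  by move=> z [].
have dist0 r : 0 < r -> `|t - t| < r by rewrite subrr normr0.
have p0 := kernel_gt0 b a t0.
have e3 : e * 3 = p t a b - p t b a by rewrite /e divfK.
have L := @pairing_ge t V W (p t a b - e) t0 mV mW fV fW.
have U := @pairing_le t W V (p t b a + e) t0 mW mV fW fV.
have {}L : (p t a b - e) * fine (v W) * fine (v V) <= \int[v]_x (P t \1_W x * \1_V x).
  apply: L; first by lra.
  move=> z1 z2 [[Vz1 _] _] [[Wz2 _] _].
  by have := h1 t z1 z2 (dist0 _ d1) Vz1 Wz2; rewrite ltr_norml => /andP[]; lra.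
have {}U : \int[v]_x (P t \1_V x * \1_W x) <= (p t b a + e) * fine (v V) * fine (v W).
  apply: U; first by lra.
  move=> z1 z2 [[_ Wz1] _] [[_ Vz2] _].
  by have := h2 t z1 z2 (dist0 _ d2) Wz1 Vz2; rewrite ltr_norml => /andP[]; lra.
have S := heat_flow_symmetric hP (ltW t0) (L2_indic mW fW) (L2_indic mV fV).
have E : \int[v]_x (\1_W x * P t \1_V x) = \int[v]_x (P t \1_V x * \1_W x).
  by apply: eq_Rintegral => z _; rewrite mulrC.
rewrite S E in L; have := le_trans L U.
rewrite -mulrA -(mulrA (p t b a + e)) (mulrC (fine (v W))) ler_pM2r; first by lra.
by rewrite mulr_gt0// fine_gt0// ?V0 ?W0.
Qed.

End kernel_symmetry.

(** * The flow decreases the integral of the convex truncation *)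

Section ramp_integral.
Context dT (T : measurableType dT) (R : realType) (mu : {measure set T -> \bar R}).
Implicit Types f g : T -> R.

Lemma sqint_norm f : sqint mu f -> sqint mu (fun x => `|f x|).
Proof.
move=> sf; have [mf _] := sf; apply: le_sqint sf; first exact: measurableT_comp.
by move=> x; rewrite normr_id.
Qed.

Lemma Rintegral_sqrD_le f g : sqint mu f -> sqint mu g ->
  \int[mu]_x (f x + g x) ^+ 2 <= 2 * \int[mu]_x (f x ^+ 2) + 2 * \int[mu]_x (g x ^+ 2).
Proof.
move=> sf sg; rewrite Rintegral_sqrD//.
have h := Rintegral_sqr_ge0 mu (fun x => f x - g x).
have e := Rintegral_sqrD sf (sqintZ (-1) sg).
have e1 : \int[mu]_x (f x + -1 * g x) ^+ 2 = \int[mu]_x (f x - g x) ^+ 2.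
  by apply: eq_Rintegral => x _; rewrite mulN1r.
have e2 : \int[mu]_x (f x * (-1 * g x)) = - \int[mu]_x (f x * g x).
  have -> : \int[mu]_x (f x * (-1 * g x)) = \int[mu]_x (-1 * (f x * g x)).
    by apply: eq_Rintegral => x _; rewrite mulrCA.
  by rewrite RintegralZl ?mulN1r//; exact: sqint_mul.
have e3 : \int[mu]_x (-1 * g x) ^+ 2 = \int[mu]_x (g x ^+ 2).
  by apply: eq_Rintegral => x _; rewrite mulN1r sqrrN.
by move: h e; rewrite -e1 e2 e3; lra.
Qed.

Lemma integrable_ramp2 f : sqint mu f -> mu.-integrable setT (fun x => (ramp2 (f x))%:E).
Proof.
move=> sf; have [mf _] := sf; apply: le_integrable (sqint_integrable sf) => //.
  by apply/measurable_EFinP; apply: measurableT_comp => //; exact: measurable_ramp2.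
move=> x _; rewrite /= lee_fin; have := ramp2_dist (f x) 0.
rewrite [ramp2 0]ramp2_eq0// !subr0 normr0 addr0 => h.
by rewrite normrX expr2.
Qed.

(** Continuity of the functional in L^2: the slope of ramp2 at r is at most
    |r|. *)
Lemma ramp2_integral_dist f g : sqint mu f -> sqint mu g ->
  `|\int[mu]_x ramp2 (f x) - \int[mu]_x ramp2 (g x)| <=
  Num.sqrt (\int[mu]_x (f x - g x) ^+ 2) *
  Num.sqrt (2 * \int[mu]_x (f x ^+ 2) + 2 * \int[mu]_x (g x ^+ 2)).
Proof.
move=> sf sg; have sfg := sqintB sf sg.
have sa := sqint_norm sfg; have sn := sqintD (sqint_norm sf) (sqint_norm sg).
have i1 := integrable_ramp2 sf; have i2 := integrable_ramp2 sg.
rewrite -RintegralB//; apply: le_trans (le_normr_Rintegral _ _) _ => //.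
  exact: (integrableB measurableT i1 i2).
apply: (@le_trans _ _ (\int[mu]_x (`|f x - g x| * (`|f x| + `|g x|)))).
  apply: le_Rintegral => //.
  - have h : mu.-integrable setT (fun x => (ramp2 (f x) - ramp2 (g x))%:E) by exact: (integrableB measurableT i1 i2).
    exact: (integrable_norm h).
  - exact: sqint_mul.
  - by move=> x _; exact: ramp2_dist.
apply: le_trans (ler_norm _) _; apply: le_trans (cauchy_schwarz sa sn) _.
have e : \int[mu]_x (`|f x - g x| ^+ 2) = \int[mu]_x ((f x - g x) ^+ 2).
  by apply: eq_Rintegral => x _; rewrite real_normK ?num_real.
have e1 : \int[mu]_x (`|f x| ^+ 2) = \int[mu]_x (f x ^+ 2).
  by apply: eq_Rintegral => x _; rewrite real_normK ?num_real.
have e2 : \int[mu]_x (`|g x| ^+ 2) = \int[mu]_x (g x ^+ 2).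
  by apply: eq_Rintegral => x _; rewrite real_normK ?num_real.
rewrite e ler_wpM2l ?sqrtr_ge0// ler_wsqrtr// -e1 -e2.
by apply: Rintegral_sqrD_le; exact: sqint_norm.
Qed.

End ramp_integral.

Section euler_steps.
Context (R : realType) (d : nat) (d_gt0 : (0 < d)%N) (M : lr_manifold R d).
Context (v : {measure set (borel M) -> \bar R}) (v_volume : volume_measure v).
Context (P : R -> (M -> R) -> M -> R) (hP : heat_flow v P).
Implicit Types (f g h u k : M -> R) (s t c : R).

Let m_comp (phi : R -> R) f : measurable_fun setT phi -> L2 v f ->
  measurable_fun setT (fun x : borel M => phi (f x)).
Proof. by move=> mphi /L2_measurable mf; exact: measurableT_comp. Qed.

Let sq f : L2 v f -> sqint v f. Proof. by move/sqint_Lfun. Qed.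
Let L2P t f : 0 <= t -> L2 v f -> L2 v (P t f). Proof. exact: heat_flow_L2. Qed.
Let L2_lin c f g : L2 v f -> L2 v g -> L2 v (fun x => c * f x + g x).
Proof. by move=> /sq f2 /sq g2; apply/sqint_Lfun; apply: sqintD => //; exact: sqintZ. Qed.

Lemma flow_linear2 t a b f g : 0 <= t -> L2 v f -> L2 v g ->
  {ae v, forall x, P t (fun y => a * f y + b * g y) x = a * P t f x + b * P t g x}.
Proof.
move=> t0 f2 g2; pose g' := fun y => (b - 1) * g y + g y.
have g'2 : L2 v g' by exact: L2_lin.
have e : (fun y => b * g y) = g' by apply/funext => y; rewrite /g'; ring.
have -> : (fun y => a * f y + b * g y) = (fun y => a * f y + g' y).
  by apply/funext => y; rewrite -e.
apply: ae_imp2 (heat_flow_linear hP a t0 f2 g'2) (heat_flow_linear hP (b - 1) t0 g2 g2).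
by move=> x -> ->; ring.
Qed.

Lemma flow_commute s t f : 0 <= s -> 0 <= t -> L2 v f ->
  {ae v, forall x, P t (P s f) x = P s (P t f) x}.
Proof.
move=> s0 t0 f2.
apply: ae_imp2 (heat_flow_semigroup hP s0 t0 f2) (heat_flow_semigroup hP t0 s0 f2) => x.
by rewrite addrC => -> ->.
Qed.

(** The flow commutes with difference quotients, and a contraction does not
    enlarge their deviation from k. With k = A u this carries the domain of the
    generator into itself, with k = P t (A u) it controls an Euler step. *)
Lemma flow_quotient s t u k : 0 <= s -> 0 < t -> L2 v u -> L2 v k ->
  {ae v, forall x, (P t (P s u) x - P s u x) / t - P s k x =
     P s (fun y => (P t u y - u y) / t - k y) x}.
Proof.
move=> s0 t0 u2 k2; have Pu2 := L2P (ltW t0) u2.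
pose q := fun y => t^-1 * P t u y + (- t^-1) * u y.
have q2 : L2 v q.
  by apply/sqint_Lfun; apply: sqintD; apply: sqintZ; exact: sq.
have -> : (fun y => (P t u y - u y) / t - k y) = (fun y => 1 * q y + (-1) * k y).
  by apply/funext => y; rewrite /q; ring.
have a := ae_and (flow_linear2 1 (-1) s0 q2 k2) (flow_linear2 t^-1 (- t^-1) s0 Pu2 u2).
by apply: ae_imp2 (flow_commute s0 (ltW t0) u2) a => x -> [-> ->]; ring.
Qed.

Lemma L2_quotient t u k : 0 < t -> L2 v u -> L2 v k -> L2 v (fun y => (P t u y - u y) / t - k y).
Proof.
move=> t0 u2 k2; apply/sqint_Lfun; apply: sqintB; last exact: sq.
rewrite (_ : (fun x => _) = (fun x => t^-1 * (P t u x - u x))); last first.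
  by apply/funext => x; rewrite mulrC.
by apply: sqintZ; apply: sqintB; apply: sq => //; apply: L2P => //; exact: ltW.
Qed.

Lemma half_laplacian_flow s u h : 0 <= s -> half_laplacian v u h ->
  half_laplacian v (P s u) (P s h).
Proof.
move=> s0 uh; have [[u2 _] h2 _] := uh.
apply/(heat_flow_generator hP (L2P s0 u2) (L2P s0 h2)).
have h0 := proj1 (heat_flow_generator hP u2 h2) uh.
apply: (@squeeze_cvgr _ _ _ _ (fun=> 0) (fun t => sqr_dist v (fun x => (P t u x - u x) / t) h)) h0.
- near=> t; have t0 : 0 < t by near: t; exact: nbhs_right_gt.
  rewrite Rintegral_sqr_ge0 /=.
  have q2 := L2_quotient t0 u2 h2.
  apply: le_trans (heat_flow_contraction hP s0 q2).
  rewrite le_eqVlt; apply/orP; left; apply/eqP; apply: ae_eq_Rintegral.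
  + apply: measurable_funX; apply: L2_measurable; apply: L2_quotient => //; exact: L2P.
  + by apply: measurable_funX; apply: L2_measurable; exact: L2P.
  + by apply: ae_imp (flow_quotient s0 t0 u2 h2) => x ->.
- exact: cvg_cst.
Unshelve. all: by end_near.
Qed.

(* the deviation of the difference quotient from the generator at the end of
   the step *)
Let D t u h := fun y => (P t u y - u y) / t - P t h y.
Let nrm f := Num.sqrt (\int[v]_x (f x ^+ 2)).

(** A backward Euler step. With y = P s u, z = P (s + t) u and q = P s (D t u
    h) one has z - y = t (A z + q), so by convexity the increment of the
    functional is at most t int ramp1(z) (A z + q). The term in A z is
    nonpositive by [half_laplacian_dissipative], and the other one is bounded
    independently of s because P s and P (s + t) are contractions. *)
Lemma euler_step s t u h : 0 <= s -> 0 < t -> half_laplacian v u h ->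
  \int[v]_x ramp2 (P (s + t) u x) - \int[v]_x ramp2 (P s u x) <= t * (nrm u * nrm (D t u h)).
Proof.
move=> s0 t0 uh; have [[u2 _] h2 _] := uh.
have st0 : 0 <= s + t by rewrite addr_ge0// ltW.
have hz := half_laplacian_flow st0 uh.
have z2 := L2P st0 u2; have y2 := L2P s0 u2; have hh2 := L2P (ltW t0) h2; have Az2 := L2P st0 h2.
have D2 := L2_quotient t0 u2 hh2; have q2 := L2P s0 D2.
set z := P (s + t) u; set y := P s u; set Az := P (s + t) h; set q := P s _ in q2.
have ae1 : {ae v, forall x, z x - y x = t * (q x + Az x)}.
  have a1 := flow_quotient s0 t0 u2 hh2; have a2 := heat_flow_semigroup hP s0 (ltW t0) h2.
  have a3 := heat_flow_semigroup hP s0 (ltW t0) u2; have a4 := flow_commute s0 (ltW t0) u2.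
  apply: ae_imp2 (ae_and a1 a2) (ae_and a3 a4) => x [e1 e2] [e3 e4].
  rewrite /z /y /Az e2 e3 -e4 /q -e1.
  by field; rewrite gt_eqF.
have sF : sqint v (fun x => ramp1 (z x)).
  apply: le_sqint (sq z2) => [|x]; last exact: ramp1_norm_le.
  by apply: m_comp => //; exact: measurable_ramp1.
have i1 := integrable_ramp2 (sq z2); have i2 := integrable_ramp2 (sq y2).
have i3 := sqint_mul (sq q2) sF; have i4 := sqint_mul (sq Az2) sF.
rewrite -RintegralB//.
apply: (@le_trans _ _ (\int[v]_x (t * (q x * ramp1 (z x)) + t * (Az x * ramp1 (z x))))).
  apply: ae_le_Rintegral.
  - exact: (integrableB measurableT i1 i2).
  - have j3 := integrableZl measurableT t i3; have j4 := integrableZl measurableT t i4.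
    exact: (integrableD measurableT j3 j4).
  apply: ae_imp ae1 => x e; apply: le_trans (ramp2_convex _ _) _.
  by rewrite e le_eqVlt; apply/orP; left; apply/eqP; ring.
rewrite RintegralD//; [|exact: (integrableZl measurableT t i3)|exact: (integrableZl measurableT t i4)].
rewrite !RintegralZl// -mulrDr ler_pM2l//.
have neg := half_laplacian_dissipative d_gt0 v_volume hz.
apply: (@le_trans _ _ (\int[v]_x (q x * ramp1 (z x)))).
  by rewrite gerDl.
apply: le_trans (ler_norm _) _; apply: le_trans (cauchy_schwarz (sq q2) sF) _.
rewrite mulrC; apply: ler_pM; rewrite ?sqrtr_ge0//; apply: ler_wsqrtr.
  apply: le_trans (heat_flow_contraction hP st0 u2).
  apply: le_Rintegral => //; [exact: sqint_integrable|exact: sqint_integrable (sq z2)|].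
  by move=> x _; rewrite -ler_sqrt ?sqr_ge0// !sqrtr_sqr ramp1_norm_le.
exact: heat_flow_contraction.
Qed.

Lemma euler_steps (n : nat) t u h : 0 < t -> half_laplacian v u h ->
  \int[v]_x ramp2 (P (n%:R * t) u x) <=
  \int[v]_x ramp2 (u x) + n%:R * t * (nrm u * nrm (D t u h)).
Proof.
move=> t0 uh; have [[u2 _] h2 _] := uh.
elim: n => [|k ih].
  rewrite !mul0r addr0 le_eqVlt; apply/orP; left; apply/eqP; apply: ae_eq_Rintegral.
  - by apply: m_comp; [exact: measurable_ramp2|exact: L2P].
  - by apply: m_comp => //; exact: measurable_ramp2.
  - by apply: ae_imp (heat_flow_0 hP u2) => x ->.
have kt0 : 0 <= k%:R * t by rewrite mulr_ge0// ltW.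
have := euler_step kt0 t0 uh.
rewrite (_ : k%:R * t + t = k.+1%:R * t); last by rewrite -natr1; ring.
by rewrite -natr1; lra.
Qed.

Lemma quotient_cvg0 u h : half_laplacian v u h ->
  \int[v]_x (D t u h x ^+ 2) @[t --> 0^'+] --> 0.
Proof.
move=> uh; have [[u2 _] h2 _] := uh.
have c1 := proj1 (heat_flow_generator hP u2 h2) uh.
have c2 := heat_flow_continuous hP h2.
have c : 2 * sqr_dist v (fun x => (P t u x - u x) / t) h + 2 * sqr_dist v (P t h) h @[t --> 0^'+] --> 0.
  have k2 : (fun=> 2 : R) @ (0 : R)^'+ --> (2 : R) by exact: cvg_cst.
  by have := cvgD (cvgM k2 c1) (cvgM k2 c2); rewrite mulr0 addr0; apply.
apply: (squeeze_cvgr _ (cvg_cst 0) c).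
near=> t; have t0 : 0 < t by near: t; exact: nbhs_right_gt.
rewrite Rintegral_sqr_ge0 /= /sqr_dist.
have s1 := sq (L2_quotient t0 u2 h2).
have s2 := sqintZ (-1) (sqintB (sq (L2P (ltW t0) h2)) (sq h2)).
have e : \int[v]_x (-1 * (P t h x - h x)) ^+ 2 = \int[v]_x (P t h x - h x) ^+ 2.
  by apply: eq_Rintegral => x _; rewrite mulN1r sqrrN.
rewrite -e; apply: le_trans (Rintegral_sqrD_le s1 s2).
rewrite le_eqVlt; apply/orP; left; apply/eqP; apply: eq_Rintegral => x _.
by rewrite /D; congr (_ ^+ 2); ring.
Unshelve. all: by end_near.
Qed.

(** The errors of n Euler steps of length t / n add up to t times a quantity
    that tends to 0 with the length. *)
Lemma ramp2_flow_domain t u h : 0 < t -> half_laplacian v u h ->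
  \int[v]_x ramp2 (P t u x) <= \int[v]_x ramp2 (u x).
Proof.
move=> t0 uh; apply/ler_addgt0Pr => e e0.
have c : t * (nrm u * nrm (D s u h)) @[s --> 0^'+] --> 0.
  have k1 : (fun=> t) @ (0 : R)^'+ --> t by exact: cvg_cst.
  have k2 : (fun=> nrm u) @ (0 : R)^'+ --> nrm u by exact: cvg_cst.
  have k3 : nrm (D s u h) @[s --> 0^'+] --> Num.sqrt 0.
    by apply: (cvg_comp _ _ (quotient_cvg0 uh)); exact: sqrt_continuous.
  by have := cvgM k1 (cvgM k2 k3); rewrite sqrtr0 !mulr0; apply.
have /cvgrPdist_lt/(_ e e0) := c.
move=> [r /= r0 hr].
pose n := (Num.truncn (t / r)).+1.
have n0 : 0 < n%:R :> R by [].
have tn0 : 0 < t / n%:R by rewrite divr_gt0.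
have tnr : t / n%:R < r.
  by rewrite ltr_pdivrMr// -ltr_pdivrMl// mulrC truncnS_gt.
have := hr (t / n%:R); rewrite /ball_ /= !sub0r !normrN (gtr0_norm tn0) => /(_ tnr tn0) h1.
have := euler_steps n tn0 uh.
rewrite (mulrC n%:R) divfK ?gt_eqF//.
move: h1 => /ltr_normlW h1; lra.
Qed.

End euler_steps.

(** * Time averages and the density of the domain *)

Section time_average.
Context (R : realType) (d : nat) (M : lr_manifold R d).
Context (v : {sigma_finite_measure set (borel M) -> \bar R}).
Context (p : R -> M -> M -> R) (hk : heat_kernel v p).
Context (P : R -> (M -> R) -> M -> R) (hP : heat_flow v P).
Hypothesis PE : forall t f, 0 < t -> L2 v f ->
  {ae v, forall x, (P t f x)%:E = (\int[v]_y (p t x y * f y)%:E)%E}.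
Implicit Types (f g : M -> R).
Let L : {sigma_finite_measure set (measurableTypeR R) -> \bar R} := @lebesgue_measure R.
Let I (a : R) : set R := `]0, a]%classic.

Definition flow_pairing f g s : R := \int[v]_x (P s f x * g x).

Let mI a : measurable_fun setT (\1_(I a) : measurableTypeR R -> R).
Proof. by apply: measurable_indic; exact: measurable_itv. Qed.

Let nrm g : R := Num.sqrt (\int[v]_x (g x ^+ 2)).
Let sq g : L2 v g -> sqint v g. Proof. by move/sqint_Lfun. Qed.

Lemma flow_pairing_bound g h s : 0 <= s -> L2 v g -> L2 v h ->
  `|flow_pairing g h s| <= nrm g * nrm h.
Proof.
move=> s0 g2 h2; have Pg := heat_flow_L2 hP s0 g2.
apply: le_trans (cauchy_schwarz (sq Pg) (sq h2)) _.
rewrite ler_wpM2r ?sqrtr_ge0// ler_wsqrtr//; exact: heat_flow_contraction.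
Qed.

Lemma integral_indic_oc (b : R) : 0 < b -> (\int[L]_s (\1_(I b) s)%:E = b%:E)%E.
Proof.
move=> b0; rewrite (@integral_indic _ _ _ L setT measurableT (I b)); last exact: measurable_itv.
by rewrite setIT [LHS]lebesgue_measure_itv/= lte_fin b0 -EFinB subr0.
Qed.

(** The average of P s f over s is built from the kernel: for each s, P s f is
    only defined up to a null set, whereas the kernel is measurable in time and
    space together. *)
Variables (f : M -> R) (f2 : L2 v f) (f0 : forall x, 0 <= f x) (a : R) (a0 : 0 < a).

Let K (z : measurableTypeR R * borel M) : \bar R := (\int[v]_y (kernel0 p (z, y) * f y)%:E)%E.

Let K0 z : (0 <= K z)%E.
Proof. by apply: integral_ge0 => y _; rewrite lee_fin mulr_ge0// (kernel0_ge0 hk). Qed.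

Let mK : measurable_fun setT K.
Proof.
have mk := @measurable_kernel0 _ _ _ _ _ hk; have mf := L2_measurable f2.
apply: (@measurable_fun_fubini_tonelli_F _ _ _ _ _ v (fun z => (kernel0 p z * f z.2)%:E)).
  apply/measurable_EFinP; apply: measurable_funM => //.
  exact: (measurableT_comp mf measurable_snd).
by move=> z; rewrite lee_fin mulr_ge0// (kernel0_ge0 hk).
Qed.

Let KE s : 0 < s -> {ae v, forall x, K (s, x) = (P s f x)%:E}.
Proof.
move=> s0; apply: ae_imp (PE s0 f2) => x ->.
by apply: eq_integral => y _; rewrite kernel0E.
Qed.

Let U0 (x : borel M) : \bar R := (\int[L]_s ((\1_(I a) s)%:E * K (s, x)))%E.

Let mIK : measurable_fun setT (fun z : measurableTypeR R * borel M => ((\1_(I a) z.1)%:E * K z)%E).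
Proof.
apply: emeasurable_funM => //; apply/measurable_EFinP.
exact: (measurableT_comp (@mI a) measurable_fst).
Qed.

Let mU0 : measurable_fun setT U0.
Proof.
apply: (@measurable_fun_fubini_tonelli_G _ _ _ _ _ L _ mIK).
by move=> z; rewrite mule_ge0.
Qed.

Let U00 x : (0 <= U0 x)%E.
Proof. by apply: integral_ge0 => s _; rewrite mule_ge0. Qed.

Let pairing g : L2 v g -> (forall x, 0 <= g x) ->
  (\int[v]_x ((g x)%:E * U0 x) = \int[L]_s (\1_(I a) s * flow_pairing f g s)%:E)%E /\
  measurable_fun setT (fun s : measurableTypeR R => \1_(I a) s * flow_pairing f g s).
Proof.
move=> g2 g0; have mg := L2_measurable g2.
pose H (z : measurableTypeR R * borel M) : \bar R := ((g z.2)%:E * ((\1_(I a) z.1)%:E * K z))%E.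
have mH : measurable_fun setT H.
  apply: emeasurable_funM => //; apply/measurable_EFinP.
  exact: (measurableT_comp mg measurable_snd).
have H0 z : (0 <= H z)%E by rewrite /H !mule_ge0// lee_fin.
have HE s : (\int[v]_x H (s, x) = (\1_(I a) s * flow_pairing f g s)%:E)%E.
  rewrite /H /= indicE; have [/set_mem Is|_] := boolP (s \in I a); last first.
    by rewrite mul0r integral0_eq// => x _; rewrite mul0e mule0.
  have /andP[s0 _] : 0 < s <= a by move: Is; rewrite /I /= in_itv.
  rewrite mul1r /flow_pairing.
  have Ps2 := heat_flow_L2 hP (ltW s0) f2.
  have ig : v.-integrable setT (fun x => (P s f x * g x)%:E).
    by apply: sqint_mul; apply/sqint_Lfun.
  rewrite /Rintegral fineK ?integral_fune_fin_num//.
  apply: ae_eq_integral => //.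
  - apply: emeasurable_funM; first exact/measurable_EFinP.
    under eq_fun do rewrite mul1e.
    exact: (@measurable_fun_pair2 _ _ _ _ _ _ K s mK).
  - exact: measurable_int ig.
  - by apply: ae_imp (KE s0) => x h _; rewrite h mul1e -EFinM mulrC.
split.
  under [RHS]eq_integral do rewrite -HE.
  rewrite (@fubini_tonelli _ _ _ _ R L v H mH H0); apply: eq_integral => x _.
  rewrite -ge0_integralZl//.
  - exact: (@measurable_fun_pair1 _ _ _ _ _ _ _ x mIK).
  - by move=> s _; rewrite mule_ge0.
  - by rewrite lee_fin.
apply/measurable_EFinP; rewrite (_ : _ \o _ = fun s => (\int[v]_x H (s, x))%E); last first.
  by apply/funext => s; rewrite HE.
exact: (@measurable_fun_fubini_tonelli_F _ _ _ _ _ v _ mH H0).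
Qed.

Let pairing_le g : L2 v g -> (forall x, 0 <= g x) ->
  (\int[v]_x ((g x)%:E * U0 x) <= (a * (nrm f * nrm g))%:E)%E.
Proof.
move=> g2 g0; have [-> mg] := pairing g2 g0.
have -> : (a * (nrm f * nrm g))%:E = ((nrm f * nrm g)%:E * \int[L]_s (\1_(I a) s)%:E)%E.
  by rewrite integral_indic_oc// -EFinM mulrC.
rewrite -ge0_integralZl//.
- apply: ge0_le_integral => //.
  + move=> s _; rewrite lee_fin indicE; have [/set_mem Is|_] := boolP (s \in I a); last by rewrite mul0r.
    have /andP[s0 _] : 0 < s <= a by move: Is; rewrite /I /= in_itv.
    rewrite mul1r; apply: Rintegral_ae_ge0.
      have Ps2 := heat_flow_L2 hP (ltW s0) f2.
      by apply: measurable_funM; [exact: (L2_measurable Ps2)|exact: (L2_measurable g2)].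
    by apply: ae_imp (flow_ge0 hk PE s0 f2 f0) => x h; rewrite mulr_ge0.
  + exact/measurable_EFinP.
  + by apply: emeasurable_funM => //; exact/measurable_EFinP.
  + move=> s _; rewrite -EFinM lee_fin indicE; have [/set_mem Is|_] := boolP (s \in I a); last by rewrite mul0r mulr0.
    have /andP[s0 _] : 0 < s <= a by move: Is; rewrite /I /= in_itv.
    by rewrite mul1r mulr1 (le_trans (ler_norm _))// flow_pairing_bound// ltW.
- exact/measurable_EFinP.
- by rewrite lee_fin mulr_ge0 ?sqrtr_ge0.
Qed.

Let U (x : M) : R := fine (U0 x).

Let U_ge0 x : 0 <= U x. Proof. exact: fine_ge0. Qed.

Let mU : measurable_fun setT (U : borel M -> R).
Proof. by apply: (measurableT_comp _ mU0). Qed.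

(* U is not known to be square integrable in advance; its truncations to sets
   of finite measure are, and pairing them with U bounds their norms
   uniformly *)
Let U_L2 : L2 v U.
Proof.
apply/sqint_Lfun; split=> //.
have /sigma_finiteP[F [FT ndF mF]] := sigma_finiteT v.
pose g n (x : M) : R := Num.min (U x) n%:R * \1_(F n) x.
have g0 n x : 0 <= g n x by rewrite /g mulr_ge0// le_min U_ge0 ler0n.
have mg n : measurable_fun setT (g n : borel M -> R).
  apply: measurable_funM; first exact: measurable_minr.
  by apply: measurable_indic; case: (mF n).
have gU n x : g n x <= U x.
  rewrite /g indicE -[leRHS]mulr1 ler_pM ?le_min ?U_ge0 ?ler0n ?lern1 ?leq_b1//.
  by rewrite ge_min lexx.
have g2 n : L2 v (g n).
  have [mFn Fn] := mF n.
  apply/sqint_Lfun; apply: le_sqint (sqintZ n%:R (sqint_indic mFn Fn)) => // x.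
  rewrite (ger0_norm (g0 n x)) ger0_norm ?mulr_ge0// /g ler_wpM2r//.
  by rewrite ge_min lexx orbT.
have bnd n : (\int[v]_x (g n x ^+ 2)%:E <= ((a * nrm f) ^+ 2)%:E)%E.
  have i2 := sqint_integrable (sq (g2 n)).
  have eE : (\int[v]_x (g n x ^+ 2)%:E = (\int[v]_x (g n x ^+ 2))%:E)%E.
    by rewrite /Rintegral fineK// integral_fune_fin_num.
  rewrite eE lee_fin; set e := \int[v]_x _.
  have e0 : 0 <= e by exact: Rintegral_sqr_ge0.
  have : (e%:E <= (a * (nrm f * nrm (g n)))%:E)%E.
    rewrite -eE; apply: le_trans (pairing_le (g2 n) (g0 n)).
    apply: ge0_le_integral => //.
    - by move=> x _; rewrite lee_fin sqr_ge0.
    - by apply/measurable_EFinP; exact: measurable_funX.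
    - by apply: emeasurable_funM => //; exact/measurable_EFinP.
    - move=> x _; rewrite expr2 EFinM lee_wpmul2l ?lee_fin//.
      apply: (@le_trans _ _ (U x)%:E); first by rewrite lee_fin.
      by rewrite /U; case: (U0 x) (U00 x) => //= r _; rewrite leey.
  rewrite lee_fin /nrm -/e mulrA; apply: le_sqr_of_sqrt => //.
  by rewrite mulr_ge0 ?sqrtr_ge0// ltW.
have c := @cvg_monotone_convergence _ _ _ v _ measurableT (fun n x => (g n x ^+ 2)%:E).
have {}c : (\int[v]_x (g n x ^+ 2)%:E)%E @[n --> \oo] --> (\int[v]_x (U x ^+ 2)%:E)%E.
  rewrite [X in _ --> X](_ : _ = (\int[v]_x limn (fun n => (g n x ^+ 2)%:E))%E).
    apply: c.
    - by move=> n; apply/measurable_EFinP; exact: measurable_funX.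
    - by move=> n x _; rewrite lee_fin sqr_ge0.
    - move=> x _ m n mn; rewrite lee_fin lerXn2r ?nnegrE ?g0// /g ler_pM ?le_min ?U_ge0 ?ler0n//.
        by rewrite !ge_min lexx /= ler_nat mn orbT.
      rewrite !indicE ler_nat; case: (boolP (x \in F m)) => // /set_mem Fx.
      by rewrite mem_set//; move: x Fx; exact/subsetPset/ndF.
  apply: eq_integral => x _; apply/esym/cvg_lim => //.
  have [m _ Fm] : (\bigcup_k F k) x by rewrite -FT.
  have Un : \forall n \near \oo, U x <= n%:R by exact: nbhs_infty_ger.
  apply: cvg_near_cst; near=> n; congr (_ ^+ 2)%:E.
  rewrite /g indicE mem_set ?mulr1; last first.
    have mn : (m <= n)%N by near: n; exact: nbhs_infty_ge.
    by have /subsetPset/(_ x Fm) := ndF _ _ mn.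
  by apply/min_idPl; near: n.
apply: (@le_lt_trans _ _ (((a * nrm f) ^+ 2)%:E)%E); last by rewrite ltry.
by apply: (cvge_le _ c); exact: nearW.
Unshelve. all: by end_near.
Qed.

Let U0E : {ae v, forall x, U0 x = (U x)%:E}.
Proof.
have /sigma_finiteP[F [FT ndF mF]] := sigma_finiteT v.
have h n : {ae v, forall x, F n x -> U0 x \is a fin_num}.
  have [mFn Fn] := mF n.
  apply: integrable_ae => //; apply/integrableP; split; first exact: measurable_funTS.
  under eq_integral do rewrite gee0_abs//.
  have s1 := L2_indic mFn Fn.
  apply: le_lt_trans (_ : _ <= (a * (nrm f * nrm (\1_(F n))))%:E)%E _; last by rewrite ltry.
  apply: le_trans (pairing_le s1 _); last by move=> x; rewrite indicE.
  rewrite integral_mkcond le_eqVlt; apply/orP; left; apply/eqP; apply: eq_integral => x _.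
  by rewrite patchE indicE; case: ifP; rewrite ?mul1e ?mul0e.
apply: ae_imp (ae_foralln h) => x hx.
have [m _ Fm] : (\bigcup_k F k) x by rewrite -FT.
by rewrite /U fineK// (hx m).
Qed.

Let U_pairing_ge0 g : L2 v g -> (forall x, 0 <= g x) ->
  L.-integrable setT (fun s => (\1_(I a) s * flow_pairing f g s)%:E) /\
  \int[v]_x (U x * g x) = \int[L]_s (\1_(I a) s * flow_pairing f g s).
Proof.
move=> g2 g0; have [e mg] := pairing g2 g0; split.
  have iI : L.-integrable setT (fun s => (\1_(I a) s)%:E).
    apply/integrableP; split; first exact/measurable_EFinP.
    by under eq_integral do rewrite /= ger0_norm//; rewrite integral_indic_oc// ltry.
  apply: le_integrable (integrableZl measurableT (nrm f * nrm g) iI) => //.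
    exact/measurable_EFinP.
  move=> s _; rewrite /= lee_fin indicE; have [/set_mem Is|_] := boolP (s \in I a); last by rewrite mul0r mulr0.
  have /andP[s0 _] : 0 < s <= a by move: Is; rewrite /I /= in_itv.
  rewrite mul1r mulr1 (le_trans (flow_pairing_bound (ltW s0) f2 g2))//.
  by rewrite ler_norm.
rewrite /Rintegral -e; congr fine; apply: ae_eq_integral => //.
- by apply/measurable_EFinP; apply: measurable_funM => //; exact: (L2_measurable g2).
- by apply: emeasurable_funM => //; apply/measurable_EFinP; exact: (L2_measurable g2).
- by apply: ae_imp U0E => x -> _; rewrite -EFinM mulrC.
Qed.

(** The average is only needed through its pairings, which are the averages of
    the pairings. *)
Lemma flow_time_average : exists2 U, L2 v U & forall g, L2 v g ->
  L.-integrable setT (fun s => (\1_(I a) s * flow_pairing f g s)%:E) /\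
  \int[v]_x (U x * g x) = \int[L]_s (\1_(I a) s * flow_pairing f g s).
Proof.
exists U => // g g2; have mg := L2_measurable g2.
pose gp x := Num.max (g x) 0; pose gn x := Num.max (- g x) 0.
have gp2 : L2 v gp.
  apply/sqint_Lfun; apply: le_sqint (sq g2) => [|x]; first exact: measurable_maxr.
  by rewrite /gp; case: (leP (g x) 0); rewrite ?normr0.
have gn2 : L2 v gn.
  apply/sqint_Lfun; apply: le_sqint (sq g2) => [|x].
    by apply: measurable_maxr => //; exact: measurableT_comp.
  by rewrite /gn; case: (leP (- g x) 0); rewrite ?normr0 ?normrN.
have gE x : g x = gp x - gn x.
  by rewrite /gp /gn; case: (leP (g x) 0) => ?; case: (leP (- g x) 0) => ?; lra.
have gp0 x : 0 <= gp x by rewrite /gp le_max lexx orbT.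
have gn0 x : 0 <= gn x by rewrite /gn le_max lexx orbT.
have [i1 e1] := U_pairing_ge0 gp2 gp0; have [i2 e2] := U_pairing_ge0 gn2 gn0.
have E s : \1_(I a) s * flow_pairing f g s =
    \1_(I a) s * flow_pairing f gp s - \1_(I a) s * flow_pairing f gn s.
  rewrite indicE; have [/set_mem Is|_] := boolP (s \in I a); last by rewrite !mul0r subrr.
  have /andP[s0 _] : 0 < s <= a by move: Is; rewrite /I /= in_itv.
  have Ps2 := heat_flow_L2 hP (ltW s0) f2.
  have j1 := sqint_mul (sq Ps2) (sq gp2); have j2 := sqint_mul (sq Ps2) (sq gn2).
  rewrite !mul1r /flow_pairing -RintegralB//; apply: eq_Rintegral => x _.
  by rewrite gE mulrBr.
have EE : (fun s => (\1_(I a) s * flow_pairing f g s)%:E) =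
   ((fun s => (\1_(I a) s * flow_pairing f gp s)%:E) \- (fun s => (\1_(I a) s * flow_pairing f gn s)%:E))%E.
  by apply/funext => s; rewrite E.
split; first by rewrite EE; exact: integrableB.
have j1 := sqint_mul (sq U_L2) (sq gp2); have j2 := sqint_mul (sq U_L2) (sq gn2).
have -> : (fun s => \1_(I a) s * flow_pairing f g s) =
    (fun s => \1_(I a) s * flow_pairing f gp s - \1_(I a) s * flow_pairing f gn s).
  by apply/funext => s; exact: E.
rewrite [RHS](RintegralB measurableT i1 i2) -e1 -e2 -RintegralB//.
by apply: eq_Rintegral => x _; rewrite gE mulrBr.
Qed.

End time_average.

Section line_integrals.
Context (R : realType).
Let L : {sigma_finite_measure set (measurableTypeR R) -> \bar R} := @lebesgue_measure R.
Let I (a : R) : set R := `]0, a]%classic.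

Let m_shift (c : R) : measurable_fun [set: measurableTypeR R] (fun x : measurableTypeR R => x + c : measurableTypeR R).
Proof. exact: measurable_funD. Qed.

Let ge0_shift (c : R) (F : measurableTypeR R -> \bar R) : measurable_fun setT F -> (forall x, 0 <= F x)%E ->
  (\int[L]_x F (x + c)%R = \int[L]_x F x)%E.
Proof.
move=> mF F0; rewrite -[LHS](ge0_integral_pushforward (m_shift c) _ measurableT)//.
apply: eq_measure_integral => D mD _.
exact: lebesgue_measure_shift.
Qed.

Lemma integrable_shift1 (c : R) (F : measurableTypeR R -> R) : L.-integrable setT (EFin \o F) ->
  L.-integrable setT (fun x : measurableTypeR R => (F (x + c))%:E).
Proof.
move=> /integrableP[mF iF]; apply/integrableP; split; first exact: (measurableT_comp mF (m_shift c)).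
rewrite (@ge0_shift c (fun x => `|(F x)%:E|%E))//.
exact: measurableT_comp.
Qed.

Lemma Rintegral_shift1 (c : R) (F : measurableTypeR R -> R) : L.-integrable setT (EFin \o F) ->
  \int[L]_x F (x + c) = \int[L]_x F x.
Proof.
move=> /measurable_int mF; rewrite /Rintegral; congr fine.
rewrite integralE [RHS]integralE; congr (_ - _)%E.
  have h := @ge0_shift c ((EFin \o F)^\+)%E (measurable_funepos mF) (funepos_ge0 _).
  by rewrite -h; apply: eq_integral => x _; rewrite ?funeposE.
have h := @ge0_shift c ((EFin \o F)^\-)%E (measurable_funeneg mF) (funeneg_ge0 _).
by rewrite -h; apply: eq_integral => x _; rewrite ?funenegE.
Qed.

Lemma integrable_indic_oc (b : R) : 0 < b -> L.-integrable setT (EFin \o (\1_(I b) : measurableTypeR R -> R)).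
Proof.
move=> b0; apply: integrable_indic_fin; first exact: measurable_itv.
by rewrite [ltLHS]lebesgue_measure_itv/= lte_fin b0 -EFinB ltry.
Qed.

Lemma Rintegral_average_bound (t c B : R) (psi : measurableTypeR R -> R) : 0 < t -> 0 <= B ->
  L.-integrable setT (fun s => (\1_(I t) s * psi s)%:E) ->
  (forall s, 0 < s <= t -> `|psi s - c| <= B) ->
  `|\int[L]_s (\1_(I t) s * psi s) - t * c| <= t * B.
Proof.
move=> t0 B0 ip hB.
have iI := integrable_indic_oc t0.
have EI : \int[L]_s (\1_(I t) s : R) = t.
  rewrite Rintegral_indic_fine; last exact: measurable_itv.
  by rewrite [X in fine X]lebesgue_measure_itv/= lte_fin t0 -EFinB subr0.
have ic : L.-integrable setT (fun s => (c * \1_(I t) s)%:E) by exact: (integrableZl measurableT c iI).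
have iB : L.-integrable setT (fun s => (B * \1_(I t) s)%:E) by exact: (integrableZl measurableT B iI).
have Ec r : t * r = \int[L]_s (r * \1_(I t) s) by rewrite RintegralZl// EI mulrC.
rewrite (Ec c) -(RintegralB measurableT ip ic).
apply: le_trans (le_normr_Rintegral _ _) _ => //; first exact: (integrableB measurableT ip ic).
rewrite Ec.
apply: le_Rintegral => //.
- have h : L.-integrable setT (fun s => (\1_(I t) s * psi s - c * \1_(I t) s)%:E).
    exact: (integrableB measurableT ip ic).
  exact: (integrable_norm h).
- move=> s _; rewrite indicE; have [/set_mem Is|_] := boolP (s \in I t).
    by rewrite mul1r !mulr1 hB//; move: Is; rewrite /I /= in_itv.
  by rewrite mul0r !mulr0 subr0 normr0.
Qed.

End line_integrals.

Section density_of_domain.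
Context (R : realType) (d : nat) (d_gt0 : (0 < d)%N) (M : lr_manifold R d).
Context (v : {sigma_finite_measure set (borel M) -> \bar R}) (v_volume : volume_measure v).
Context (p : R -> M -> M -> R) (hk : heat_kernel v p).
Context (P : R -> (M -> R) -> M -> R) (hP : heat_flow v P).
Hypothesis PE : forall t f, 0 < t -> L2 v f ->
  {ae v, forall x, (P t f x)%:E = (\int[v]_y (p t x y * f y)%:E)%E}.
Let L : {sigma_finite_measure set (measurableTypeR R) -> \bar R} := @lebesgue_measure R.
Let I (a : R) : set R := `]0, a]%classic.
Let nrm (g : M -> R) : R := Num.sqrt (\int[v]_x (g x ^+ 2)).
Let sq g : L2 v g -> sqint v g. Proof. by move/sqint_Lfun. Qed.

Lemma flow_diff t f g : 0 <= t -> L2 v f -> L2 v g ->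
  {ae v, forall x, P t (fun y => f y - g y) x = P t f x - P t g x}.
Proof.
move=> t0 f2 g2; have h := flow_linear2 hP 1 (-1) t0 f2 g2.
rewrite (_ : (fun y => f y - g y) = (fun y => 1 * f y + -1 * g y)); last by apply/funext => y; ring.
by apply: ae_imp h => x ->; ring.
Qed.

Lemma L2B f g : L2 v f -> L2 v g -> L2 v (fun x => f x - g x).
Proof. by move=> /sq f2 /sq g2; apply/sqint_Lfun; exact: sqintB. Qed.

(** The flow at time r is a contraction, so the modulus of continuity at 0
    holds at all times. *)
Lemma flow_pairing_diff f g r s : 0 <= r -> 0 <= s -> L2 v f -> L2 v g ->
  `|flow_pairing v P f g (s + r) - flow_pairing v P f g r| <= nrm (fun x => P s f x - f x) * nrm g.
Proof.
move=> r0 s0 f2 g2; have Ps2 := heat_flow_L2 hP s0 f2; have Pr2 := heat_flow_L2 hP r0 f2.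
have Psr2 := heat_flow_L2 hP (addr_ge0 s0 r0) f2; have D2 := L2B Ps2 f2.
have PD2 := heat_flow_L2 hP r0 D2.
apply: le_trans (flow_pairing_bound hP r0 D2 g2).
rewrite /flow_pairing -RintegralB//; [|exact: (sqint_mul (sq Psr2) (sq g2))|exact: (sqint_mul (sq Pr2) (sq g2))].
rewrite le_eqVlt; apply/orP; left; apply/eqP; congr `|_|.
have m1 := L2_measurable Psr2; have m2 := L2_measurable Pr2; have m3 := L2_measurable PD2; have m4 := L2_measurable g2.
apply: ae_eq_Rintegral.
- by apply: measurable_funB; apply: measurable_funM.
- exact: measurable_funM.
apply: ae_imp2 (heat_flow_semigroup hP r0 s0 f2) (flow_diff r0 Ps2 f2) => x; rewrite addrC => -> ->.
by rewrite mulrBl.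
Qed.

Lemma flow_near f e : L2 v f -> 0 < e ->
  exists2 del, 0 < del & forall s, 0 < s <= del -> nrm (fun x => P s f x - f x) <= e.
Proof.
move=> f2 e0; have := heat_flow_continuous hP f2.
have e20 : 0 < e ^+ 2 by rewrite exprn_gt0.
move=> /cvgrPdist_lt/(_ _ e20) [r /= r0 hr]; exists (r / 2); first by rewrite divr_gt0.
move=> s /andP[s0 sr]; have := hr s; rewrite /ball_ /= !sub0r !normrN (gtr0_norm s0) => h.
have {}h : `|sqr_dist v (P s f) f| < e ^+ 2 by apply: h => //; lra.
rewrite -[leRHS](gtr0_norm e0) -sqrtr_sqr ler_wsqrtr// (le_trans (ler_norm _))//.
exact: ltW.
Qed.

Lemma flow_pairing0 f g : L2 v f -> L2 v g -> flow_pairing v P f g 0 = \int[v]_x (f x * g x).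
Proof.
move=> f2 g2; have m1 := L2_measurable (heat_flow_L2 hP (lexx 0) f2).
have m2 := L2_measurable f2; have m3 := L2_measurable g2.
apply: ae_eq_Rintegral; [exact: measurable_funM|exact: measurable_funM|].
by apply: ae_imp (heat_flow_0 hP f2) => x ->.
Qed.

Lemma flow_pairing_flow f g s t : 0 <= s -> 0 <= t -> L2 v f -> L2 v g ->
  flow_pairing v P f (P t g) s = flow_pairing v P f g (s + t).
Proof.
move=> s0 t0 f2 g2; have Ps2 := heat_flow_L2 hP s0 f2.
rewrite /flow_pairing -(heat_flow_symmetric hP t0 Ps2 g2).
have m1 := L2_measurable (heat_flow_L2 hP (addr_ge0 s0 t0) f2).
have m2 := L2_measurable (heat_flow_L2 hP t0 Ps2); have m3 := L2_measurable g2.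
apply: ae_eq_Rintegral; [exact: measurable_funM|exact: measurable_funM|].
by apply: ae_imp (heat_flow_semigroup hP t0 s0 f2) => x; rewrite addrC => ->.
Qed.

(** The element is u = (1/eps) int_0^eps P s f ds, with A u = (P eps f - f) /
    eps. All norms are estimated by pairing with the function itself, so that
    only the scalar functions phi g of time are integrated. *)
Lemma domain_dense f e : L2 v f -> (forall x, 0 <= f x) -> 0 < e ->
  exists u h, half_laplacian v u h /\ sqr_dist v u f <= e.
Proof.
move=> f2 f0 e0; pose e1 := Num.sqrt e; have e10 : 0 < e1 by rewrite sqrtr_gt0.
have [eps eps0 heps] := flow_near f2 e10.
pose phi g s := flow_pairing v P f g s.
have iphi b (b0 : 0 < b) g (g2 : L2 v g) : L.-integrable setT (fun s => (\1_(I b) s * phi g s)%:E).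
  by have [W _ hW] := flow_time_average hk hP PE f2 f0 b0; have [] := hW g g2.
have [U U2 hU] := flow_time_average hk hP PE f2 f0 eps0.
pose u x := eps^-1 * U x.
have u2 : L2 v u by apply/sqint_Lfun; apply: sqintZ; exact: sq.
have uE g (g2 : L2 v g) : \int[v]_x (u x * g x) = eps^-1 * \int[L]_s (\1_(I eps) s * phi g s).
  have [_ <-] := hU g g2; rewrite -RintegralZl//; last exact: (sqint_mul (sq U2) (sq g2)).
  by apply: eq_Rintegral => x _; rewrite mulrA.
have Pe2 := heat_flow_L2 hP (ltW eps0) f2.
pose h x := eps^-1 * (P eps f x - f x).
have h2 : L2 v h by apply/sqint_Lfun; apply: sqintZ; apply: sq; exact: L2B.
exists u, h; split; last first.
  rewrite -[leRHS](sqr_sqrtr (ltW e0)) -/e1.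
  have q2 := L2B u2 f2.
  apply: le_sqr_of_sqrt; [exact: ltW|exact: Rintegral_sqr_ge0|].
  set g := fun x => u x - f x in q2 *.
  have sE : sqr_dist v u f = eps^-1 * (\int[L]_s (\1_(I eps) s * phi g s) - eps * phi g 0).
    have -> : sqr_dist v u f = \int[v]_x (u x * g x) - \int[v]_x (f x * g x).
      rewrite -RintegralB//; [|exact: (sqint_mul (sq u2) (sq q2))|exact: (sqint_mul (sq f2) (sq q2))].
      by apply: eq_Rintegral => x _; rewrite -mulrBl expr2.
    rewrite uE// -(flow_pairing0 f2 q2) -/(phi g 0).
    by field; rewrite gt_eqF.
  rewrite [leLHS]sE.
  rewrite ler_pdivrMl// (le_trans (ler_norm _))//.
  apply: Rintegral_average_bound => //; first by rewrite mulr_ge0 ?sqrtr_ge0// ltW.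
    exact: iphi.
  move=> s /andP[s0 se]; have := flow_pairing_diff (lexx 0) (ltW s0) f2 q2; rewrite addr0 => h'.
  by apply: le_trans h' _; rewrite ler_wpM2r ?sqrtr_ge0// heps// s0.
apply/(heat_flow_generator hP u2 h2).
(* eps (P t u - u) is the integral of P s f over ]eps, eps + t] minus that over
   ]0, t] *)
have shiftE b c (b0 : 0 < b) (c0 : 0 < c) g (g2 : L2 v g) :
    L.-integrable setT (fun s => (\1_(I b) s * phi g (s + c))%:E) /\
    \int[L]_s (\1_(I b) s * phi g (s + c)) =
    \int[L]_s (\1_(I (b + c)) s * phi g s) - \int[L]_s (\1_(I c) s * phi g s).
  have i1 := iphi _ (addr_gt0 b0 c0) _ g2; have i2 := iphi _ c0 _ g2.
  pose F (s : measurableTypeR R) := \1_(I (b + c)) s * phi g s - \1_(I c) s * phi g s.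
  have iF : L.-integrable setT (EFin \o F) by exact: (integrableB measurableT i1 i2).
  have FE s : \1_(I b) s * phi g (s + c) = F (s + c).
    have Iin r z : (z \in I r) = (0 < z <= r).
      by apply/idP/idP => [/set_mem|rz]; [|apply/mem_set]; rewrite /I /= in_itv.
    rewrite /F !indicE -mulrBl !Iin lerD2r; congr (_ * _).
    have [s0|s0] := ltP 0 s.
      by rewrite addr_gt0//= gerDr (lt_geF s0) subr0.
    by rewrite gerDr s0 (le_trans s0 (ltW b0)) subrr.
  rewrite (_ : (fun s => _) = (fun s => F (s + c))); last by apply/funext.
  split.
    rewrite (_ : (fun s => _) = (fun s => (F (s + c))%:E)); first exact: integrable_shift1.
    by apply/funext => s; rewrite FE.
  by rewrite Rintegral_shift1// /F RintegralB.
have key t eta (t0 : 0 < t) : 0 < eta -> (forall s, 0 < s <= t -> nrm (fun x => P s f x - f x) <= eta) ->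
    sqr_dist v (fun x => (P t u x - u x) / t) h <= (2 * eps^-1 * eta) ^+ 2.
  move=> eta0 hs; pose q x := (P t u x - u x) / t - h x.
  have Pu2 := heat_flow_L2 hP (ltW t0) u2.
  have q2 : L2 v q.
    apply/sqint_Lfun; apply: sqintB; last exact: sq.
    rewrite (_ : (fun x => _) = (fun x => t^-1 * (P t u x - u x))); last first.
      by apply/funext => x; rewrite mulrC.
    by apply: sqintZ; apply: sq; exact: L2B.
  have c0 : 0 <= 2 * eps^-1 * eta by rewrite !mulr_ge0// ?invr_ge0 ltW.
  apply: le_sqr_of_sqrt => //; first exact: Rintegral_sqr_ge0.
  have Pq2 := heat_flow_L2 hP (ltW t0) q2.
  have [j1 E1] := shiftE eps t eps0 t0 q q2; have [j2 E2] := shiftE t eps t0 eps0 q q2.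
  pose A := \int[L]_s (\1_(I t) s * phi q (s + eps)) - t * phi q eps.
  pose B := \int[L]_s (\1_(I t) s * phi q s) - t * phi q 0.
  have qE : sqr_dist v (fun x => (P t u x - u x) / t) h = eps^-1 * (t^-1 * A - t^-1 * B).
    have a1 := sqint_mul (sq Pu2) (sq q2); have a2 := sqint_mul (sq u2) (sq q2).
    have a3 := sqint_mul (sq Pe2) (sq q2); have a4 := sqint_mul (sq f2) (sq q2).
    have b1 : \int[v]_x (P t u x * q x) = eps^-1 * \int[L]_s (\1_(I eps) s * phi q (s + t)).
      rewrite (heat_flow_symmetric hP (ltW t0) u2 q2) (uE _ Pq2).
      suff -> : \int[L]_s (\1_(I eps) s * phi (P t q) s) =
        \int[L]_s (\1_(I eps) s * phi q (s + t)) by [].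
      apply: eq_Rintegral => s _; rewrite indicE.
      have [/set_mem Is|_] := boolP (s \in I eps); last by rewrite !mul0r.
      have /andP[s0 _] : 0 < s <= eps by move: Is; rewrite /I /= in_itv.
      by congr (_ * _); apply: flow_pairing_flow => //; exact: ltW.
    have b2 : sqr_dist v (fun x => (P t u x - u x) / t) h =
      t^-1 * (\int[v]_x (P t u x * q x) - \int[v]_x (u x * q x)) -
      eps^-1 * (\int[v]_x (P eps f x * q x) - \int[v]_x (f x * q x)).
      rewrite -!RintegralB// -!RintegralZl//; [|exact: (integrableB measurableT a3 a4)|exact: (integrableB measurableT a1 a2)].
      rewrite -RintegralB//; [|exact: (integrableZl measurableT _ (integrableB measurableT a1 a2))|exact: (integrableZl measurableT _ (integrableB measurableT a3 a4))].
      by apply: eq_Rintegral => x _; rewrite -!/(q x) /q /h; ring.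
    rewrite b2 b1 (uE _ q2) /A /B E1 E2 (addrC eps t) -(flow_pairing0 f2 q2) -/(phi q 0).
    rewrite -[\int[v]_x (P eps f x * q x)]/(phi q eps).
    by field; rewrite !gt_eqF.
  have nq0 : 0 <= eta * nrm q by rewrite mulr_ge0 ?sqrtr_ge0// ltW.
  have hA : `|A| <= t * (eta * nrm q).
    apply: Rintegral_average_bound => // s /andP[s0 st].
    have h' := flow_pairing_diff (ltW eps0) (ltW s0) f2 q2; apply: le_trans h' _.
    by rewrite ler_wpM2r ?sqrtr_ge0// hs// s0.
  have hB : `|B| <= t * (eta * nrm q).
    apply: Rintegral_average_bound => //; first exact: iphi.
    move=> s /andP[s0 st]; have h' := flow_pairing_diff (lexx 0) (ltW s0) f2 q2.
    by rewrite addr0 in h'; apply: le_trans h' _; rewrite ler_wpM2r ?sqrtr_ge0// hs// s0.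
  rewrite [leLHS]qE -/(nrm q) -mulrBr [leRHS](_ : _ = eps^-1 * (t^-1 * (t * (eta * nrm q) + t * (eta * nrm q)))); last first.
    by field; rewrite !gt_eqF.
  rewrite ler_wpM2l ?invr_ge0 ?(ltW eps0)// ler_wpM2l ?invr_ge0 ?(ltW t0)//.
  by rewrite (le_trans (ler_norm _))// (le_trans (ler_normB _ _))// lerD.
apply/cvgrPdist_le => r r0 /=.
pose eta := Num.sqrt r * eps / 2.
have eta0 : 0 < eta by rewrite divr_gt0// mulr_gt0// sqrtr_gt0.
have [del del0 hdel] := flow_near f2 eta0.
near=> t; have t0 : 0 < t by near: t; exact: nbhs_right_gt.
have td : t <= del by near: t; exact: nbhs_right_le.
rewrite sub0r normrN ger0_norm ?Rintegral_sqr_ge0//.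
apply: le_trans (key t eta t0 eta0 _) _.
  by move=> s /andP[s0 st]; apply: hdel; rewrite s0 (le_trans st).
rewrite (_ : 2 * eps^-1 * eta = Num.sqrt r); last by rewrite /eta; field; rewrite gt_eqF.
by rewrite sqr_sqrtr// ltW.
Unshelve. all: by end_near.
Qed.

(** Contractions of L^2 that decrease the functional of ramp2 on a dense set
    decrease it everywhere; the functional vanishes at f, and it vanishes only
    at functions bounded by 1. *)
Lemma flow_le1 f t : 0 < t -> L2 v f -> (forall x, 0 <= f x <= 1) ->
  {ae v, forall x, P t f x <= 1}.
Proof.
move=> t0 f2 f01; have f0 x : 0 <= f x by case/andP: (f01 x).
have Pf2 := heat_flow_L2 hP (ltW t0) f2.
pose F2 := \int[v]_x (f x ^+ 2).
have F20 : 0 <= F2 by exact: Rintegral_sqr_ge0.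
have zero : \int[v]_x ramp2 (f x) = 0.
  rewrite (_ : (fun x => _) = fun=> 0); first by rewrite /Rintegral integral0.
  by apply/funext => x; rewrite ramp2_eq0//; case/andP: (f01 x).
pose C := Num.sqrt (4 + 6 * F2).
have C0 : 0 <= C by exact: sqrtr_ge0.
have bound e : 0 < e <= 1 -> \int[v]_x ramp2 (P t f x) <= 2 * (Num.sqrt e * C).
  move=> /andP[e0 e1]; have [u [h [uh ue]]] := domain_dense f2 f0 e0.
  have [[u2 _] _ _] := uh; have Pu2 := heat_flow_L2 hP (ltW t0) u2.
  have U2 : \int[v]_x (u x ^+ 2) <= 2 + 2 * F2.
    have l := Rintegral_sqrD_le (sq (L2B u2 f2)) (sq f2).
    rewrite (_ : (fun x => (u x - f x + f x) ^+ 2) = (fun x => u x ^+ 2)) in l; last first.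
      by apply/funext => x; rewrite subrK.
    by apply: le_trans l _; rewrite lerD2r; move: ue; rewrite /sqr_dist; lra.
  have step1 : \int[v]_x ramp2 (u x) <= Num.sqrt e * C.
    have := ramp2_integral_dist (sq u2) (sq f2); rewrite zero subr0 => l.
    apply: le_trans (ler_norm _) _; apply: le_trans l _.
    apply: ler_pM; rewrite ?sqrtr_ge0//; apply: ler_wsqrtr => //.
    by rewrite -/F2; lra.
  have step2 : \int[v]_x ramp2 (P t f x) - \int[v]_x ramp2 (P t u x) <= Num.sqrt e * C.
    have l := ramp2_integral_dist (sq Pf2) (sq Pu2).
    apply: le_trans (ler_norm _) _; apply: le_trans l _.
    have c1 := heat_flow_contraction hP (ltW t0) f2; have c2 := heat_flow_contraction hP (ltW t0) u2.
    apply: ler_pM; rewrite ?sqrtr_ge0//; apply: ler_wsqrtr => //; last by rewrite -/F2 in c1; lra.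
    have c3 := heat_flow_contraction hP (ltW t0) (L2B f2 u2).
    apply: le_trans (le_trans _ c3) _.
      rewrite le_eqVlt; apply/orP; left; apply/eqP.
      have m1 := L2_measurable (L2B Pf2 Pu2); have m2 := L2_measurable (heat_flow_L2 hP (ltW t0) (L2B f2 u2)).
      apply: ae_eq_Rintegral; [exact: measurable_funX|exact: measurable_funX|].
      by apply: ae_imp (flow_diff (ltW t0) f2 u2) => x ->.
    apply: le_trans ue; rewrite le_eqVlt; apply/orP; left; apply/eqP.
    by apply: eq_Rintegral => x _; rewrite -sqrrN opprB.
  have step3 := ramp2_flow_domain d_gt0 v_volume hP t0 uh.
  by move: step1 step2 step3; lra.
have le0 : \int[v]_x ramp2 (P t f x) <= 0.
  apply/ler_addgt0Pr => e e0; rewrite add0r.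
  pose r := Num.min 1 (e / (2 * (C + 1))).
  have r0 : 0 < r by rewrite lt_min ltr01 divr_gt0// mulr_gt0// ltr_wpDl.
  have r1 : r <= 1 by rewrite ge_min lexx.
  have := bound (r ^+ 2); rewrite exprn_gt0//= expr_le1// ?(ltW r0)// sqrtr_sqr (gtr0_norm r0) => /(_ r1) h.
  apply: le_trans h _.
  have : r <= e / (2 * (C + 1)) by rewrite ge_min lexx orbT.
  rewrite ler_pdivlMr; last by rewrite mulr_gt0// ltr_wpDl.
  by move=> h; have := ltW r0; nra.
have i2 := integrable_ramp2 (sq Pf2).
have : ae_eq v setT (fun x => (ramp2 (P t f x))%:E) (cst 0%E).
  apply/(ae_eq_integral_abs v measurableT (measurable_int _ i2)).
  under eq_integral do rewrite gee0_abs ?lee_fin ?ramp2_ge0//.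
  have e : (\int[v]_x (ramp2 (P t f x))%:E = (\int[v]_x ramp2 (P t f x))%:E)%E.
    by rewrite /Rintegral fineK// integral_fune_fin_num.
  rewrite e; congr EFin; apply/eqP; rewrite eq_le le0/=.
  by apply: Rintegral_ge0 => x _; exact: ramp2_ge0.
apply: ae_imp => x /(_ Logic.I) [h]; rewrite leNgt; apply/negP => /ramp2_gt1.
by rewrite h ltxx.
Qed.

End density_of_domain.

(** * The mass of the heat kernel *)

Section kernel_mass.
Context (R : realType) (d : nat) (d_gt0 : (0 < d)%N) (M : lr_manifold R d).
Context (v : {sigma_finite_measure set (borel M) -> \bar R}) (v_volume : volume_measure v).

(** The complement of a null set is dense, because open sets have positive
    volume. *)
Lemma ae_dense (Q : M -> Prop) x : {ae v, forall z, Q z} ->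
  exists s : nat -> M, (forall k, Q (s k)) /\ (forall N, open N -> N x -> \forall k \near \oo, N (s k)).
Proof.
move=> aQ; have [a xa] := chart_cover x.
have h k : exists z, [/\ Q z, chart_dom a z & `|chart a z - chart a x| < k.+1%:R^-1].
  have k0 : 0 < k.+1%:R^-1 :> R by rewrite invr_gt0.
  have [V [oV Vx Va hV]] := near_chart xa k0.
  have V0 : (0 < v V)%E by apply: (volume_open_gt0 v_volume) => //; exists x.
  apply: contrapT => nh; have [N [mN N0 hN]] := aQ.
  suff : (v V <= v N)%E by rewrite N0 leNgt V0.
  apply: le_measure; rewrite ?inE//; first exact: open_borel.
  move=> z Vz; apply: hN => /= Qz; apply: nh; exists z; split=> //; [exact: Va|exact: hV].
have [s hs] := choice h; exists s; split=> [k|N oN Nx]; first by case: (hs k).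
have cc : {within chart_image a, continuous (chart_inv a)} by exact: chart_inv_continuous.
have [W oW eW] := within_preimage_open cc oN.
have Wx : W (chart a x).
  have : (chart_image a `&` chart_inv a @^-1` N) (chart a x) by split; [exists x|rewrite /= chartK].
  by rewrite eW => -[].
have /nbhs_ballP[r /= r0 rW] : nbhs (chart a x) W by exact: open_nbhs_nbhs.
near=> k; have [_ sa sk] := hs k.
have : (chart_image a `&` W) (chart a (s k)).
  split; first by exists (s k).
  apply: rW; rewrite -ball_normE /= distrC (lt_trans sk)//.
  near: k; exact: (near_infty_natSinv_lt (PosNum r0)).
by rewrite -eW => -[_ /=]; rewrite chartK.
Unshelve. all: by end_near.
Qed.

Context (p : R -> M -> M -> R) (hk : heat_kernel v p).

(** For almost every x the integral is the value of P t 1_A, which is at most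
    1. It is lower semicontinuous in x by Fatou, the kernel being
    continuous. *)
Lemma kernel_mass_set t x (A : set (borel M)) : 0 < t -> measurable A -> (v A < +oo)%E ->
  (\int[v]_(y in A) (p t x y)%:E <= 1)%E.
Proof.
move=> t0 mA fA; have [P hP PE] := heat_kernel_flow hk.
have A2 := L2_indic mA fA.
have A01 z : 0 <= (\1_A z : R) <= 1 by rewrite indicE; case: (_ \in _); rewrite /= ?lexx ?ler01.
have le1 := flow_le1 d_gt0 v_volume hk hP PE t0 A2 A01.
have Q : {ae v, forall z, (\int[v]_(y in A) (p t z y)%:E <= 1)%E}.
  apply: ae_imp2 (PE t _ t0 A2) le1 => z; rewrite kernel_integral_indic// => <-.
  by rewrite lee_fin.
have [s [hs sx]] := ae_dense x Q.
have mk z : measurable_fun A (fun y => (p t z y)%:E).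
  by apply/measurable_EFinP; apply: measurable_funTS; exact: (measurable_kernel_snd hk).
have p0 z y : 0 <= p t z y by exact: (kernel_ge0 hk).
have fat := @fatou _ _ _ v A mA (fun k y => (p t (s k) y)%:E) (fun k => mk (s k)) (fun k y _ => p0 (s k) y).
have E : (\int[v]_(y in A) (p t x y)%:E = \int[v]_(y in A) limn_einf (fun k => (p t (s k) y)%:E))%E.
  apply: eq_integral => y _; apply/esym.
  have c : (p t (s k) y)%:E @[k --> \oo] --> (p t x y)%:E.
    apply: cvg_EFin; first by apply: nearW.
    apply/cvgrPdist_lt => e e0.
    have [del [V [W [d0 [oV Vx] [oW Wy] h]]]] := kernel_near hk x y t0 e0.
    near=> k; rewrite /= distrC; apply: h => //; first by rewrite subrr normr0.
    by near: k; exact: sx.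
  by rewrite (cvg_limn_einf_sup c).1.
rewrite E; apply: le_trans fat _.
rewrite limn_einf_lim; apply: lime_le; first exact: is_cvg_einfs.
apply: nearW => n; apply: le_trans (hs n); apply: ereal_inf_lbound.
by exists n => //=.
Unshelve. all: by end_near.
Qed.

Lemma kernel_mass_le1 t x : 0 < t -> (\int[v]_y (p t x y)%:E <= 1)%E.
Proof.
move=> t0; have /sigma_finiteP[F [FT ndF mF]] := sigma_finiteT v.
have mF1 n : measurable_fun setT (fun y : borel M => p t x y * \1_(F n) y).
  apply: measurable_funM; first exact: (measurable_kernel_snd hk).
  by apply: measurable_indic; case: (mF n).
have p0 y : 0 <= p t x y by exact: (kernel_ge0 hk).
have c := @cvg_monotone_convergence _ _ _ v _ measurableT (fun n y => (p t x y * \1_(F n) y)%:E).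
have {}c : (\int[v]_y (p t x y * \1_(F n) y)%:E)%E @[n --> \oo] --> (\int[v]_y (p t x y)%:E)%E.
  rewrite [X in _ --> X](_ : _ = (\int[v]_y limn (fun n => (p t x y * \1_(F n) y)%:E))%E).
    apply: c.
    - by move=> n; exact/measurable_EFinP.
    - by move=> n y _; rewrite lee_fin mulr_ge0.
    - move=> y _ m n mn; rewrite lee_fin ler_wpM2l// !indicE ler_nat.
      case: (boolP (y \in F m)) => // /set_mem Fy.
      by rewrite mem_set//; have /subsetPset/(_ y Fy) := ndF _ _ mn.
  apply: eq_integral => y _; apply/esym/cvg_lim => //.
  have [m _ Fm] : (\bigcup_k F k) y by rewrite -FT.
  apply: cvg_near_cst; near=> n; congr (_%:E).
  rewrite indicE mem_set ?mulr1//.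
  have mn : (m <= n)%N by near: n; exact: nbhs_infty_ge.
  by have /subsetPset/(_ y Fm) := ndF _ _ mn.
apply: (cvge_le _ c); apply: nearW => n; have [mFn Fn] := mF n.
rewrite kernel_integral_indic//.
exact: kernel_mass_set.
Unshelve. all: by end_near.
Qed.

End kernel_mass.

(** * The integral estimate *)

Lemma le_poweR (R : realType) (x y : \bar R) (r : R) : 0 <= r -> (0 <= x)%E -> (x <= y)%E ->
  (x `^ r <= y `^ r)%E.
Proof.
move=> r0 x0 xy; apply: gt0_ler_poweR => //; rewrite in_itv/= leey ?andbT//.
exact: le_trans xy.
Qed.

Section kernel_hoelder.
Context (R : realType) (d : nat) (d_gt0 : (0 < d)%N) (M : lr_manifold R d).
Context (v : {sigma_finite_measure set (borel M) -> \bar R}) (v_volume : volume_measure v).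
Context (p : R -> M -> M -> R) (hk : heat_kernel v p).

Lemma admissible_ge1 q : admissible_exponent d q -> 1 <= q :> R.
Proof.
rewrite /admissible_exponent; case: eqP => // d1 dq.
have d2 : (2 <= d)%N by case: d d_gt0 d1 {dq} => [|[|]].
rewrite -(ler_nat R) in d2; apply: ltW; apply: le_lt_trans dq.
by rewrite ler_pdivlMr// mul1r.
Qed.

(** The control pair bounds the supremum in the second variable by a function
    of the first; symmetry exchanges the two. *)
Lemma kernel_le Xi Sigma C t x y : kernel_bound p Xi Sigma C -> 0 < t <= 1 ->
  p t x y <= C * Sigma t * Xi y.
Proof.
move=> kb t01; have t0 : 0 < t by case/andP: t01.
have [P hP PE] := heat_kernel_flow hk.
rewrite (kernel_sym v_volume hk hP PE)// -lee_fin; apply: le_trans (kb y t t01).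
by apply: ereal_sup_ubound; exists x.
Qed.

Lemma weighted_norm_ge0 Xi q f : (0 <= weighted_norm v Xi q f)%E.
Proof. exact: poweR_ge0. Qed.

(** Split p = p^(1/r) p^(1/q) with r conjugate to q. The first factor has L^r
    norm at most 1, and in the second one p is bounded by c Xi. *)
Lemma kernel_hoelder Xi (c : R) q k t x : 0 < t -> 1 <= q -> 0 <= c ->
  measurable_fun setT (k : borel M -> R) -> measurable_fun setT (Xi : borel M -> R) ->
  (forall y, 0 <= Xi y) -> (forall y, p t x y <= c * Xi y) ->
  (\int[v]_y (p t x y * `|k y|)%:E <= (c `^ q^-1)%:E * weighted_norm v Xi q k)%E.
Proof.
move=> t0 q1 c0 mk mXi Xi0 pXi.
have q0 : 0 < q by exact: lt_le_trans q1.
have p0 y : 0 <= p t x y by exact: (kernel_ge0 hk).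
have mp := measurable_kernel_snd hk x t0.
have mabs : measurable_fun setT (fun y : borel M => `|k y|) by exact: measurableT_comp.
have mpow0 r (h : M -> R) : measurable_fun setT (h : borel M -> R) ->
    measurable_fun setT (fun y : borel M => h y `^ r).
  by move=> mh; exact: (measurableT_comp (measurable_powR r) mh).
have mpow r : measurable_fun setT (fun y : borel M => `|k y| `^ r) by exact: mpow0.
have W : ((c `^ q^-1)%:E * weighted_norm v Xi q k =
    (\int[v]_y (c * (`|k y| `^ q * Xi y))%:E) `^ q^-1)%E.
  rewrite /weighted_norm -poweR_EFin -poweRM//.
  - congr (_ `^ _)%E; rewrite -ge0_integralZl//.
    + by apply/measurable_EFinP; exact: measurable_funM.
    + by move=> y _; rewrite lee_fin mulr_ge0 ?powR_ge0.
  - by apply: integral_ge0 => y _; rewrite lee_fin mulr_ge0 ?powR_ge0.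
have B : (\int[v]_y (p t x y * `|k y| `^ q)%:E <= \int[v]_y (c * (`|k y| `^ q * Xi y))%:E)%E.
  apply: ge0_le_integral => //.
  - by move=> y _; rewrite lee_fin mulr_ge0 ?powR_ge0.
  - by apply/measurable_EFinP; exact: measurable_funM.
  - by apply/measurable_EFinP; apply: measurable_funM => //; exact: measurable_funM.
  - by move=> y _; rewrite lee_fin (mulrC (_ `^ _)) mulrA ler_wpM2r ?powR_ge0.
have I0 f : (0 <= \int[v]_y (p t x y * `|k y| `^ f)%:E)%E.
  by apply: integral_ge0 => y _; rewrite lee_fin mulr_ge0 ?powR_ge0.
rewrite W; apply: (@le_trans _ _ ((\int[v]_y (p t x y * `|k y| `^ q)%:E) `^ q^-1)%E); last first.
  by apply: le_poweR => //; rewrite invr_ge0 ltW.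
(* the conjugate exponent is infinite, and the claim is the bound on p *)
have [->|qn1] := eqVneq q 1.
  rewrite invr1 poweRe1//; under [leRHS]eq_integral do rewrite powRr1//.
  by [].
have {q1}q1 : 1 < q by rewrite lt_neqAle eq_sym qn1.
pose r := q / (q - 1).
have r0 : 0 < r by rewrite divr_gt0// subr_gt0.
have rq : r^-1 + q^-1 = 1.
  by rewrite /r; field; rewrite gt_eqF// subr_eq0 gt_eqF.
have pE y : p t x y = p t x y `^ r^-1 * p t x y `^ q^-1.
  rewrite -powRD; first by rewrite rq powRr1.
  by rewrite rq oner_eq0.
pose f y := p t x y `^ r^-1; pose g y := p t x y `^ q^-1 * `|k y|.
have mf : measurable_fun setT (f : borel M -> R) by exact: mpow0.
have mg : measurable_fun setT (g : borel M -> R).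
  by apply: measurable_funM => //; exact: mpow0.
have h := hoelder v mf mg r0 q0 rq.
have -> : (\int[v]_y (p t x y * `|k y|)%:E = 'N[v]_1[EFin \o (f \* g)%R])%E.
  rewrite Lnorm1; apply: eq_integral => y _ /=.
  have -> : f y * g y = p t x y * `|k y| by rewrite /f /g mulrA -pE.
  by rewrite (@ger0_norm _ (p t x y * `|k y|)) ?mulr_ge0.
apply: le_trans h _; rewrite unlock.
have -> : (\int[v]_y (`|(EFin \o f) y| `^ r) = \int[v]_y (p t x y)%:E)%E.
  apply: eq_integral => y _ /=; congr EFin.
  by rewrite /f ger0_norm ?powR_ge0// -powRrM mulVf ?gt_eqF// powRr1.
have -> : (\int[v]_y (`|(EFin \o g) y| `^ q) = \int[v]_y (p t x y * `|k y| `^ q)%:E)%E.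
  apply: eq_integral => y _ /=; congr EFin.
  by rewrite (@ger0_norm _ (g y)) ?mulr_ge0 ?powR_ge0// /g powRM ?powR_ge0// -powRrM mulVf ?gt_eqF// powRr1.
have m1 := kernel_mass_le1 d_gt0 v_volume hk x t0.
rewrite -[leRHS]mul1e; apply: lee_wpmul2r; first exact: poweR_ge0.
rewrite -[leRHS](poweR1r r^-1); apply: le_poweR => //; first by rewrite invr_ge0 ltW.
by apply: integral_ge0 => y _; rewrite lee_fin.
Qed.

Lemma kernel_ess_sup t x k : 0 < t -> measurable_fun setT (k : borel M -> R) ->
  (\int[v]_y (p t x y * `|k y|)%:E <= 'N[v]_+oo[EFin \o k])%E.
Proof.
move=> t0 mk; have p0 y : 0 <= p t x y by exact: (kernel_ge0 hk).
have mp := measurable_kernel_snd hk x t0.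
have vT : (0 < v [set: M])%E.
  by apply: (volume_open_gt0 v_volume); [exact: openT|exists x].
have N0 := Lnorm_ge0 v +oo%E (EFin \o k).
have ae_N : {ae v, forall y, (`|k y|%:E <= 'N[v]_+oo[EFin \o k])%E}.
  by rewrite unlock vT; exact: ess_sup_inf.ess_sup_ge.
have m1 := kernel_mass_le1 d_gt0 v_volume hk x t0.
move: N0 ae_N; case: ('N[v]_+oo[_])%E => [N N0 ae_N|_ _|//]; last by rewrite leey.
rewrite lee_fin in N0.
apply: (@le_trans _ _ (\int[v]_y (N%:E * (p t x y)%:E))%E).
  apply: ae_ge0_le_integral => //.
  - by move=> y _; rewrite lee_fin mulr_ge0.
  - by apply/measurable_EFinP; apply: measurable_funM => //; exact: measurableT_comp.
  - by move=> y _; rewrite -EFinM lee_fin mulr_ge0.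
  - by apply: emeasurable_funM => //; exact/measurable_EFinP.
  - apply: ae_imp ae_N => y h _; rewrite -EFinM lee_fin mulrC; apply: ler_wpM2r; [exact: p0|exact: h].
rewrite ge0_integralZl//; [|exact/measurable_EFinP|by move=> y _; rewrite lee_fin].
by rewrite -[leRHS]mule1; apply: lee_wpmul2l.
Qed.

(** The decomposition of k holds almost everywhere, which is all that
    membership in the sum of two Lebesgue spaces provides. *)
Lemma kernel_sum_bound (k k1 k2 : M -> R) q Xi Sigma C t x :
  measurable_fun setT (k : borel M -> R) ->
  measurable_fun setT (k1 : borel M -> R) -> measurable_fun setT (k2 : borel M -> R) ->
  {ae v, forall y, k y = k1 y + k2 y} ->
  admissible_exponent d q -> control_pair p Xi Sigma -> 0 < C -> kernel_bound p Xi Sigma C ->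
  0 < t <= 1 ->
  (\int[v]_y (p t x y * `|k y|)%:E <=
    (C `^ q^-1 * Sigma t `^ q^-1)%:E * weighted_norm v Xi q k1 + 'N[v]_+oo[EFin \o k2])%E.
Proof.
move=> mk mk1 mk2 kE aq cp C0 kb t01; have /andP[t0 t1] := t01.
have p0 y : 0 <= p t x y by exact: (kernel_ge0 hk).
have mp := measurable_kernel_snd hk x t0.
have [cXi [xi xi0 hxi] S0 _ _ _] := cp.
have mXi : measurable_fun setT (Xi : borel M -> R).
  apply: (@measurability _ _ _ _ _ _ _ (RGenOpens.measurableE R)) => _ [_ [a [b ->]] <-].
  rewrite setTI; apply: open_borel; apply: open_comp; last exact: interval_open.
  by move=> z _; exact: cXi.
have S0' := S0 _ t01.
have mm (f : M -> R) : measurable_fun setT (f : borel M -> R) ->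
    measurable_fun setT (fun y : borel M => (p t x y * `|f y|)%:E).
  by move=> mf; apply/measurable_EFinP; apply: measurable_funM => //; exact: measurableT_comp.
apply: (@le_trans _ _ (\int[v]_y ((p t x y * `|k1 y|)%:E + (p t x y * `|k2 y|)%:E))%E).
  apply: ae_ge0_le_integral => //.
  - by move=> y _; rewrite lee_fin mulr_ge0.
  - exact: mm.
  - by move=> y _; rewrite -EFinD lee_fin addr_ge0 ?mulr_ge0.
  - by apply: emeasurable_funD; exact: mm.
  - apply: ae_imp kE => y -> _; rewrite -EFinD lee_fin -mulrDr ler_wpM2l//.
    exact: ler_normD.
rewrite ge0_integralD//; [|by move=> y _; rewrite lee_fin mulr_ge0|exact: mm|by move=> y _; rewrite lee_fin mulr_ge0|exact: mm].
apply: leeD; last exact: kernel_ess_sup.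
rewrite -powRM ?(ltW C0) ?(ltW S0')//; apply: kernel_hoelder => //.
- exact: admissible_ge1.
- by rewrite mulr_ge0 ?(ltW C0) ?(ltW S0').
- by move=> y; rewrite (le_trans (ltW xi0)).
- by move=> y; exact: kernel_le.
Qed.

End kernel_hoelder.

(** * Densities and the Kato class *)

Section integral_density.
Context dT (T : measurableType dT) (R : realType) (mu : {measure set T -> \bar R}).
Local Open Scope ereal_scope.
Import HBNNSimple.

(** Integration against a measure with a density, by approximation of g with
    simple functions. *)
Lemma ge0_integral_pos_density (w : {mfun T >-> R}) (g : T -> R) :
  measurable_fun setT g -> (forall x, (0 <= g x)%R) ->
  \int[pos_density mu w]_x (g x)%:E = \int[mu]_x (g x * Num.max (w x) 0)%:E.
Proof.
move=> mg g0; have mE := @measurableT _ T.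
have mf : measurable_fun setT (EFin \o g) by exact/measurable_EFinP.
pose wp x := Num.max (w x) 0%R.
have wp0 x : (0 <= wp x)%R by rewrite le_max lexx orbT.
have mw : measurable_fun setT wp by exact: measurable_maxr.
pose h := nnsfun_approx mE mf.
have hcvg x : (EFin \o h n) x @[n --> \oo] --> (g x)%:E.
  by apply: cvg_nnsfun_approx => // y _; rewrite lee_fin.
have -> : \int[pos_density mu w]_x (g x)%:E =
    lim (\int[pos_density mu w]_x (EFin \o h n) x @[n --> \oo]).
  have fE x : (g x)%:E = lim ((EFin \o h n) x @[n --> \oo]).
    by apply/esym/cvg_lim => //; exact: hcvg.
  under eq_integral => x _ do rewrite fE.
  apply: monotone_convergence => //.
  - by move=> n; apply/measurable_EFinP; exact/measurable_funP.
  - by move=> n x _; rewrite lee_fin.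
  - by move=> x _ a b ab; rewrite lee_fin; exact/lefP/nd_nnsfun_approx.
have -> : \int[mu]_x (g x * wp x)%:E = lim (\int[mu]_x (h n x * wp x)%:E @[n --> \oo]).
  have fE x : (g x * wp x)%:E = lim ((h n x * wp x)%:E @[n --> \oo]).
    apply/esym/cvg_lim => //.
    rewrite (_ : (fun n => _) = (fun n => (EFin \o h n) x * (wp x)%:E)); last by apply/funext.
    by rewrite EFinM; apply: cvgeZr => //; exact: hcvg.
  under eq_integral => x _ do rewrite fE.
  apply: monotone_convergence => //.
  - by move=> n; apply/measurable_EFinP; apply: measurable_funM.
  - by move=> n x _; rewrite lee_fin mulr_ge0.
  - by move=> x _ a b ab; rewrite lee_fin ler_wpM2r//; exact/lefP/nd_nnsfun_approx.
suff suf n : \int[mu]_x (h n x * wp x)%:E = \int[pos_density mu w]_x (EFin \o h n) x.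
  by congr (limn _); apply/funext => n; rewrite suf.
transitivity (\int[pos_density mu w]_x
   (\sum_(y \in range (h n)) (y * \1_(h n @^-1` [set y]) x)%:E)); last first.
  by apply: eq_integral => t tE; rewrite /= fimfunE -fsumEFin.
have indich m r : measurable_fun setT (fun x => (r * \1_(h m @^-1` [set r]) x)%:E).
  by apply/measurable_EFinP; exact: measurable_funM.
rewrite ge0_integral_fsum//; last by move=> m y Ey; exact: nnfun_muleindic_ge0.
transitivity (\int[mu]_x (\sum_(y \in range (h n))
    (y * \1_(h n @^-1` [set y]) x)%:E * (wp x)%:E)).
  apply: eq_integral => x _.
  rewrite -ge0_mule_fsuml => [|y]; last exact: nnfun_muleindic_ge0.
  by rewrite fsumEFin // -(fimfunE _ x) EFinM.
rewrite ge0_integral_fsum//; last 2 first.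
  - by move=> y; apply: emeasurable_funM => //; exact/measurable_EFinP.
  - by move=> m y Ey; rewrite mule_ge0 ?nnfun_muleindic_ge0// lee_fin.
apply: eq_fsbigr => r rhn.
under [RHS]eq_integral do rewrite EFinM.
rewrite integralZl_indic_nnsfun => //.
under eq_integral do rewrite EFinM -muleA.
rewrite ge0_integralZl//.
- congr (_ * _); rewrite integral_indic// setIT.
  rewrite /pos_density [RHS]integral_mkcond; apply: eq_integral => x _.
  by rewrite patchE indicE; case: ifP; rewrite ?mul1e ?mul0e.
- by apply: emeasurable_funM; exact/measurable_EFinP.
- by move=> t Et; rewrite mule_ge0 ?lee_fin.
- by move: rhn; rewrite inE => -[t _ <-]; rewrite lee_fin.
Qed.

Lemma ge0_integral_total_variation (k : {mfun T >-> R}) (g : T -> R) :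
  measurable_fun setT g -> (forall x, (0 <= g x)%R) ->
  \int[Defs.total_variation (signed_density mu k)]_x (g x)%:E = \int[mu]_x (g x * `|k x|)%:E.
Proof.
move=> mg g0.
have mm (w : {mfun T >-> R}) : measurable_fun setT (fun x => (g x * Num.max (w x) 0)%:E).
  by apply/measurable_EFinP; apply: measurable_funM => //; exact: measurable_maxr.
rewrite ge0_integral_measure_add//; [|by move=> x _; rewrite lee_fin|exact/measurable_EFinP].
rewrite /= !ge0_integral_pos_density// -ge0_integralD//.
- apply: eq_integral => x _; rewrite -EFinD -mulrDr; congr (_ * _)%:E => /=.
  change (Num.max (k x) 0 + Num.max (- k x) 0 = `|k x|)%R.
  have [h|h] := leP 0%R (k x).
    by rewrite (max_idPr _) ?oppr_le0// addr0 ger0_norm.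
  by rewrite (max_idPl _) ?oppr_ge0 ?ltW// add0r ltr0_norm.
- by move=> x _; rewrite lee_fin mulr_ge0// le_max lexx orbT.
- by move=> x _; rewrite lee_fin mulr_ge0// le_max lexx orbT.
Qed.

End integral_density.

Section kato.
Context (R : realType) (d : nat) (d_gt0 : (0 < d)%N) (M : lr_manifold R d).
Context (v : {sigma_finite_measure set (borel M) -> \bar R}) (v_volume : volume_measure v).

(** A function that is at least 1 near A has squared L^2 norm at least v(A),
    and the energy is nonnegative. *)
Lemma polar_null (A : set (borel M)) : measurable A -> polar v A -> v A = 0%E.
Proof.
move=> mA pA; apply/eqP; rewrite eq_le measure_ge0 andbT.
apply/lee_addgt0Pr => e e0; rewrite add0e.
have : (capacity v A < e%:E)%E by rewrite pA lte_fin.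
move=> /ereal_inf_lt[_ [f [Wf [U [oU AU fU]]] <-]]; rewrite lte_fin => le.
have mU : measurable (U : set (borel M)) by exact: open_borel.
have [f2 _] := Wf; have sf : sqint v f by exact/sqint_Lfun.
have [mf _] := sf.
have en := energy_ge0 d_gt0 v_volume f.
have I2 := sqint_integrable sf.
have E : (\int[v]_x (f x ^+ 2)%:E = (\int[v]_x (f x) ^+ 2)%:E)%E.
  by rewrite /Rintegral fineK// integral_fune_fin_num.
apply: (@le_trans _ _ (v U)); first by apply: le_measure; rewrite ?inE.
apply: (@le_trans _ _ (\int[v]_x (f x ^+ 2)%:E)%E); last by rewrite E lee_fin; lra.
rewrite -[leLHS]mul1e -integral_cst// integral_mkcond.
apply: ae_ge0_le_integral => //.
- by move=> x _; rewrite patchE; case: ifP => //; rewrite ?lee_fin.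
- by apply/(measurable_restrictT _ mU); exact: measurable_cst.
- by move=> x _; rewrite lee_fin sqr_ge0.
- exact: measurable_int I2.
- apply: ae_imp fU => x h _; rewrite patchE; case: ifPn => [/set_mem Ux|_]; last by rewrite lee_fin sqr_ge0.
  by rewrite /= lee_fin exprn_ege1// h.
Qed.

Lemma polar_total_variation (k : {mfun borel M >-> R}) (A : set (borel M)) :
  measurable A -> polar v A -> Defs.total_variation (signed_density v k) A = 0%E.
Proof.
move=> mA /(polar_null mA) vA.
have -> : Defs.total_variation (signed_density v k) A =
    (pos_density v k A + pos_density v (- k)%R A)%E by exact: measure_addE.
have z (w : {mfun borel M >-> R}) : pos_density v w A = 0%E.
  rewrite /pos_density null_set_integral//.
  by apply/measurable_EFinP; apply: measurable_funTS; exact: measurable_maxr.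
by rewrite !z adde0.
Qed.

Context (p : R -> M -> M -> R) (hk : heat_kernel v p).

Lemma measurable_kernel_integral x (k : M -> R) (D : set (measurableTypeR R)) :
  measurable D -> D `<=` [set s | 0 < s] -> measurable_fun setT (k : borel M -> R) ->
  measurable_fun D (fun s : measurableTypeR R => (\int[v]_y (p s x y * `|k y|)%:E)%E).
Proof.
move=> mD D0 mk.
have mF : measurable_fun setT
    (fun z : measurableTypeR R * borel M => (kernel0 p (z.1, x, z.2) * `|k z.2|)%:E).
  apply/measurable_EFinP; apply: measurable_funM.
    have mk0 := @measurable_kernel0 _ _ _ _ _ hk.
    apply: (measurableT_comp mk0); apply: measurable_fun_pair => //.
    by apply: measurable_fun_pair => //; exact: measurable_fst.
  by apply: measurableT_comp => //; exact: (measurableT_comp mk measurable_snd).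
have h := @measurable_fun_fubini_tonelli_F _ _ _ _ _ v _ mF.
apply: (@eq_measurable_fun _ _ _ _ D (fun s => \int[v]_y (kernel0 p (s, x, y) * `|k y|)%:E)%E).
  move=> s /set_mem /D0 /= s0; apply: eq_integral => y _.
  by rewrite kernel0E.
by apply: measurable_funTS; apply: h => z; rewrite lee_fin mulr_ge0// (kernel0_ge0 hk).
Qed.

(** The integral estimate bounds the supremum over x by the integral over ]0,
    t] of a fixed integrable function of s. *)
Lemma kato_density (k k1 k2 : {mfun borel M >-> R}) q Xi Sigma :
  {ae v, forall y, k y = k1 y + k2 y} ->
  admissible_exponent d q -> control_pair p Xi Sigma ->
  (weighted_norm v Xi q k1 < +oo)%E -> (k2 : borel M -> R) \in Lfun v +oo%E ->
  kato_class v p (signed_density v k).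
Proof.
move=> kE aq cp W1 k2L; split=> [A mA pA|]; first exact: polar_total_variation.
have q1 := admissible_ge1 d_gt0 aq.
have qi0 : 0 <= q^-1 by rewrite invr_ge0 (le_trans _ q1).
have [C C0 kb] := control_kernel cp.
have [E E0 SE] := control_Sigma_integrable cp aq.
have mS := control_Sigma_borel cp.
have [w [w0 wE]] : exists w, 0 <= w /\ weighted_norm v Xi q k1 = w%:E.
  exists (fine (weighted_norm v Xi q k1)); rewrite fine_ge0 ?weighted_norm_ge0// fineK//.
  by rewrite ge0_fin_numE ?weighted_norm_ge0.
have [n [n0 nE]] : exists n, 0 <= n /\ 'N[v]_+oo[EFin \o k2]%E = n%:E.
  have N0 := Lnorm_ge0 v +oo%E (EFin \o k2).
  have Noo : ('N[v]_+oo[EFin \o k2] < +oo)%E.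
    by move: k2L; rewrite inE => /andP[_]; rewrite inE.
  exists (fine 'N[v]_+oo[EFin \o k2]%E); rewrite fine_ge0// fineK//.
  by rewrite ge0_fin_numE.
pose J : set (measurableTypeR R) := `]0, 1]%classic.
have mJ : measurable J by exact: measurable_itv.
pose H s := (C `^ q^-1 * Sigma s `^ q^-1) * w + n.
have H0 s : 0 <= H s by rewrite addr_ge0// !mulr_ge0 ?powR_ge0.
have mSq : measurable_fun J (fun s => Sigma s `^ q^-1).
  exact: (measurableT_comp (measurable_powR q^-1) mS).
have mH : measurable_fun J H.
  by apply: measurable_funD => //; apply: measurable_funM => //; exact: measurable_funM.
pose L : {sigma_finite_measure set (measurableTypeR R) -> \bar R} := @lebesgue_measure R.
have Lone : (L J < +oo)%E by rewrite [ltLHS]lebesgue_measure_itv/= lte_fin ltr01 ltry.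
(* the weight exp(-E s) is bounded below on ]0, 1] *)
have iH : L.-integrable J (EFin \o H).
  have iSe : L.-integrable J (fun s => (Sigma s `^ q^-1 * expR (- E * s))%:E).
    apply/integrableP; split.
      apply/measurable_EFinP; apply: measurable_funM => //; apply: measurable_funTS.
      by apply: measurableT_comp => //; exact: measurable_funM.
    by under eq_integral do rewrite /= ger0_norm ?mulr_ge0 ?powR_ge0 ?expR_ge0//.
  have ic : L.-integrable J (fun s => n%:E).
    apply/integrableP; split; first exact: measurable_cst.
    by rewrite integral_cst// lte_mul_pinfty.
  have i1 := integrableZl mJ (C `^ q^-1 * w * expR E) iSe.
  apply: le_integrable (integrableD mJ i1 ic) => //; first exact/measurable_EFinP.
  move=> s; rewrite /J /= in_itv/= => /andP[s0 s1].
  rewrite lee_fin ger0_norm// (le_trans _ (ler_norm _))// /H lerD2r.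
  rewrite [leLHS](_ : _ = C `^ q^-1 * w * Sigma s `^ q^-1 * 1); last by ring.
  rewrite [leRHS](_ : _ = C `^ q^-1 * w * Sigma s `^ q^-1 * (expR E * expR (- E * s))); last by ring.
  apply: ler_wpM2l; first by rewrite !mulr_ge0 ?powR_ge0.
  rewrite -expRD -[leLHS]expR0 ler_expR.
  by have := ltW E0; nra.
(* the primitive of an integrable function is continuous at 0 *)
pose K := (fun s => H s) \_ J.
have iK : L.-integrable setT (EFin \o K).
  by rewrite -restrict_EFin; apply/(integrable_mkcond _ mJ).
have iK1 : L.-integrable `[0, 1] (EFin \o K).
  by apply: integrableS iK => //; exact: measurable_itv.
have c := @parameterized_integral_cvg_left R 0 1 K ltr01 iK1.
have {}c : (parameterized_integral lebesgue_measure 0 t K)%:E @[t --> 0^'+] --> 0%E.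
  apply: cvg_EFin; first by apply: nearW.
  by apply: cvg_at_right_filter; exact: c.
have c0 : (fun=> 0%E : \bar R) @ (0 : R)^'+ --> (0%E : \bar R) by exact: cvg_cst.
apply: (squeeze_cvge _ c0 c).
near=> t; have t0 : 0 < t by near: t; exact: nbhs_right_gt.
have t1 : t <= 1 by near: t; exact: nbhs_right_le.
have tv s x : 0 < s -> (\int[Defs.total_variation (signed_density v k)]_y (p s x y)%:E =
    \int[v]_y (p s x y * `|k y|)%:E)%E.
  move=> s0; apply: ge0_integral_total_variation; first exact: (measurable_kernel_snd hk).
  by move=> y; exact: (kernel_ge0 hk).
apply/andP; split.
  apply: (@le_trans _ _ (\int[lebesgue_measure]_(s in `]0%R, t])
      \int[Defs.total_variation (signed_density v k)]_y (p s point y)%:E)%E); last first.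
    by apply: ereal_sup_ubound; exists point.
  apply: integral_ge0 => s; rewrite /= in_itv/= => /andP[s0 _]; apply: integral_ge0 => y _.
  by rewrite lee_fin; exact: (kernel_ge0 hk).
apply: ge_ereal_sup => _ [x _ <-].
rewrite /parameterized_integral /Rintegral fineK; last first.
  apply: integral_fune_fin_num; first exact: measurable_itv.
  apply: integrableS iK => //; exact: measurable_itv.
have tJ : `]0, t]%classic `<=` J.
  by move=> s; rewrite /J /= !in_itv/= => /andP[-> /le_trans]; exact.
have -> : (\int[lebesgue_measure]_(s in `]0%R, t])
      \int[Defs.total_variation (signed_density v k)]_y (p s x y)%:E =
    \int[L]_(s in `]0%R, t]) \int[v]_y (p s x y * `|k y|)%:E)%E.
  by apply: eq_integral => s /set_mem /tJ; rewrite /J /= in_itv/= => /andP[s0 _]; exact: tv.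
apply: (@le_trans _ _ (\int[L]_(s in `]0%R, t]) (K s)%:E)%E).
  apply: ge0_le_integral.
  - exact: measurable_itv.
  - move=> s; rewrite /= in_itv/= => /andP[s0 _]; apply: integral_ge0 => y _.
    by rewrite lee_fin mulr_ge0//; exact: (kernel_ge0 hk).
  - have mI : measurable (`]0, t]%classic : set (measurableTypeR R)) by exact: measurable_itv.
    have I0 : (`]0, t]%classic : set R) `<=` [set s | 0 < s].
      by move=> s; rewrite /= in_itv/= => /andP[].
    have mk : measurable_fun setT (k : borel M -> R) by [].
    exact: (@measurable_kernel_integral x k _ mI I0 mk).
  - by apply: measurable_funTS; exact: measurable_int iK.
  - move=> s st; have := tJ _ st; rewrite /J /= in_itv/= => s01.
    rewrite /K patchE mem_set; last by rewrite /J /= in_itv.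
    have b := kernel_sum_bound d_gt0 v_volume hk x (measurable_funPT k) (measurable_funPT k1) (measurable_funPT k2) kE aq cp C0 kb s01.
    by rewrite wE nE in b.
apply: ge0_subset_integral => //; try exact: measurable_itv.
- by apply: measurable_funTS; exact: measurable_int iK.
- by move=> s _; rewrite lee_fin /K patchE; case: ifP.
- by move=> s; rewrite /= !in_itv/= => /andP[/ltW -> ->].
Unshelve. all: by end_near.
Qed.

End kato.

Section sigma_finite_copy.
Context dT (T : measurableType dT) (R : realType) (mu : {measure set T -> \bar R}).

(** A name for mu that carries the proof of sigma-finiteness: Tonelli asks for
    the structure, and for volume measures it comes from a theorem. *)
Definition with_sigma_finite (sf : sigma_finite setT mu) : set T -> \bar R := mu.

Variable sf : sigma_finite setT mu.

HB.instance Definition _ := Measure.copy (with_sigma_finite sf) mu.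

HB.instance Definition _ := Measure_isSigmaFinite.Build _ _ _ (with_sigma_finite sf) sf.

End sigma_finite_copy.

Lemma sigma_finite_measure_ex dT (T : measurableType dT) (R : realType)
    (mu : {measure set T -> \bar R}) : sigma_finite setT mu ->
  exists nu : {sigma_finite_measure set T -> \bar R}, (nu : {measure set T -> \bar R}) = mu.
Proof.
move=> sf; exists (with_sigma_finite sf : {sigma_finite_measure set T -> \bar R}).
by case: mu sf.
Qed.

Theorem theorem4p2 (R : realType) (d : nat) (d_gt0 : (0 < d)%N)
    (M : lr_manifold R d)
    (v : {measure set (borel M) -> \bar R}) (v_volume : volume_measure v)
    (p : R -> M -> M -> R) (p_heat : heat_kernel v p) :
  (forall (k k1 k2 : {mfun borel M >-> R}),
     (forall x : M, k x = k1 x + k2 x) ->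
     (k2 : borel M -> R) \in Lfun v +oo%E ->
   forall (q : R) (Xi : M -> R) (Sigma : R -> R),
     admissible_exponent d q -> control_pair p Xi Sigma ->
     (weighted_norm v Xi q k1 < +oo)%E ->
   forall C : R, 0 < C -> kernel_bound p Xi Sigma C ->
   forall (s : R) (x : M), 0 < s <= 1 ->
     (\int[v]_y (p s x y * `|k y|)%:E
      <= (C `^ q^-1 * Sigma s `^ q^-1)%:E * weighted_norm v Xi q k1
         + 'N[v]_+oo[EFin \o k2])%E) /\
  (forall (q : R) (Xi : M -> R) (Sigma : R -> R),
     admissible_exponent d q -> control_pair p Xi Sigma ->
   forall k : {mfun borel M >-> R}, sum_Lq_Linfty v Xi q k ->
     kato_class v p (signed_density v k)).
Proof.
have [v' ev] := sigma_finite_measure_ex (volume_sigma_finite v_volume).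
move: v_volume p_heat; rewrite -{v}ev => vol hk.
split=> [k k1 k2 kE _ q Xi Sigma aq cp _ C C0 kb s x s01|q Xi Sigma aq cp k [k1 [k2 [W1 k2L kE]]]].
  have aE : {ae v', forall y, k y = k1 y + k2 y} by exact: aeW.
  exact: (kernel_sum_bound d_gt0 vol hk x (measurable_funPT k) (measurable_funPT k1)
    (measurable_funPT k2) aE aq cp C0 kb s01).
exact: (kato_density d_gt0 vol hk kE aq cp W1 k2L).
Qed.
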